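(* (Upper bound) Let $h_\varepsilon>0$ be a function of $\varepsilon\in(0,1)$ with $h_\varepsilon = O(\varepsilon^5)$ as $\varepsilon\to 0$. Then there is an embedded root finding algorithm for the $2$-NN model on the thin torus $[0,1]\times[0,h_\varepsilon]$, running in time $O(n^2+\log^2(1/\varepsilon))$, such that for all sufficiently small $\varepsilon>0$ it returns, for every $n$, a set $H(\varepsilon,n)$ of vertices of size $|H(\varepsilon,n)| = O\left(\frac{\log(1/\varepsilon)}{\log\log(1/\varepsilon)}\right)$, with $\liminf_{n\to\infty}\mathbf{P}\{1\in H(\varepsilon,n)\}\ge 1-\varepsilon$. (Lower bound) Let $h_\varepsilon>0$ be a function of $\varepsilon\in(0,1)$ with $h_\varepsilon = O(1/\log(1/\varepsilon))$ as $\varepsilon\to 0$. Then there is a constant $c>0$ such that for all sufficiently small $\varepsilon>0$ there is no embedded root finding procedure (of any computational complexity) for the $2$-NN model on the thin torus $[0,1]\times[0,h_\varepsilon]$ whose returned sets satisfy $|H(\varepsilon,n)| \le c\,\frac{\log(1/\varepsilon)}{\log\log(1/\varepsilon)}$ for all $n$ and for which $\liminf_{n\to\infty}\mathbf{P}\{1\in H(\varepsilon,n)\}\ge 1-\varepsilon$.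
   Context: The thin torus $[0,1]\times[0,h]$ is the rectangle with opposite sides identified, with the induced Euclidean torus distance $d(x,y) = \big(\min\{|x_1-y_1|,1-|x_1-y_1|\}^2 + \min\{|x_2-y_2|,h-|x_2-y_2|\}^2\big)^{1/2}$. The $2$-NN model on it: vertices $1,2,3,\dots$ arrive sequentially, each placed at an independent uniformly random position in the thin torus; for $i\ge2$, upon arrival vertex $i$ is connected by an edge to the closest vertex among $\{1,\dots,i-1\}$ (almost surely unique; ties are broken arbitrarily). The resulting tree on $\{1,\dots,n\}$ is $T_n$; the root is vertex $1$. $T_n^\circ$ denotes the corresponding unlabeled tree (arrival times removed). Embedded root finding: the input is $\varepsilon \in (0,1)$ and the unlabeled tree $T_n^\circ$ embedded in the space (the positions of the vertices and the edges between them, but not the arrival times). The output is a set $H(\varepsilon,n)$ of vertices whose size is bounded by a quantity independent of $n$, required to satisfy $\liminf_{n\to\infty}\mathbf{P}\{1\in H(\varepsilon,n)\} \ge 1-\varepsilon$. $\log$ is the natural logarithm. Running time counts elementary operations; arithmetic, comparisons, evaluation of elementary functions and of distances on real numbers cost one unit each. Constants in $O(\cdot)$ do not depend on $n$ or $\varepsilon$. *)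

(* Defs.v *)
From HB Require Import structures.
From mathcomp Require Import all_boot all_order all_algebra all_fingroup.
From mathcomp Require Import finmap.
From mathcomp Require Import all_classical all_reals all_analysis.

Set Implicit Arguments.
Unset Strict Implicit.
Unset Printing Implicit Defensive.

Import Order.TTheory GRing.Theory Num.Theory.
Import numFieldNormedType.Exports.

Local Open Scope classical_set_scope.
Local Open Scope ring_scope.

(** * The thin torus *)

(* The torus [0,1] x [0,h] with opposite sides identified, each point being
   given by its representative in the half-open rectangle. *)
Definition torus (R : realType) (h : R) : set (R * R) :=
  [set z | 0 <= z.1 < 1 /\ 0 <= z.2 < h].

Definition circle_dist (R : realType) (l a b : R) : R :=
  Num.min `|a - b| (l - `|a - b|).

Definition torus_dist (R : realType) (h : R) (a b : R * R) : R :=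
  Num.sqrt (circle_dist 1 a.1 b.1 ^+ 2 + circle_dist h a.2 b.2 ^+ 2).

(** * Nearest-neighbour trees *)

(* Arrival times start at 0 rather than 1: the root is vertex 0. *)

(* [x i] is the position of vertex [i] and [p i] the earlier vertex it is
   attached to; [p] may break ties in any way. *)
Definition nn_parents (R : realType) (h : R) (n : nat)
    (x : nat -> R * R) (p : nat -> nat) : Prop :=
  forall i, (0 < i < n)%N -> (p i < i)%N /\
    forall j, (j < i)%N ->
      torus_dist h (x i) (x (p i)) <= torus_dist h (x i) (x j).

Definition tree_edges (n : nat) (p : nat -> nat) : {set {set 'I_n}} :=
  [set [set u.1; u.2]%SET | u : 'I_n * 'I_n
                          & (0 < u.1)%N && (p u.1 == u.2)]%SET.

(* Renaming every vertex [i] to [s i]. *)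
Definition relabel_pos (V : Type) (n : nat) (s : {perm 'I_n})
    (x : n.-tuple V) : n.-tuple V := [tuple tnth x (s^-1%g i) | i < n].

Definition relabel_edges (n : nat) (s : {perm 'I_n})
    (e : {set {set 'I_n}}) : {set {set 'I_n}} :=
  [set s @: A | A : {set 'I_n} in e]%SET.

(* [(x, e)] is, up to a renaming of the vertices, a possible outcome of the
   process with [n] vertices: names carry no information on arrival times. *)
Definition nn_tree (R : realType) (h : R) (n : nat)
    (x : n.-tuple (R * R)) (e : {set {set 'I_n}}) : Prop :=
  exists (y : nat -> R * R) (p : nat -> nat) (s : {perm 'I_n}),
    [/\ forall i, (i < n)%N -> torus h (y i),
        nn_parents h n y p,
        x = relabel_pos s [tuple y i | i < n] &
        e = relabel_edges s (tree_edges n p)].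

(* The random process: i.i.d. uniform positions [X] in the torus of height
   [h], and parents [p] (random, to allow for arbitrary tie-breaking). *)
Record nn_model (R : realType) d (T : measurableType d) (P : probability T R)
    (h : R) (X : nat -> T -> R * R) (p : nat -> T -> nat) : Prop := NNModel {
  nn_pos_measurable : forall i, measurable_fun setT (X i);
  nn_pos_torus : forall i w, torus h (X i w);
  nn_pos_uniform : forall i (B : set (R * R)), measurable B ->
    (P (X i @^-1` B) =
     (h^-1)%:E * (lebesgue_measure \x lebesgue_measure) (B `&` torus h))%E;
  nn_pos_independent : forall (J : {fset nat}) (B : nat -> set (R * R)),
    (forall i, measurable (B i)) ->
    (P (\bigcap_(i in [set` J]) X i @^-1` B i) =
     \prod_(i <- J) P (X i @^-1` B i))%E;
  nn_par_measurable : forall i k, measurable (p i @^-1` [set k]);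
  nn_par_nearest : forall n w, nn_parents h n (X^~ w) (p^~ w) }.

(** * Embedded root finding *)

(* A map selecting a set of vertices of an embedded tree.  An unlabeled
   embedded tree is a labeled one up to renaming, so a procedure on unlabeled
   trees is an equivariant map on labeled ones.  Borel measurability makes
   success probabilities meaningful. *)
Definition procedure (R : realType) : Type :=
  forall n, n.-tuple (R * R) -> {set {set 'I_n}} -> {set 'I_n}.

Record root_procedure (R : realType) (H : procedure R) : Prop :=
  RootProcedure {
  procedure_equivariant : forall n (s : {perm 'I_n}) x e,
    H n (relabel_pos s x) (relabel_edges s e) = [set s i | i in H n x e]%SET;
  procedure_measurable : forall n (e : {set {set 'I_n}}) (i : 'I_n),
    measurable [set x : n.-tuple (R * R) | i \in H n x e] }.

Definition size_at_most (R : realType) (h : R) (H : procedure R) (b : R) :=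
  forall n x e, @nn_tree R h n x e -> #|H n x e|%:R <= b.

(* liminf of the probability that the root is returned; term [n] of the
   sequence is about the tree on [n + 1] vertices. *)
Definition liminf_success (R : realType) d (T : measurableType d)
    (P : probability T R) (X : nat -> T -> R * R) (p : nat -> T -> nat)
    (H : procedure R) : \bar R :=
  limn_einf (fun n => P [set w | ord0 \in
    H n.+1 [tuple X i w | i < n.+1] (tree_edges n.+1 (p^~ w))]).

(** * Real RAM programs *)

(* Imperative programs over finitely many unbounded arrays of natural numbers
   (used for addressing and counting) and of exact real numbers, all initially
   zero outside the input.  Integer arithmetic is limited to addition and
   truncated subtraction, and there is no conversion from reals to integers
   (no floor); the only literals are natural numbers. *)

Inductive elementary := Exp | Ln | Sqrt | Sin | Cos | Atan.

Inductive iexpr :=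
| ILit of nat
| IGet of nat & iexpr            (* cell of a given integer array *)
| IAdd of iexpr & iexpr
| ISub of iexpr & iexpr.

Inductive rexpr :=
| RNat of iexpr                  (* natural number read as a real *)
| RGet of nat & iexpr            (* cell of a given real array *)
| RAdd of rexpr & rexpr
| RSub of rexpr & rexpr
| RMul of rexpr & rexpr
| RDiv of rexpr & rexpr
| RFun of elementary & rexpr
| RDist of rexpr & rexpr & rexpr & rexpr & rexpr.

Inductive bexpr :=
| BILt of iexpr & iexpr
| BRLt of rexpr & rexpr
| BNot of bexpr
| BAnd of bexpr & bexpr.

Inductive cmd :=
| Skip
| ISet of nat & iexpr & iexpr    (* array, index, value *)
| RSet of nat & iexpr & rexpr
| Seq of cmd & cmd
| If of bexpr & cmd & cmd
| While of bexpr & cmd.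

Record state (R : realType) :=
  State { ints : nat -> nat -> nat; reals : nat -> nat -> R }.

Definition set_int (R : realType) (st : state R) (a i v : nat) : state R :=
  State (fun b j => if (b == a) && (j == i) then v else ints st b j)
        (reals st).

Definition set_real (R : realType) (st : state R) (a i : nat) (v : R) :
    state R :=
  State (ints st)
        (fun b j => if (b == a) && (j == i) then v else reals st b j).

Definition elementary_fun (R : realType) (f : elementary) : R -> R :=
  match f with
  | Exp => @expR R | Ln => @ln R | Sqrt => @Num.sqrt R
  | Sin => @sin R | Cos => @cos R | Atan => @atan R
  end.

Fixpoint ieval (R : realType) (st : state R) (e : iexpr) : nat :=
  match e with
  | ILit k => k
  | IGet a i => ints st a (ieval st i)
  | IAdd e1 e2 => (ieval st e1 + ieval st e2)%N
  | ISub e1 e2 => (ieval st e1 - ieval st e2)%N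
  end.

Fixpoint reval (R : realType) (st : state R) (e : rexpr) : R :=
  match e with
  | RNat i => (ieval st i)%:R
  | RGet a i => reals st a (ieval st i)
  | RAdd e1 e2 => reval st e1 + reval st e2
  | RSub e1 e2 => reval st e1 - reval st e2
  | RMul e1 e2 => reval st e1 * reval st e2
  | RDiv e1 e2 => reval st e1 / reval st e2
  | RFun f e1 => elementary_fun f (reval st e1)
  | RDist h a1 a2 b1 b2 =>
      torus_dist (reval st h) (reval st a1, reval st a2)
                 (reval st b1, reval st b2)
  end.

Fixpoint beval (R : realType) (st : state R) (b : bexpr) : bool :=
  match b with
  | BILt e1 e2 => (ieval st e1 < ieval st e2)%N
  | BRLt e1 e2 => reval st e1 < reval st e2
  | BNot b1 => ~~ beval st b1
  | BAnd b1 b2 => beval st b1 && beval st b2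
  end.

(* Every literal, memory access and operation costs one unit. *)
Fixpoint icost (e : iexpr) : nat :=
  match e with
  | ILit _ => 1
  | IGet _ i => (icost i).+1
  | IAdd e1 e2 | ISub e1 e2 => (icost e1 + icost e2).+1
  end.

Fixpoint rcost (e : rexpr) : nat :=
  match e with
  | RNat i | RGet _ i => (icost i).+1
  | RAdd e1 e2 | RSub e1 e2 | RMul e1 e2 | RDiv e1 e2 =>
      (rcost e1 + rcost e2).+1
  | RFun _ e1 => (rcost e1).+1
  | RDist h a1 a2 b1 b2 =>
      (rcost h + rcost a1 + rcost a2 + rcost b1 + rcost b2).+1
  end.

Fixpoint bcost (b : bexpr) : nat :=
  match b with
  | BILt e1 e2 => (icost e1 + icost e2).+1
  | BRLt e1 e2 => (rcost e1 + rcost e2).+1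
  | BNot b1 => (bcost b1).+1
  | BAnd b1 b2 => (bcost b1 + bcost b2).+1
  end.

(* [exec c st t st']: from [st], [c] halts in [st'] after [t] units of time. *)
Inductive exec (R : realType) : cmd -> state R -> nat -> state R -> Prop :=
| ExecSkip st : exec Skip st 1 st
| ExecISet a i e st :
    exec (ISet a i e) st (icost i + icost e).+1
         (set_int st a (ieval st i) (ieval st e))
| ExecRSet a i e st :
    exec (RSet a i e) st (icost i + rcost e).+1
         (set_real st a (ieval st i) (reval st e))
| ExecSeq c1 c2 st1 st2 st3 t1 t2 :
    exec c1 st1 t1 st2 -> exec c2 st2 t2 st3 ->
    exec (Seq c1 c2) st1 (t1 + t2) st3
| ExecIf b c1 c2 st st' t :
    exec (if beval st b then c1 else c2) st t st' ->
    exec (If b c1 c2) st (bcost b + t) st'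
| ExecWhileFalse b c st :
    beval st b = false -> exec (While b c) st (bcost b) st
| ExecWhileTrue b c st1 st2 st3 t1 t2 :
    beval st1 b = true ->
    exec c st1 t1 st2 -> exec (While b c) st2 t2 st3 ->
    exec (While b c) st1 (bcost b + t1 + t2) st3.

(* Input.  Integer arrays: 0 holds the number of vertices in cell 0; 1 and 2
   hold the endpoints of the edges.  Real arrays: 0 holds [eps] and the height
   [h] of the torus; 1 and 2 hold the coordinates of the vertices. *)
Definition input (R : realType) (eps h : R) (n : nat)
    (x : n.-tuple (R * R)) (es : seq ('I_n * 'I_n)) : state R :=
  State (fun a i => match a with
           | 0%N => nth 0%N [:: n] i
           | 1%N => nth 0%N [seq val u.1 | u <- es] i
           | 2%N => nth 0%N [seq val u.2 | u <- es] i
           | _ => 0%N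
         end)
        (fun a i => match a with
           | 0%N => nth 0 [:: eps; h] i
           | 1%N => nth 0 [seq z.1 | z <- x] i
           | 2%N => nth 0 [seq z.2 | z <- x] i
           | _ => 0
         end).

(* Output: the vertices flagged by a nonzero cell in integer array 3. *)
Definition output (R : realType) (n : nat) (st : state R) : {set 'I_n} :=
  [set i : 'I_n | ints st 3 i != 0%N]%SET.

(* [es] lists each edge of [e] exactly once, in any order and orientation. *)
Definition lists_edges (n : nat) (es : seq ('I_n * 'I_n))
    (e : {set {set 'I_n}}) : Prop :=
  perm_eq [seq [set u.1; u.2]%SET | u <- es] (enum e).

(* Whatever the names of the vertices and the listing of the edges, program
   [c] returns [H n x e] in time at most [time n]. *)
Definition computes_within (R : realType) (c : cmd) (eps h : R)
    (H : procedure R) (time : nat -> R) : Prop :=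
  forall n (x : n.-tuple (R * R)) e es, (0 < n)%N ->
    nn_tree h x e -> lists_edges es e ->
    exists t st, [/\ exec c (input eps h x es) t st,
      output n st = H n x e & t%:R <= time n].

(* Main.v *)
Require Import Defs.
From HB Require Import structures.
From mathcomp Require Import all_boot all_order all_algebra all_fingroup.
From mathcomp Require Import finmap.
From mathcomp Require Import all_classical all_reals all_analysis.
From mathcomp Require Import measurable_realfun ring lra zify.

Set Implicit Arguments.
Unset Strict Implicit.
Unset Printing Implicit Defensive.

Import Order.TTheory GRing.Theory Num.Theory.
Import numFieldNormedType.Exports.

Local Open Scope classical_set_scope.
Local Open Scope ring_scope.

(** On a thin torus the tree looks like a nearest-neighbour tree on a circle of
    length 1 as long as one only looks at edges much longer than the height
    [h].  Arcs, angles and quarters below refer to first coordinates.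

    Upper bound.  Let an edge of length at least [eta = eps^2] cover the points
    strictly inside the shorter of the two arcs between its ends, and call a
    vertex exposed when no edge covers it.  The finder returns the exposed
    vertices that have fewer than [B = 8 ln(1/eps) / ln ln(1/eps)] exposed
    vertices in the quarter circle that follows them, or in the one that
    precedes them ([candidates]).  There are at most [8 (B + 1)] of them in any
    tree: among those of one kind in a fixed quarter of the circle, an extreme
    one has all the others in its run ([card_candidates]).

    The root is found for the following reason ([root_is_candidate]).  Lift the
    tree to the real line, every edge moving along its shorter arc.  Among the
    first [m = O(ln(1/eps))] vertices one is very likely to be at distance at
    least 1/4 from the root.  The tree path from the root to this vertex sweeps
    a quarter circle on one side of the root, so that the exposed vertices of
    this quarter are all on the path ([path_covers]) and follow each other in
    their order of arrival.  If there were [N] of them, then [N] of the first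
    [m] vertices would have angles from the root monotone in their arrival
    times.  By exchangeability this has probability at most [1/N!] for a given
    set of [N] indices ([prob_le_monotone]), and ['C(m, N) / N!] is [O(eps^2)]
    for [N] close to [B] ([monotone_term]).  The root could only be covered by
    an edge whose older end is within [h] of it ([root_edges_short]).  None of
    the first [eps^-3] vertices is likely to be so close to the root, and later
    vertices only have edges shorter than [eta].

    All this takes a constant number of comparisons for every pair of a vertex
    with an edge or a vertex, hence quadratic time ([finder_computes]).

    Lower bound.  Let [K] be the least integer above the allowed size and
    consider [K] equally spaced narrow slots on the circle.  For each [r < K],
    let the first [K] vertices fill the slots in the order
    [r, r+1, ..., K-1, r-1, ..., 0].  Each of these orders has probability
    [(64 K)^-K > eps] and builds the same path through the slots.  Since ties
    have probability zero ([no_ties]), the rest of the tree is then determined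
    by the positions, so that the orders lead to the same embedded tree
    ([relabel_nearest_edges]), but the root is in slot [r].  By exchangeability
    these scenarios are equally likely, and a set of fewer than [K] vertices
    misses one of the slots, so that the root is missed with probability at
    least [(64 K)^-K] ([prob_success_le]). *)

(** * The finder as a map on embedded trees *)

Section Procedure.
Context {R : realType}.
Implicit Types (a b c : R).

(** The point [c] is strictly inside the counterclockwise arc from [a] to [b], and
    this arc has length at most 1/2.  The second disjunct is the case where the
    arc passes through the point 0 of the circle. *)
Definition short_arc a b c : bool :=
  (b - a <= 1 / 2) && ((a < c) && (c < b))
  || (b - a < - (1 / 2)) && ((a < c) || (c < b)).

Definition spans a b c : bool := short_arc a b c || short_arc b a c.

Lemma spansC a b c : spans a b c = spans b a c.
Proof. by rewrite /spans orbC. Qed.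

(** For abscissae in [[0, 1)]: [b] is at counterclockwise distance less than 1/4
    from [a]. *)
Definition cw a b : bool :=
  (0 <= b - a) && (b - a < 1 / 4) || (b - a < - (3 / 4)).

Variables (eta h B : R).

Section Tree.
Variables (n : nat) (x : n.-tuple (R * R)) (e : {set {set 'I_n}}).

Definition covers (a b v : 'I_n) : bool :=
  (eta <= torus_dist h (tnth x a) (tnth x b))
  && spans (tnth x a).1 (tnth x b).1 (tnth x v).1.

Definition exposed (v : 'I_n) : bool :=
  ~~ [exists a, exists b, ([set a; b]%SET \in e) && covers a b v].

Definition cw_run (v : 'I_n) : {set 'I_n} :=
  [set w | [&& w != v, exposed w & cw (tnth x v).1 (tnth x w).1]]%SET.

Definition ccw_run (v : 'I_n) : {set 'I_n} :=
  [set w | [&& w != v, exposed w & cw (tnth x w).1 (tnth x v).1]]%SET.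

Definition candidates : {set 'I_n} :=
  [set v | exposed v && ((#|cw_run v|%:R < B) || (#|ccw_run v|%:R < B))]%SET.

End Tree.

(** The [f]-least element of [S] is related by [r] to all the others, so it
    bounds their number. *)
Lemma card_few_after (T : finType) (f : T -> R) (r : rel T) (E : pred T)
    (S : {set T}) : 0 <= B ->
  (forall v, v \in S -> E v) ->
  (forall v w, v \in S -> w \in S -> f v <= f w -> r v w) ->
  (forall v, v \in S -> #|[set w | [&& w != v, E w & r v w]]%SET|%:R < B) ->
  #|S|%:R <= B + 1.
Proof.
move=> B0 SE Sr Sc; have [->|[v0 v0S]] := set_0Vmem S.
  by rewrite cards0 addr_ge0.
case: (@Order.TotalTheory.arg_minP _ _ _ v0 (mem S) f v0S) => v vS0 vmin; have vS : v \in S := vS0.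
rewrite (cardsD1 v) vS natrD addrC lerD2r.
apply: le_trans (ltW (Sc v vS)); rewrite ler_nat subset_leq_card //.
apply/fintype.subsetP => w; rewrite !inE => /andP[-> wS] /=.
by rewrite SE // Sr // vmin.
Qed.

(** Each candidate is in one of four quarters of the circle and has a short run
    on one of two sides.  [card_few_after] applies to each of the eight classes,
    with the first coordinate or its opposite as [f]. *)
Lemma card_candidates n (x : n.-tuple (R * R)) e : 0 <= B ->
  (forall v, 0 <= (tnth x v).1 < 1) ->
  #|candidates x e|%:R <= 8 * (B + 1).
Proof.
move=> B0 x01.
pose q (j : 'I_4) := [set v | (j%:R / 4 <= (tnth x v).1)
   && ((tnth x v).1 < (j.+1)%:R / 4)]%SET.
have qE j v : v \in q j -> j%:R / 4 <= (tnth x v).1 /\ (tnth x v).1 < (j%:R + 1) / 4.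
  by rewrite inE natr1 => /andP[].
pose S1 j := [set v | [&& exposed x e v, v \in q j & #|cw_run x e v|%:R < B]]%SET.
pose S2 j := [set v | [&& exposed x e v, v \in q j & #|ccw_run x e v|%:R < B]]%SET.
have S1B j : #|S1 j|%:R <= B + 1.
  apply: (@card_few_after _ (fun v => (tnth x v).1)
     (fun v w => cw (tnth x v).1 (tnth x w).1) (exposed x e)) => // v.
  - by rewrite inE => /and3P[].
  - move=> w; rewrite [v \in _]inE => /and3P[_ /qE[v1 v2] _].
    rewrite inE => /and3P[_ /qE[w1 w2] _] vw; rewrite /cw; apply/orP; left.
    by apply/andP; split; lra.
  - by rewrite inE => /and3P[].
have S2B j : #|S2 j|%:R <= B + 1.
  apply: (@card_few_after _ (fun v => - (tnth x v).1)
     (fun v w => cw (tnth x w).1 (tnth x v).1) (exposed x e)) => // v.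
  - by rewrite inE => /and3P[].
  - move=> w; rewrite [v \in _]inE => /and3P[_ /qE[v1 v2] _].
    rewrite inE => /and3P[_ /qE[w1 w2] _] vw; rewrite /cw; apply/orP; left.
    by apply/andP; split; lra.
  - by rewrite inE => /and3P[].
have sub : candidates x e \subset (\bigcup_j (S1 j :|: S2 j))%SET.
  apply/fintype.subsetP => v; rewrite inE => /andP[ev cv].
  have [j vj] : exists j, v \in q j.
    have /andP[v0 v1] := x01 v.
    have [c1|c1] := ltP (tnth x v).1 (1 / 4).
      by exists (inord 0); rewrite inE inordK //; apply/andP; split; lra.
    have [c2|c2] := ltP (tnth x v).1 (2 / 4).
      by exists (inord 1); rewrite inE inordK //; apply/andP; split; lra.
    have [c3|c3] := ltP (tnth x v).1 (3 / 4).
      by exists (inord 2); rewrite inE inordK //; apply/andP; split; lra.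
    by exists (inord 3); rewrite inE inordK //; apply/andP; split; lra.
  apply/bigcupP; exists j => //; rewrite inE.
  by case/orP: cv => cv; apply/orP; [left|right]; rewrite inE ev vj.
have: (#|candidates x e| <= \sum_j (#|S1 j| + #|S2 j|))%N.
  apply: leq_trans (subset_leq_card sub) _.
  elim/big_ind2 : _ => [|A a C c Aa Cc|j _]; first by rewrite cards0.
  - by apply: leq_trans (leq_add Aa Cc); exact: leq_card_setU.
  - exact: leq_card_setU.
rewrite -(ler_nat R) => /le_trans; apply.
rewrite natr_sum big_ord_recl !big_ord_recl big_ord0 !natrD.
have := S1B ord0; have := S2B ord0.
set i1 := lift _ _; have := S1B i1; have := S2B i1.
set i2 := lift _ _; have := S1B i2; have := S2B i2.
set i3 := lift _ _; have := S1B i3; have := S2B i3.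
lra.
Qed.

Lemma tnth_relabel (V : Type) n (s : {perm 'I_n}) (x : n.-tuple V) v :
  tnth (relabel_pos s x) (s v) = tnth x v.
Proof. by rewrite tnth_mktuple permK. Qed.

Lemma mem_relabel_edges n (s : {perm 'I_n}) (e : {set {set 'I_n}}) (a b : 'I_n) :
  ([set s a; s b]%SET \in relabel_edges s e) = ([set a; b]%SET \in e).
Proof.
have -> : [set s a; s b]%SET = s @: [set a; b]%SET.
  by rewrite imsetU !imset_set1.
rewrite /relabel_edges mem_imset //.
exact: imset_inj perm_inj.
Qed.

End Procedure.

Section Equivariance.
Context {R : realType}.
Variables (eta h B : R).

Lemma exposed_relabel n (s : {perm 'I_n}) (x : n.-tuple (R * R)) e v :
  exposed eta h (relabel_pos s x) (relabel_edges s e) (s v) =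
  exposed eta h x e v.
Proof.
rewrite /exposed; congr (~~ _); apply/existsP/existsP => -[a /existsP[b ab]].
  exists (s^-1 a)%g; apply/existsP; exists (s^-1 b)%g; move: ab.
  by rewrite -{1 2}(permKV s a) -{1 2}(permKV s b) mem_relabel_edges /covers !tnth_relabel.
exists (s a); apply/existsP; exists (s b).
by rewrite mem_relabel_edges /covers !tnth_relabel.
Qed.

Lemma candidates_equivariant n (s : {perm 'I_n}) (x : n.-tuple (R * R)) e :
  candidates eta h B (relabel_pos s x) (relabel_edges s e) =
  [set s i | i in candidates eta h B x e]%SET.
Proof.
have cwE v : cw_run eta h (relabel_pos s x) (relabel_edges s e) (s v) =
    [set s i | i in cw_run eta h x e v]%SET.
  apply/setP => w; rewrite -(permKV s w) mem_imset ?inE; last exact: perm_inj.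
  by rewrite exposed_relabel !tnth_relabel (inj_eq perm_inj).
have ccwE v : ccw_run eta h (relabel_pos s x) (relabel_edges s e) (s v) =
    [set s i | i in ccw_run eta h x e v]%SET.
  apply/setP => w; rewrite -(permKV s w) mem_imset ?inE; last exact: perm_inj.
  by rewrite exposed_relabel !tnth_relabel (inj_eq perm_inj).
apply/setP => w; rewrite -(permKV s w) mem_imset ?inE; last exact: perm_inj.
by rewrite exposed_relabel cwE ccwE !card_imset //; exact: perm_inj.
Qed.

End Equivariance.

(** * Short arcs and lifted tree paths *)

Section Geometry.
Context {R : realType}.
Implicit Types (a b c : R) (k : int).

(** Signed length of the shorter arc from [a] to [b]. *)
Definition displacement a b : R :=
  if `|b - a| <= 1 / 2 then b - a else
  if 1 / 2 < b - a then b - a - 1 else b - a + 1.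

(** Counterclockwise distance from [a] to [b]. *)
Definition angle a b : R := if a <= b then b - a else b - a + 1.

Lemma circle_dist1_lift a b k : 0 <= a < 1 -> 0 <= b < 1 ->
  circle_dist 1 a b <= `|b - a + k%:~R|.
Proof.
move=> a01 b01; rewrite /circle_dist ge_min.
have [k0|k0|->] := ltgtP k 0; last by rewrite addr0 distrC lexx.
- have : (k%:~R : R) <= (-1)%:~R by rewrite ler_int; lia.
  rewrite rmorphN /= => k1; apply/orP; right.
  have -> : `|b - a + k%:~R| = - (b - a + k%:~R) by rewrite ler0_norm //; lra.
  by have := ler_norm (a - b); have := ler_norm (b - a); rewrite (distrC b a); lra.
- have : (1%:~R : R) <= k%:~R by rewrite ler_int; lia.
  move=> /= k1; apply/orP; right.
  have -> : `|b - a + k%:~R| = (b - a + k%:~R) by rewrite ger0_norm //; lra.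
  by have := ler_norm (a - b); have := ler_norm (b - a); rewrite (distrC b a); lra.
Qed.

Lemma displacement_lift a b : exists k, displacement a b = b - a + k%:~R.
Proof.
rewrite /displacement; case: ifP => _; first by exists 0; rewrite addr0.
by case: ifP => _; [exists (-1)|exists 1]; rewrite ?rmorphN.
Qed.

(** The shorter arc between [a] and [b], lifted to the line from [a] on, passes
    over a lift of [c] exactly when it covers [c]. *)
Lemma spans_step a b c k : 0 <= a < 1 -> 0 <= b < 1 -> 0 <= c < 1 ->
  (a < c + k%:~R < a + displacement a b) \/
  (a + displacement a b < c + k%:~R < a) -> spans a b c.
Proof.
move=> /andP[a0 a1] /andP[b0 b1] /andP[c0 c1].
rewrite /displacement /spans /short_arc.
case: ifPn; [rewrite ler_norml|rewrite -ltNge ltr_normr opprB].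
  move=> /andP[ab1 ab2] bet.
  have k0 : k = 0.
    have : (-1%:~R : R) < k%:~R by rewrite /=; case: bet => /andP[]; lra.
    have : (k%:~R : R) < 1%:~R by rewrite /=; case: bet => /andP[]; lra.
    by rewrite -rmorphN /= !ltr_int; lia.
  case: bet; rewrite k0 => /andP[h1 h2].
    apply/orP; left; apply/orP; left; apply/andP; split; first lra.
    by apply/andP; split; lra.
  apply/orP; right; apply/orP; left; apply/andP; split; first lra.
  by apply/andP; split; lra.
case: ifPn => [ab _|]; rewrite -?leNgt.
  case => /andP[h1 h2]; first by exfalso; lra.
  apply/orP; right; apply/orP; right; apply/andP; split; first lra.
  have : k = 0 \/ k = -1.
    have : (-2%:~R : R) < k%:~R by rewrite /=; lra.
    have : (k%:~R : R) < 1%:~R by rewrite /=; lra.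
    by rewrite -rmorphN /= !ltr_int; lia.
  move=> [k0|k0]; move: h1 h2; rewrite k0 ?rmorphN /= => h1 h2; apply/orP; [right|left]; lra.
move=> ab1 /orP[?|ab]; first by move=> _; lra.
case => /andP[h1 h2]; last by exfalso; lra.
apply/orP; left; apply/orP; right; apply/andP; split; first lra.
have : k = 0 \/ k = 1.
  have : (-1%:~R : R) < k%:~R by rewrite /=; lra.
  have : (k%:~R : R) < 2%:~R by rewrite /=; lra.
  by rewrite -rmorphN /= !ltr_int; lia.
move=> [k0|k0]; move: h1 h2; rewrite k0 ?rmorphN /= => h1 h2; apply/orP; [left|right]; lra.
Qed.

Lemma spans_dist a b c : 0 <= a < 1 -> 0 <= b < 1 -> 0 <= c < 1 -> spans a b c ->
  circle_dist 1 a b = circle_dist 1 a c + circle_dist 1 b c.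
Proof.
move=> /andP[a0 a1] /andP[b0 b1] /andP[c0 c1].
move=> sp.
have nE (r : R) : (0 <= r /\ `|r| = r) \/ (r < 0 /\ `|r| = - r).
  have [|] := leP 0 r => r0; first by left; rewrite ger0_norm.
  by right; rewrite ltr0_norm.
wlog {sp} ab : a b a0 a1 b0 b1 / short_arc a b c => [hw|].
  case/orP: sp => ab; first exact: hw.
  have cC (r1 r2 : R) : circle_dist 1 r1 r2 = circle_dist 1 r2 r1.
    by rewrite /circle_dist distrC.
  by rewrite cC addrC; exact: hw.
rewrite /circle_dist /Num.min.
case/orP: ab => /andP[ab1].
  move=> /andP[ac cb].
  rewrite (ltr0_norm (_ : a - b < 0)) ?(ltr0_norm (_ : a - c < 0)) ?(gtr0_norm (_ : 0 < b - c)); try lra.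
  by do 3 (case: ifPn; rewrite -?leNgt => ?); lra.
rewrite (gtr0_norm (_ : 0 < a - b)); last lra.
case/orP => ac.
  rewrite (ltr0_norm (_ : a - c < 0)) ?(ltr0_norm (_ : b - c < 0)); try lra.
  by do 3 (case: ifPn; rewrite -?leNgt => ?); lra.
rewrite (gtr0_norm (_ : 0 < a - c)) ?(gtr0_norm (_ : 0 < b - c)); try lra.
by do 3 (case: ifPn; rewrite -?leNgt => ?); lra.
Qed.

End Geometry.

Section Path.
Context {R : realType}.
Variables (n : nat) (xs : nat -> R) (p : nat -> nat).
Hypothesis xs01 : forall i, (i < n)%N -> 0 <= xs i < 1.
Hypothesis xs_inj : forall i j, (i < n)%N -> (j < n)%N -> xs i = xs j -> i = j.
Hypothesis p_lt : forall i, (0 < i < n)%N -> (p i < i)%N.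

(** Vertex [i] is lifted to [s i] by following the edges of the tree from the
    root, each along its shorter arc.  The lift remembers on which side of the
    circle the tree path from the root reaches [i]. *)
Definition lifting (s : nat -> R) : Prop := s 0%N = 0 /\
  forall i, (0 < i < n)%N -> s i = s (p i) + displacement (xs (p i)) (xs i).

Lemma lifting_exists : exists s, lifting s.
Proof.
suff : forall m, (m <= n)%N -> exists s : nat -> R, s 0%N = 0 /\
    forall i, (0 < i < m)%N -> s i = s (p i) + displacement (xs (p i)) (xs i).
  by move=> /(_ n (leqnn n)).
elim=> [|m IHm] mn; first by exists (fun=> 0); split=> [|i]; [|lia].
have [s [s0 sS]] := IHm (ltnW mn).
case: (posnP m) => [->|m0]; first by exists s; split=> [|i]; [exact: s0|lia].
exists (fun i => if i == m then s (p m) + displacement (xs (p m)) (xs m) else s i).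
rewrite [0%N == m]eq_sym (gtn_eqF m0); split=> // i /andP[i0]; rewrite ltnS leq_eqVlt.
have im i' : (0 < i' <= m)%N -> (p i' == m) = false.
  move=> /andP[i'0 i'm]; apply: ltn_eqF; apply: (leq_trans _ (i'm)).
  by apply: p_lt; rewrite i'0 (leq_ltn_trans i'm).
case/orP => [/eqP ->|lim]; first by rewrite eqxx im // m0 leqnn.
by rewrite (ltn_eqF lim) im ?i0 1?ltnW // sS // i0.
Qed.

Variable s : nat -> R.
Hypothesis s_lifting : lifting s.

Lemma lifting_mod i : (i < n)%N -> exists k : int, s i = xs i - xs 0 + k%:~R.
Proof.
have [s0 sS] := s_lifting.
elim/ltn_ind: i => -[|i] IH lin; first by exists 0; rewrite s0 subrr add0r.
have lpi : (p i.+1 < i.+1)%N by exact: p_lt.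
have [k sk] := IH _ lpi (ltn_trans lpi lin).
have [k' dk'] := displacement_lift (xs (p i.+1)) (xs i.+1).
exists (k + k'); rewrite sS // sk dk' rmorphD /=; ring.
Qed.

(** Discrete intermediate value theorem: the tree path from the root to [w]
    passes over every lift [t] between 0 and [s w], either strictly inside an
    edge or at a vertex.  In the latter case the vertex is an ancestor of [w],
    hence older, and [t] is its own lift. *)
Lemma path_covers v (k : int) w : (v < n)%N -> (w < n)%N ->
  let t := xs v - xs 0 + k%:~R in
  (0 < t < s w \/ s w < t < 0) ->
  (exists j, (0 < j <= w)%N /\ spans (xs j) (xs (p j)) (xs v)) \/
  (v < w)%N /\ s v = t.
Proof.
move=> vn + t; have [s0 sS] := s_lifting.
elim/ltn_ind: w => -[|w] IH wn.
  by rewrite s0 => -[] /andP[h1 h2]; have := lt_trans h1 h2; rewrite ltxx.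
have pw : (p w.+1 < w.+1)%N by exact: p_lt.
have pn := ltn_trans pw wn.
have sw : s w.+1 = _ := sS w.+1 wn.
move=> tw.
have [tp|tp|tp] := ltgtP t (s (p w.+1)); last first.
  have [k' spk] := lifting_mod pn.
  have vp : v = p w.+1.
    apply: xs_inj => //.
    have /andP[v0 v1] := xs01 vn; have /andP[p0 p1] := xs01 pn.
    move: tp; rewrite /t spk => tp.
    have kk : (k' - k)%:~R = xs v - xs (p w.+1) by rewrite rmorphB /=; lra.
    have : ((-1)%:~R : R) < (k' - k)%:~R by rewrite kk /= rmorphN /=; lra.
    have : ((k' - k)%:~R : R) < 1%:~R by rewrite kk /=; lra.
    rewrite !ltr_int => k1 k2; have k0 : k' - k = 0 by lia.
    by move: kk; rewrite k0 /=; lra.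
  by right; rewrite vp.
all: have [cov|cov] : (0 < t < s (p w.+1) \/ s (p w.+1) < t < 0) \/
      (s (p w.+1) < t < s w.+1 \/ s w.+1 < t < s (p w.+1)).
- case: tw => /andP[t1 t2]; first by right; left; rewrite t2 tp.
  by left; right; rewrite t2 tp.
- case: (IH _ pw pn cov) => [[j [/andP[j0 jp] sp]]|[vp sv]].
    by left; exists j; rewrite j0 (leq_trans jp) // ltnW.
  by right; rewrite (ltn_trans vp).
- have [k' spk] := lifting_mod pn.
  left; exists w.+1; rewrite leqnn; split=> //; rewrite spansC.
  apply: (@spans_step _ _ _ _ (k - k')); rewrite ?xs01 //.
  by case: cov => /andP[]; rewrite sw spk /t => h1 h2; [left|right];
    rewrite rmorphB /=; apply/andP; split; lra.
- case: tw => /andP[t1 t2]; first by left; left; rewrite t1 tp.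
  by right; right; rewrite t1 tp.
- case: (IH _ pw pn cov) => [[j [/andP[j0 jp] sp]]|[vp sv]].
    by left; exists j; rewrite j0 (leq_trans jp) // ltnW.
  by right; rewrite (ltn_trans vp).
- have [k' spk] := lifting_mod pn.
  left; exists w.+1; rewrite leqnn; split=> //; rewrite spansC.
  apply: (@spans_step _ _ _ _ (k - k')); rewrite ?xs01 //.
  by case: cov => /andP[]; rewrite sw spk /t => h1 h2; [left|right];
    rewrite rmorphB /=; apply/andP; split; lra.
Qed.

End Path.

Section Distances.
Context {R : realType}.
Implicit Types (a b c : R).

Lemma circle_dist_ge0 (l a b : R) : 0 <= a < l -> 0 <= b < l -> 0 <= circle_dist l a b.
Proof.
move=> /andP[a0 a1] /andP[b0 b1]; rewrite /circle_dist le_min normr_ge0 /=.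
by rewrite subr_ge0 ler_norml; apply/andP; split; lra.
Qed.

Lemma circle_distC (l a b : R) : circle_dist l a b = circle_dist l b a.
Proof. by rewrite /circle_dist distrC. Qed.

Lemma circle_dist_le_half (l a b : R) : circle_dist l a b <= l / 2.
Proof. by 
by rewrite /circle_dist ge_min; apply/orP; case: (lerP `|a - b| (l / 2)) => ab; [left|right; lra].
Qed.

Lemma torus_distC (h : R) (z w : R * R) : torus_dist h z w = torus_dist h w z.
Proof. by rewrite /torus_dist (circle_distC 1) (circle_distC h). Qed.

Lemma circle_dist_le_torus (h : R) (z w : R * R) : torus h z -> torus h w ->
  circle_dist 1 z.1 w.1 <= torus_dist h z w.
Proof.
move=> [z1 z2] [w1 w2]; rewrite /torus_dist.
rewrite -[leLHS]ger0_norm ?circle_dist_ge0 // -sqrtr_sqr.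
by rewrite ler_sqrt ?addr_ge0 ?sqr_ge0 // lerDl sqr_ge0.
Qed.

(** With [circle_dist_le_torus], horizontal distance is torus distance up to an
    error of [h / 2]. *)
Lemma torus_dist_le_circle (h : R) (z w : R * R) : torus h z -> torus h w ->
  torus_dist h z w <= circle_dist 1 z.1 w.1 + h / 2.
Proof.
move=> [z1 z2] [w1 w2]; rewrite /torus_dist.
have c0 : 0 <= circle_dist 1 z.1 w.1 by exact: circle_dist_ge0.
have d0 : 0 <= circle_dist h z.2 w.2 by exact: circle_dist_ge0.
have d1 : circle_dist h z.2 w.2 <= h / 2 by exact: circle_dist_le_half.
apply: (@le_trans _ _ (circle_dist 1 z.1 w.1 + circle_dist h z.2 w.2)); last by rewrite lerD2l.
rewrite -[leRHS]ger0_norm ?addr_ge0 // -sqrtr_sqr ler_sqrt ?sqr_ge0 //.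
rewrite sqrrD -addrA [_ *+ 2 + _]addrC addrA lerDl mulrn_wge0 ?mulr_ge0 //.
Qed.

Lemma angle_lift a b : exists k : int, angle a b = b - a + k%:~R.
Proof. by rewrite /angle; case: ifP => _; [exists 0; rewrite addr0|exists 1]. Qed.

Lemma angle_cw a b : 0 <= a < 1 -> 0 <= b < 1 -> a != b -> cw a b -> 0 < angle a b < 1 / 4.
Proof.
move=> /andP[a0 a1] /andP[b0 b1] ab; rewrite /cw /angle.
have [leab|ltba] := leP a b.
  have {ab}leab : a < b by rewrite lt_neqAle ab.
  case/orP => [/andP[_ h2]|h2]; [apply/andP; split|]; lra.
by case/orP => [/andP[]|h2]; try lra; apply/andP; split; lra.
Qed.

Lemma angle_inj a b c : 0 <= a < 1 -> 0 <= b < 1 -> 0 <= c < 1 ->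
  angle a b = angle a c -> b = c.
Proof.
move=> /andP[a0 a1] /andP[b0 b1] /andP[c0 c1]; rewrite /angle.
by case: ifPn => h1; case: ifPn => h2; lra.
Qed.

Lemma angle_injl a b c : 0 <= a < 1 -> 0 <= b < 1 -> 0 <= c < 1 ->
  angle b a = angle c a -> b = c.
Proof.
move=> /andP[a0 a1] /andP[b0 b1] /andP[c0 c1]; rewrite /angle.
by case: ifPn => h1; case: ifPn => h2; lra.
Qed.

End Distances.

(** * The root is a candidate *)

Lemma set2_eq (T : finType) (a b c e : T) : [set a; b]%SET = [set c; e]%SET ->
  (a = c /\ b = e) \/ (a = e /\ b = c).
Proof.
move=> /setP E; have := E a; have := E b; have := E c; have := E e.
rewrite !inE !eqxx ?orbT /= => /orP[] /eqP -> /orP[] /eqP ->; rewrite ?eqxx ?orbb; auto.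
- by move=> /esym/eqP -> _; left.
- by move=> _ /esym/eqP ->; left.
Qed.

Section Edges.
Variables (n : nat) (p : nat -> nat).
Hypothesis p_lt : forall i, (0 < i < n)%N -> (p i < i)%N.

Lemma mem_tree_edges (a b : 'I_n) : [set a; b]%SET \in tree_edges n p ->
  (0 < a)%N /\ p a = b \/ (0 < b)%N /\ p b = a.
Proof.
case/imsetP => -[u1 u2]; rewrite inE /= => /andP[u0 /eqP pu].
by move=> /set2_eq[] [-> ->]; [left|right].
Qed.

Lemma tree_edge_in (a b : 'I_n) : (0 < a)%N -> p a = b -> [set a; b]%SET \in tree_edges n p.
Proof. by move=> a0 pa; apply/imsetP; exists (a, b) => //; rewrite inE a0 pa /=. Qed.

Lemma card_tree_edges : #|tree_edges n p| = n.-1.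
Proof.
case: n p_lt => [|n'] plt.
  by apply: eq_card0 => A; apply/negP => /imsetP[[[]]].
have pn (i : 'I_n'.+1) : (0 < i)%N -> (p i < n'.+1)%N.
  by move=> i0; apply: leq_trans (ltnW (ltn_ord i)); apply: plt; rewrite i0 /=.
pose f (i : 'I_n'.+1) := [set i; inord (p i)]%SET.
have -> : tree_edges n'.+1 p = [set f i | i in [set~ ord0]]%SET.
  apply/setP => A; apply/imsetP/imsetP.
    case=> -[u1 u2]; rewrite inE /= => /andP[u0 /eqP pu] ->.
    exists u1; first by rewrite !inE -val_eqE /= -lt0n.
    by congr (_ |: _)%SET; congr [set _]%SET; apply/val_inj; rewrite /= inordK ?pn.
  case=> i; rewrite !inE -val_eqE /= -lt0n => i0 ->.
  exists (i, inord (p i)); last by [].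
  by rewrite inE /= i0 inordK ?pn ?eqxx.
rewrite card_in_imset ?cardsC1 ?card_ord // => i j.
rewrite !inE -!val_eqE /= -!lt0n => i0 j0; rewrite /f => /setP fE.
have := fE i; have := fE j; rewrite !inE !eqxx /=.
have [-> //|ij] := eqVneq i j.
move=> /= /eqP jE /esym /eqP iE.
have := plt i; have := plt j; rewrite i0 j0 !ltn_ord => /(_ isT) pj /(_ isT) pi.
have := congr1 val jE; have := congr1 val iE; rewrite /= !inordK ?pn //.
lia.
Qed.

End Edges.

(** A large set of early vertices ordered by [K] would contain such a set of
    exactly [N] indices, which is the form that the union bound needs. *)
Lemma card_lt_no_monotone (n m N : nat) (A : {set 'I_n}) (K : rel nat) :
  (forall v, v \in A -> 0 < v < m)%N ->
  (forall J : {set 'I_m}, #|J| = N -> (forall i, i \in J -> (0 < i)%N) ->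
    ~ forall i j, i \in J -> j \in J -> (i < j)%N -> K i j) ->
  (forall v w, v \in A -> w \in A -> (v < w)%N -> K v w) ->
  (#|A| < N)%N.
Proof.
move=> Am noJ AK; rewrite ltnNge; apply/negP.
move=> /card_geqP[s [us sN sA]].
case: m Am noJ => [|m'] Am noJ.
  case: s us sN sA => [_ /= N0 _|v s _ _ sA]; last first.
    by have := Am v (sA v (mem_head _ _)); rewrite ltn0 andbF.
  by apply: (noJ finset.set0) => [|i|i j]; rewrite ?cards0 ?inE.
pose J := [set (inord (val v) : 'I_m'.+1) | v in s]%SET.
have valJ v : v \in A -> (inord (val v) : 'I_m'.+1) = v :> nat.
  by move=> /Am/andP[_ vm]; rewrite inordK.
apply: (noJ J).
- rewrite card_in_imset; first by rewrite -sN; exact/card_uniqP.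
  by move=> v w /sA vA /sA wA /(congr1 val); rewrite /= !valJ // => /val_inj.
- by move=> i /imsetP[v /sA vA ->]; rewrite valJ //; case/andP: (Am _ vA).
- move=> i j /imsetP[v /sA vA ->] /imsetP[w /sA wA ->]; rewrite !valJ //.
  exact: AK.
Qed.

Section Success.
Context {R : realType}.
Variables (eta h B : R) (n m N : nat) (y : nat -> R * R) (p : nat -> nat).
Hypothesis y_torus : forall i, (i < n.+1)%N -> torus h (y i).
Hypothesis y_nn : nn_parents h n.+1 y p.
Hypothesis mn : (m <= n.+1)%N.
Hypothesis NB : N%:R <= B.
Let xs i := (y i).1.
Let X := [tuple y i | i < n.+1].
Let e := tree_edges n.+1 p.

Hypothesis distinct : forall i j, (i < j < n.+1)%N -> xs i != xs j.
Hypothesis separated : forall i j, (i < j < m)%N -> eta <= circle_dist 1 (xs i) (xs j).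
Hypothesis far : exists2 w, (w < m)%N & 1 / 4 <= circle_dist 1 (xs 0) (xs w).
Hypothesis not_cw : forall J : {set 'I_m}, #|J| = N ->
  (forall i, i \in J -> (0 < i)%N) ->
  ~ forall i j, i \in J -> j \in J -> (i < j)%N ->
      angle (xs 0) (xs i) < angle (xs 0) (xs j).
Hypothesis not_ccw : forall J : {set 'I_m}, #|J| = N ->
  (forall i, i \in J -> (0 < i)%N) ->
  ~ forall i j, i \in J -> j \in J -> (i < j)%N ->
      angle (xs i) (xs 0) < angle (xs j) (xs 0).
Hypothesis root_free : forall j, (0 < j < n.+1)%N ->
  spans (xs j) (xs (p j)) (xs 0) -> torus_dist h (y j) (y (p j)) < eta.

Let p_lt i : (0 < i < n.+1)%N -> (p i < i)%N.
Proof. by move=> /y_nn[]. Qed.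

Let xs01 i : (i < n.+1)%N -> 0 <= xs i < 1.
Proof. by move=> /y_torus[]. Qed.

Let xs_inj i j : (i < n.+1)%N -> (j < n.+1)%N -> xs i = xs j -> i = j.
Proof.
move=> li lj E; have [lij|lji|//] := ltngtP i j.
  by have := distinct (i := i) (j := j); rewrite lij lj E eqxx => /(_ isT).
by have := distinct (i := j) (j := i); rewrite lji li E eqxx => /(_ isT).
Qed.

Let exposedP v j : exposed eta h X e v -> (0 < j < m)%N ->
  ~ spans (xs j) (xs (p j)) (xs v).
Proof.
move=> /negP ev /andP[j0 jm] sp; apply: ev.
have jn : (j < n.+1)%N by exact: leq_trans jm mn.
have pj : (p j < j)%N by rewrite p_lt // j0.
have pn := ltn_trans pj jn.
apply/existsP; exists (Ordinal jn); apply/existsP; exists (Ordinal pn).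
rewrite tree_edge_in // /covers !tnth_mktuple /= sp andbT.
apply: (le_trans _ (circle_dist_le_torus _ _)); try exact: y_torus.
by rewrite circle_distC separated // pj.
Qed.

Let root_exposed : exposed eta h X e ord0.
Proof.
apply/negP => /existsP[a /existsP[b /andP[/mem_tree_edges ab]]].
rewrite /covers !tnth_mktuple /= => /andP[d sp].
case: ab => -[l0 E].
  have := root_free (j := a); rewrite l0 ltn_ord E => /(_ isT sp).
  by rewrite ltNge d.
have := root_free (j := b); rewrite l0 ltn_ord E spansC => /(_ isT sp).
by rewrite torus_distC ltNge d.
Qed.

(** The vertex [w] far from the root is reached by a tree path that sweeps a
    quarter circle on the left or on the right of the root, according to the
    sign of its lift.  The exposed vertices of this quarter are on the path, and
    comparing two of them by [path_covers] shows that the one with the smaller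
    angle is older. *)
Lemma root_is_candidate : ord0 \in candidates eta h B X e.
Proof.
rewrite inE root_exposed /=; apply/orP.
have [s sL] := lifting_exists xs p_lt.
have [w wm farw] := far.
have wn : (w < n.+1)%N by exact: leq_trans wm mn.
have [kw sw] := lifting_mod p_lt sL wn.
have x0 : 0 <= xs 0 < 1 by exact: xs01.
have sw_big : 1 / 4 <= `|s w|.
  by apply: le_trans farw _; rewrite sw circle_dist1_lift ?xs01.
have neq0 (v : 'I_n.+1) : v != ord0 -> xs 0 != xs v.
  by move=> v0; apply: distinct; rewrite ltn_ord andbT lt0n.
have on_path (v : 'I_n.+1) k u : exposed eta h X e v -> (u < m)%N ->
    (0 < xs v - xs 0 + k%:~R < s u \/ s u < xs v - xs 0 + k%:~R < 0) ->
    (v < u)%N /\ s v = xs v - xs 0 + k%:~R.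
  move=> ev um bet; have un : (u < n.+1)%N by exact: leq_trans um mn.
  have [[j [/andP[j0 ju] sp]]|//] := path_covers xs01 xs_inj p_lt sL (ltn_ord v) un bet.
  by exfalso; apply: (exposedP ev _ sp); rewrite j0 (leq_ltn_trans ju).
(* The path to [w] goes counterclockwise from the root if [0 <= s w], and
   clockwise otherwise. *)
have [sw0|sw0] := lerP 0 (s w).
  have sw4 : 1 / 4 <= s w by rewrite ger0_norm in sw_big.
  have runP v : v \in cw_run eta h X e ord0 ->
      [/\ v != ord0, exposed eta h X e v, (v < w)%N, s v = angle (xs 0) (xs v) & 0 < angle (xs 0) (xs v)].
    rewrite inE !tnth_mktuple /= => /and3P[v0 ev cwv].
    have /andP[a0 a4] : 0 < angle (xs 0) (xs v) < 1 / 4.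
      by apply: angle_cw; rewrite ?xs01 ?neq0.
    have [k ak] := angle_lift (xs 0) (xs v).
    rewrite ak in a0 a4 *.
    have [] // := @on_path v k w ev wm.
    by left; rewrite a0 (lt_le_trans a4).
  left; apply: lt_le_trans NB; rewrite ltr_nat; apply: (@card_lt_no_monotone _ m _ _ (fun i j => angle (xs 0) (xs i) < angle (xs 0) (xs j))) => //.
    by move=> v /runP[v0 _ vw _ _]; rewrite (ltn_trans vw) // andbT lt0n.
  move=> v v' /runP[v0 ev vw sv _] /runP[v'0 ev' v'w sv' a0] vv'.
  rewrite ltNge le_eqVlt; apply/negP => /orP[/eqP E|lt].
    have := angle_inj x0 (xs01 (ltn_ord v')) (xs01 (ltn_ord v)) E.
    by move=> /(xs_inj (ltn_ord _) (ltn_ord _)) E'; rewrite E' ltnn in vv'.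
  have [k ak] := angle_lift (xs 0) (xs v').
  have [] := @on_path v' k v ev' (ltn_trans vw wm).
    by left; rewrite -ak a0 sv.
  by rewrite ltnNge (ltnW vv').
have sw4 : s w <= - (1 / 4) by rewrite ltr0_norm // in sw_big; lra.
have runP v : v \in ccw_run eta h X e ord0 ->
    [/\ v != ord0, exposed eta h X e v, (v < w)%N, s v = - angle (xs v) (xs 0) & 0 < angle (xs v) (xs 0)].
  rewrite inE !tnth_mktuple /= => /and3P[v0 ev cwv].
  have /andP[a0 a4] : 0 < angle (xs v) (xs 0) < 1 / 4.
    by apply: angle_cw; rewrite ?xs01 // eq_sym neq0.
  have [k ak] := angle_lift (xs v) (xs 0).
  have akN : - angle (xs v) (xs 0) = xs v - xs 0 + (- k)%:~R.
    by rewrite ak rmorphN /=; lra.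
  rewrite akN; have [] // := @on_path v (- k) w ev wm.
  by right; rewrite -akN; apply/andP; split; lra.
right; apply: lt_le_trans NB; rewrite ltr_nat; apply: (@card_lt_no_monotone _ m _ _ (fun i j => angle (xs i) (xs 0) < angle (xs j) (xs 0))) => //.
  by move=> v /runP[v0 _ vw _ _]; rewrite (ltn_trans vw) // andbT lt0n.
move=> v v' /runP[v0 ev vw sv _] /runP[v'0 ev' v'w sv' a0] vv'.
rewrite ltNge le_eqVlt; apply/negP => /orP[/eqP E|lt].
  have := angle_injl x0 (xs01 (ltn_ord v')) (xs01 (ltn_ord v)) E.
  by move=> /(xs_inj (ltn_ord _) (ltn_ord _)) E'; rewrite E' ltnn in vv'.
have [k ak] := angle_lift (xs v') (xs 0).
have akN : - angle (xs v') (xs 0) = xs v' - xs 0 + (- k)%:~R.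
  by rewrite ak rmorphN /=; lra.
have [] := @on_path v' (- k) v ev' (ltn_trans vw wm).
  by right; rewrite -akN sv; apply/andP; split; lra.
by rewrite ltnNge (ltnW vv').
Qed.

End Success.

(** If the edge from [j] to its parent covers the root, then the parent, being
    nearer to [j] in the torus and farther in the horizontal direction, is
    within [h / 2] of the root, so it is not among the first [M] vertices.  But
    [j] is then younger than [M] vertices one of which is near [j]. *)
Lemma root_edges_short (R : realType) (eta h r : R) (n M : nat) (y : nat -> R * R)
    (p : nat -> nat) :
  (forall i, (i < n)%N -> torus h (y i)) -> nn_parents h n y p -> (M <= n)%N ->
  (forall i, (0 < i < M)%N -> h < circle_dist 1 (y 0).1 (y i).1) ->
  (forall a, 0 <= a < 1 -> exists2 i, (i < M)%N & circle_dist 1 a (y i).1 <= r) ->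
  r + h / 2 < eta -> 0 < h ->
  forall j, (0 < j < n)%N ->
  spans (y j).1 (y (p j)).1 (y 0).1 -> torus_dist h (y j) (y (p j)) < eta.
Proof.
move=> yt ynn Mn sep dense rh h0 j jn sp.
have [pj near] := ynn j jn.
have /andP[j0 jn'] := jn.
have pn := ltn_trans pj jn'.
have [y01 _] := yt _ jn'; have [yp01 _] := yt _ pn.
have n0 : (0 < n)%N by exact: leq_ltn_trans jn'.
have [y001 _] := yt _ n0.
have p0 : (0 < p j)%N.
  rewrite lt0n; apply/eqP => E; move: sp; rewrite E /spans /short_arc !ltxx !andbF /= ?orbF.
  by move=> /orP[] /andP[]; lra.
have d0 : circle_dist 1 (y (p j)).1 (y 0).1 <= h / 2.
  have := near _ j0.
  have := torus_dist_le_circle (yt _ jn') (yt _ n0).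
  have := circle_dist_le_torus (yt _ jn') (yt _ pn).
  have := spans_dist y01 yp01 y001 sp.
  by lra.
have Mp : (M <= p j)%N.
  rewrite leqNgt; apply/negP => pM.
  by have := sep (p j); rewrite p0 pM circle_distC => /(_ isT); lra.
have [i iM di] := dense _ y01.
have ij : (i < j)%N by lia.
have := near _ ij.
have := torus_dist_le_circle (yt _ jn') (yt _ (ltn_trans ij jn')).
by lra.
Qed.

(** * Probability estimates for the model *)

(** Everything the procedures compare about [n] points is recorded in finitely
    many boolean tests, so that measurability reduces to that of each test. *)
Lemma measurable_finite_atoms d (T : measurableType d) (A : finType)
    (b : A -> T -> bool) (F : {ffun A -> bool} -> Prop) :
  (forall a, measurable [set x | b a x]) ->
  measurable [set x | F [ffun a => b a x]].
Proof.
move=> mb.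
have -> : [set x | F [ffun a => b a x]] =
    \bigcup_(g in [set g | F g]) \bigcap_(a in [set: A]) [set x | b a x = g a].
  apply/seteqP; split => [x Fx|x [g Fg bg]] /=.
    by exists [ffun a => b a x] => // a _ /=; rewrite ffunE.
  suff -> : [ffun a => b a x] = g by [].
  by apply/ffunP => a; rewrite ffunE; exact: bg.
apply: fin_bigcup_measurable => // g _; apply: fin_bigcap_measurable => // a _.
case: (g a); first exact: mb.
have -> : [set x | b a x = false] = ~` [set x | b a x].
  by apply/seteqP; split => x /= => [->//|/negP/negbTE].
exact: measurableC.
Qed.

Section OuterBound.
Context {R : realType} d (T : measurableType d) (P : probability T R).
Implicit Types (A B : set T) (r : R).

(** Outer bound on a probability: union bounds then involve no measurability
    conditions on the events of interest. *)
Definition prob_le A r := exists B, [/\ measurable B, A `<=` B & (P B <= r%:E)%E].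

Lemma prob_leI A r : measurable A -> (P A <= r%:E)%E -> prob_le A r.
Proof. by move=> mA PA; exists A; split. Qed.

Lemma prob_leE A r : measurable A -> prob_le A r -> (P A <= r%:E)%E.
Proof.
move=> mA [B [mB AB PB]]; apply: le_trans PB.
by apply: le_measure; rewrite ?inE.
Qed.

Lemma prob_leS A B r : A `<=` B -> prob_le B r -> prob_le A r.
Proof. by move=> AB [C [mC BC PC]]; exists C; split => //; exact: subset_trans BC. Qed.

Lemma prob_leW A r r' : r <= r' -> prob_le A r -> prob_le A r'.
Proof. by move=> rr [C [mC BC PC]]; exists C; split => //; rewrite (le_trans PC) ?lee_fin. Qed.

Lemma prob_le0 : prob_le set0 0.
Proof. by exists set0; split; rewrite ?measure0. Qed.

Lemma prob_leU A B r r' : prob_le A r -> prob_le B r' -> prob_le (A `|` B) (r + r').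
Proof.
move=> [C [mC AC PC]] [D [mD BD PD]]; exists (C `|` D); split.
- exact: measurableU.
- exact: setUSS.
- by rewrite EFinD (le_trans (measureU2 _ _ _)) ?leeD.
Qed.

Lemma prob_le_exists (I : finType) (Q : pred I) (A : I -> set T) (r : I -> R) :
  (forall i, Q i -> prob_le (A i) (r i)) ->
  prob_le [set w | exists2 i, Q i & A i w] (\sum_(i | Q i) r i).
Proof.
move=> Ar; suff H : forall s : seq I, prob_le [set w | exists2 i, (i \in s) && Q i & A i w]
    (\sum_(i <- s | Q i) r i).
  apply: prob_leS (H (index_enum I)) => w [i Qi Aw].
  by exists i => //; rewrite mem_index_enum.
elim=> [|i s IHs]; first by rewrite big_nil; apply: prob_leS prob_le0 => w [].
rewrite big_cons; case: ifPn => Qi.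
  apply: prob_leS (prob_leU (Ar i Qi) IHs) => w [j].
  rewrite inE => /andP[/orP[/eqP ->|js] Qj] Aw; [by left|right].
  by exists j; rewrite ?js.
apply: prob_leS IHs => w [j]; rewrite inE => /andP[/orP[/eqP ->|js] Qj] Aw.
  by rewrite Qj in Qi.
by exists j; rewrite ?js.
Qed.

Lemma prob_le_exists_cst (I : finType) (Q : pred I) (A : I -> set T) (r : R) :
  (forall i, Q i -> prob_le (A i) r) ->
  prob_le [set w | exists2 i, Q i & A i w] (#|Q|%:R * r).
Proof.
move=> /prob_le_exists; rewrite sumr_const mulr_natl; exact.
Qed.

End OuterBound.

Lemma circle_cell (R : realType) (K : nat) (x : R) : (0 < K)%N -> 0 <= x < 1 ->
  exists2 a, (a < K)%N & a%:R / K%:R <= x < a.+1%:R / K%:R.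
Proof.
move=> K0 /andP[x0 x1]; have K0' : 0 < K%:R :> R by rewrite ltr0n.
have xK : 0 <= x * K%:R by rewrite mulr_ge0 // ltW.
exists (Num.truncn (x * K%:R)).
  by rewrite truncn_lt_nat // -[ltRHS]mul1r ltr_pM2r.
by rewrite ler_pdivrMr // ltr_pdivlMr // truncn_itv.
Qed.

Section Model.
Context {R : realType} d (T : measurableType d) (P : probability T R).
Variables (h : R) (X : nat -> T -> R * R) (p : nat -> T -> nat).
Hypothesis h0 : 0 < h.
Hypothesis M : nn_model P h X p.

Lemma model_independent n (B : nat -> set (R * R)) : (forall i, measurable (B i)) ->
  P [set w | forall i, (i < n)%N -> B i (X i w)] =
  (\prod_(i < n) P (X i @^-1` B i))%E.
Proof.
move=> mB; have := nn_pos_independent M [fset i in iota 0 n]%fset mB.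
have -> : \bigcap_(i in [set` [fset i in iota 0 n]%fset]) X i @^-1` B i =
   [set w | forall i, (i < n)%N -> B i (X i w)].
  apply/seteqP; split => w /= H i.
    by move=> ilt; apply: H; rewrite /= !inE mem_iota.
  by rewrite /= !inE mem_iota => /H.
move=> ->; rewrite -(big_mkord xpredT (fun i => P (X i @^-1` B i))) /index_iota subn0.
apply: perm_big; apply: uniq_perm; rewrite ?iota_uniq // => i.
by rewrite !inE.
Qed.

Lemma model_uniform_strip i (a b : R) : 0 <= a -> a <= b -> b <= 1 ->
  P (X i @^-1` [set z | a <= z.1 < b]) = (b - a)%:E.
Proof.
move=> a0 ab b1.
have -> : [set z : R * R | a <= z.1 < b] = `[a, b[%classic `*` setT.
  by apply/seteqP; split => -[z1 z2] /=; rewrite in_itv /=; [move=> ->|case].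
rewrite (nn_pos_uniform M) //; last exact: measurableX.
have -> : (`[a, b[%classic `*` setT) `&` torus h = `[a, b[%classic `*` `[0, h[%classic.
  apply/seteqP; split => -[z1 z2] /=; rewrite !in_itv /=.
    by move=> [[-> _] [_ ->]].
  move=> [/andP[z1a z1b] z2h]; split; first by rewrite z1a z1b.
  by rewrite /torus /= (le_trans a0 z1a) (lt_le_trans z1b b1).
rewrite product_measure1E //= !lebesgue_measure_itv /= !lte_fin h0 oppr0 addr0.
case: ltP ab => [ab _|ba ab].
  by rewrite -EFinB -!EFinM; congr EFin; field; rewrite gt_eqF.
have -> : b - a = 0 by lra.
by rewrite mul0e mule0.
Qed.

Lemma measurable_strip (a b : R) : measurable [set z : R * R | a <= z.1 < b].
Proof.
have -> : [set z : R * R | a <= z.1 < b] = `[a, b[%classic `*` setT.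
  by apply/seteqP; split => -[z1 z2] /=; rewrite in_itv /=; [move=> ->|case].
exact: measurableX.
Qed.

Lemma model_preimage i (B : set (R * R)) : measurable B -> measurable (X i @^-1` B).
Proof. by move=> mB; rewrite -[X in measurable X]setTI; apply: (nn_pos_measurable M i). Qed.

Lemma model_forall n (B : nat -> set (R * R)) : (forall i, measurable (B i)) ->
  measurable [set w | forall i, (i < n)%N -> B i (X i w)].
Proof.
move=> mB; have -> : [set w | forall i, (i < n)%N -> B i (X i w)] =
    \bigcap_(i in [set i | (i < n)%N]) X i @^-1` B i by [].
by apply: fin_bigcap_measurable => [|i _]; [exact: finite_II|exact: model_preimage].
Qed.

Lemma prob_le_forall n (B : nat -> set (R * R)) (r : nat -> R) :
  (forall i, measurable (B i)) ->
  (forall i, (i < n)%N -> (P (X i @^-1` B i) <= (r i)%:E)%E) ->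
  prob_le P [set w | forall i, (i < n)%N -> B i (X i w)] (\prod_(i < n) r i).
Proof.
move=> mB Br; apply: prob_leI; first exact: model_forall.
rewrite model_independent //.
elim: n Br => [|n IHn] Br; first by rewrite !big_ord0.
rewrite !big_ord_recr /= EFinM; apply: lee_pmul.
- by apply: prode_ge0 => i _; exact: measure_ge0.
- exact: measure_ge0.
- by apply: IHn => i /ltnW; exact: Br.
- exact: Br.
Qed.

Lemma model_setT i : P (X i @^-1` setT) = 1%E.
Proof. by rewrite preimage_setT probability_setT. Qed.

Lemma prob_le_pair i j (A B : set (R * R)) (r s : R) : i != j ->
  measurable A -> measurable B ->
  (P (X i @^-1` A) <= r%:E)%E -> (P (X j @^-1` B) <= s%:E)%E ->
  prob_le P [set w | A (X i w) /\ B (X j w)] (r * s).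
Proof.
move=> ij mA mB Ar Bs.
pose C k := if k == i then A else if k == j then B else setT.
pose n := (maxn i j).+1.
have i_n : (i < n)%N by rewrite ltnS leq_maxl.
have j_n : (j < n)%N by rewrite ltnS leq_maxr.
have -> : r * s = \prod_(k < n) (if val k == i then r else if val k == j then s else 1).
  rewrite (bigD1 (Ordinal i_n)) //= eqxx (bigD1 (Ordinal j_n)) /=; last first.
    by rewrite -val_eqE /= eq_sym.
  rewrite eqxx eq_sym (negPf ij) big1 ?mulr1 // => k.
  by rewrite -!val_eqE /= => /andP[/negPf -> /negPf ->].
apply: prob_leS (@prob_le_forall n C (fun k => if k == i then r else if k == j then s else 1) _ _).
- move=> w [Aw Bw] k kn; rewrite /C; case: eqP => [->//|_].
  by case: eqP => [->//|_].
- by move=> k; rewrite /C; case: ifP => // _; case: ifP.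
- move=> k kn; rewrite /C; case: eqP => [->//|_]; case: eqP => [->//|_].
  by rewrite model_setT.
Qed.

Lemma model_avoid_strip i (a b : R) : 0 <= a -> a <= b -> b <= 1 ->
  P (X i @^-1` (~` [set z | a <= z.1 < b])) = (1 - (b - a))%:E.
Proof.
move=> a0 ab b1; rewrite preimage_setC probability_setC.
  by rewrite model_uniform_strip.
exact: (model_preimage i (measurable_strip a b)).
Qed.

Lemma prob_le_avoid_strip i0 k (a b : R) : 0 <= a -> a <= b -> b <= 1 ->
  prob_le P [set w | forall i, (i0 <= i < i0 + k)%N -> ~ a <= (X i w).1 < b]
    ((1 - (b - a)) ^+ k).
Proof.
move=> a0 ab b1.
have -> : (1 - (b - a)) ^+ k =
    \prod_(i < i0 + k) (if (i0 <= i)%N then 1 - (b - a) else 1).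
  rewrite big_split_ord /= big1 ?mul1r => [|i _]; last by rewrite leqNgt ltn_ord.
  by under eq_bigr do rewrite leq_addr; rewrite prodr_const card_ord.
apply: prob_leS (@prob_le_forall _ (fun i => if (i0 <= i)%N then
   ~` [set z | a <= z.1 < b] else setT)
   (fun i => if (i0 <= i)%N then 1 - (b - a) else 1) _ _).
- by move=> w H i ik; case: ifP => // i0i; apply: H; rewrite i0i.
- by move=> i; case: ifP => // _; apply: measurableC; exact: measurable_strip.
- by move=> i ik; case: ifP => _; rewrite ?model_setT // model_avoid_strip.
Qed.

(** Cut the circle into [K] arcs: two points at distance less than [1/K] lie in
    the same arc or in adjacent ones, which is [3 K] pairs of arcs, each of
    probability [1/K^2]. *)
Lemma prob_le_close i j K : i != j -> (0 < K)%N ->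
  prob_le P [set w | circle_dist 1 (X i w).1 (X j w).1 < K%:R^-1] (3 / K%:R).
Proof.
move=> ij K0; have K0' : 0 < K%:R :> R by rewrite ltr0n.
have Kn0 : K%:R != 0 :> R by rewrite gt_eqF.
pose S (a : nat) : set (R * R) := [set z | a%:R / K%:R <= z.1 < a.+1%:R / K%:R].
have mS a : measurable (S a) by exact: measurable_strip.
have PS l a : (a < K)%N -> (P (X l @^-1` S a) <= (K%:R^-1)%:E)%E.
  move=> aK; rewrite model_uniform_strip.
  - by rewrite lee_fin -natr1 mulrDl addrAC subrr add0r mul1r.
  - by rewrite divr_ge0 // ler0n.
  - by rewrite ler_pM2r ?invr_gt0 // ler_nat.
  - by rewrite ler_pdivrMr // mul1r ler_nat.
have [K' KE] : exists K', K = K'.+1 by case: K K0 {K0' Kn0 S mS PS} => // K'; exists K'.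
pose E (u : 'I_K * 'I_3) := [set w | S u.1 (X i w) /\ S ((u.1 + u.2 + K') %% K)%N (X j w)].
have EP u : prob_le P (E u) (K%:R^-1 * K%:R^-1).
  apply: prob_le_pair => //; first exact: PS.
  by apply: PS; rewrite ltn_mod.
have := prob_le_exists_cst (Q := xpredT) (A := E) (fun u _ => EP u).
rewrite card_prod !card_ord natrM.
have -> : K%:R * 3%:R * (K%:R^-1 * K%:R^-1) = 3 / K%:R :> R.
  by field.
apply: prob_leS => w /= dw.
have [xi01 _] := nn_pos_torus M i w; have [xj01 _] := nn_pos_torus M j w.
have [a aK ax] := circle_cell K0 xi01; have [b bK bx] := circle_cell K0 xj01.
suff [t bE] : exists t : 'I_3, ((a + t + K') %% K = b)%N.
  by exists (Ordinal aK, t) => //; split => //=; rewrite bE.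
have cells : (a <= b.+1 /\ b <= a.+1)%N \/ (a = 0%N /\ b = K')%N \/ (a = K' /\ b = 0%N)%N.
  move: ax bx; rewrite !ler_pdivrMr // !ltr_pdivlMr //.
  move: dw; rewrite /circle_dist gt_min -!natr1.
  set u := (X i w).1; set v := (X j w).1.
  case/orP => dw /andP[au ua] /andP[bv vb].
    left; move: dw; rewrite -[ltRHS]mul1r ltr_pdivlMr // -{1}(gtr0_norm K0') -normrM ltr_norml.
    move=> /andP[d1 d2]; split; rewrite -ltnS -(ltr_nat R) -!natr1; lra.
  move: dw; rewrite ltrBlDl -ltrBlDr ltr_normr => dw.
  have KK : K%:R * K%:R^-1 = 1 :> R by rewrite mulfV.
  have KE' : K%:R = K'%:R + 1 :> R by rewrite KE natr1.
  have aK1 : a%:R + 1 <= K%:R :> R by rewrite natr1 ler_nat.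
  have bK1 : b%:R + 1 <= K%:R :> R by rewrite natr1 ler_nat.
  have a0 : 0 <= a%:R :> R by exact: ler0n.
  have b0 : 0 <= b%:R :> R by exact: ler0n.
  case/orP: dw; rewrite -(ltr_pM2r K0') mulrBl mul1r (mulrC _^-1) KK => dw.
    have bK' : (b < 1)%N by rewrite -(ltr_nat R); lra.
    have aK' : (K' < a.+1)%N by rewrite -(ltr_nat R) -natr1; lra.
    by right; right; move: aK aK' bK'; rewrite KE; clear; lia.
  have aK' : (a < 1)%N by rewrite -(ltr_nat R); lra.
  have bK' : (K' < b.+1)%N by rewrite -(ltr_nat R) -natr1; lra.
  by right; left; move: bK aK' bK'; rewrite KE; clear; lia.
case: cells => [[ab ba]|[[-> ->]|[-> ->]]].
- have : (b.+1 = a \/ b = a \/ b = a.+1)%N by move: ab ba; clear; lia.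
  move=> [ab'|[->|bE]]; [exists (inord 0)|exists (inord 1)|exists (inord 2)]; rewrite inordK // KE.
  + by rewrite -ab' addn0 addSnnS modnDr modn_small // -KE.
  + by rewrite -addnA add1n modnDr modn_small // -KE.
  + rewrite bE; have -> : (a + 2 + K' = a.+1 + K'.+1)%N by clear; lia.
    by rewrite modnDr modn_small // -KE -bE.
- by exists (inord 0); rewrite inordK // KE add0n modn_small.
- exists (inord 2); rewrite inordK // KE.
  have -> : (K' + 2 + K' = K'.+1 + K'.+1)%N by clear; lia.
  by rewrite modnDr modnn.
Qed.

(** The root lies in one of four quarters of the circle, and then no other
    vertex lies in the opposite quarter. *)
Lemma prob_le_all_near m :
  prob_le P [set w | forall i, (i < m.+1)%N -> circle_dist 1 (X 0%N w).1 (X i w).1 < 1 / 4]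
    (4 * (3 / 4) ^+ m).
Proof.
pose S (a : nat) : set (R * R) := [set z | a%:R / 4 <= z.1 < a.+1%:R / 4].
pose E (a : 'I_4) := [set w | forall i, (1 <= i < 1 + m)%N -> ~ S a (X i w)].
have EP a : prob_le P (E a) ((3 / 4) ^+ m).
  have a4 : (a.+1)%:R <= 4 :> R by rewrite ler_nat.
  have -> : 3 / 4 = 1 - (a.+1%:R / 4 - a%:R / 4) :> R by rewrite -natr1; lra.
  apply: prob_le_avoid_strip; first by rewrite divr_ge0 // ler0n.
    by rewrite ler_pM2r ?invr_gt0 // ler_nat.
  by lra.
have := prob_le_exists_cst (Q := xpredT) (A := E) (fun u _ => EP u).
rewrite card_ord; apply: prob_leS => w near0.
have [x0 _] := nn_pos_torus M 0 w.
have [a a4 /andP[ax xa]] := circle_cell (isT : (0 < 4)%N) x0.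
exists (inord (if (a < 2)%N then a.+2 else a.-2)) => // i /andP[i1 im].
rewrite /S /= inordK; last by case: a a4 {ax xa} => [|[|[|[|]]]].
move=> /andP[bx xb].
have := near0 i; rewrite -add1n im => /(_ isT).
have [xi _] := nn_pos_torus M i w.
move: ax xa bx xb xi x0; set u := (X i w).1; set v := (X 0%N w).1.
rewrite /circle_dist /Num.min.
case: a a4 => [|[|[|[|//]]]] _ /= ? ? ? ? ? ?;
  case: ifPn => _; rewrite ?ltrBlDl -?ltrBlDr ?ltr_norml ?ltr_normr; lra.
Qed.

(** If the points are not dense, one of [K] fixed arcs of length [1/K] contains
    none of them. *)
Lemma prob_le_not_dense (n K : nat) : (0 < K)%N ->
  prob_le P [set w | ~ forall a, 0 <= a < 1 ->
      exists2 i, (i < n)%N & circle_dist 1 a (X i w).1 <= K%:R^-1]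
    (K%:R * (1 - K%:R^-1) ^+ n).
Proof.
move=> K0; have K0' : 0 < K%:R :> R by rewrite ltr0n.
pose S (a : nat) : set (R * R) := [set z | a%:R / K%:R <= z.1 < a.+1%:R / K%:R].
pose E (a : 'I_K) := [set w | forall i, (0 <= i < 0 + n)%N -> ~ S a (X i w)].
have EP a : prob_le P (E a) ((1 - K%:R^-1) ^+ n).
  have -> : K%:R^-1 = a.+1%:R / K%:R - a%:R / K%:R :> R by rewrite -natr1; lra.
  apply: prob_le_avoid_strip; first by rewrite divr_ge0 // ler0n.
    by rewrite ler_pM2r ?invr_gt0 // ler_nat.
  by rewrite ler_pdivrMr // mul1r ler_nat.
have := prob_le_exists_cst (Q := xpredT) (A := E) (fun u _ => EP u).
rewrite card_ord; apply: prob_leS => w; apply: contra_notP => nE x x01.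
have [a aK /andP[ax xa]] := circle_cell K0 x01.
apply: contra_notP nE => nclose.
exists (Ordinal aK) => // i /= iK /andP[bx xb]; apply: nclose; exists i => //.
rewrite /circle_dist ge_min ler_norml; apply/orP; left.
by move: xa xb; rewrite -natr1 mulrDl mul1r => xa xb; apply/andP; split; lra.
Qed.

End Model.

Section Uniqueness.
Context {R : realType}.

Lemma measure_tuple_unique d (V : measurableType d) n
    (m1 m2 : {measure set (n.-tuple V) -> \bar R}) :
  (m1 setT < +oo)%E ->
  (forall B : 'I_n -> set V, (forall i, measurable (B i)) ->
    m1 [set x | forall i, B i (tnth x i)] = m2 [set x | forall i, B i (tnth x i)]) ->
  forall D, measurable D -> m1 D = m2 D.
Proof.
move=> m1fin m12 D mD.
pose rect (B : 'I_n -> set V) := [set x : n.-tuple V | forall i, B i (tnth x i)].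
pose G := [set A | exists2 B : 'I_n -> set V, (forall i, measurable (B i)) & A = rect B].
have rectT : rect (fun=> setT) = setT by apply/seteqP; split.
apply: (measure_unique G (fun=> setT)) => //.
- rewrite eqEsubset; split.
    apply: smallest_sub; first exact: smallest_sigma_algebra.
    move=> A; rewrite -bigcup_seq => -[i _ [B mB <-]]; apply: sub_sigma_algebra.
    exists (fun j => if j == i then B else setT) => [j|]; first by case: ifP.
    rewrite setTI; apply/seteqP; split => x /= H.
      by move=> j; case: eqP => // ->.
    by have := H i; rewrite eqxx.
  apply: smallest_sub; first exact: sigma_algebra_measurable.
  move=> A [B mB ->].
  have -> : rect B = \bigcap_(i in [set: 'I_n]) (@tnth n V ^~ i) @^-1` B i.
    by apply/seteqP; split => x /= H i; [move=> _|]; exact: H.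
  apply: fin_bigcap_measurable => // i _.
  by rewrite -[X in measurable X]setTI; exact: measurable_tnth.
- move=> _ _ [B mB ->] [C mC ->]; exists (fun i => B i `&` C i) => [i|].
    exact: measurableI.
  by apply/seteqP; split => x /= => [[HB HC] i|H]; [split|split => i; have [] := H i].
- by move=> _; exists (fun=> setT) => //; rewrite rectT.
- by rewrite bigcup_const //; exists 0%N.
- by move=> _ [B mB ->]; exact: m12.
Qed.

Lemma measure_prod_unique d1 d2 (T1 : measurableType d1) (T2 : measurableType d2)
    (m1 m2 : {measure set (T1 * T2) -> \bar R}) :
  (m1 setT < +oo)%E ->
  (forall A B, measurable A -> measurable B -> m1 (A `*` B) = m2 (A `*` B)) ->
  forall D, measurable D -> m1 D = m2 D.
Proof.
move=> m1fin m12 D mD.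
pose G : set (set (T1 * T2)) := [set A `*` B | A in measurable & B in measurable].
apply: (measure_unique G (fun=> setT)) => //.
- by rewrite measurable_prod_measurableType.
- move=> _ _ [A mA [B mB <-]] [A' mA' [B' mB' <-]].
  rewrite -setXI; exists (A `&` A'); first exact: measurableI.
  by exists (B `&` B') => //; exact: measurableI.
- by move=> _; exists setT => //; exists setT => //; rewrite setXTT.
- by rewrite bigcup_const //; exists 0%N.
- by move=> _ [A mA [B mB <-]]; exact: m12.
Qed.

Lemma sum_prob_disjoint d (T : measurableType d) (P : probability T R)
    (I : eqType) (s : seq I) (A : I -> set T) : uniq s ->
  (forall i, measurable (A i)) -> (forall i j w, A i w -> A j w -> i = j) ->
  (\sum_(i <- s) P (A i) = P [set w | exists2 i, i \in s & A i w])%E.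
Proof.
move=> + mA disj; elim: s => [_|i s IHs /= /andP[is_ us]].
  rewrite big_nil (_ : [set w | _] = set0) ?measure0 //.
  by apply/seteqP; split => w // [].
rewrite big_cons IHs //.
have -> : [set w | exists2 j, j \in i :: s & A j w] =
    A i `|` [set w | exists2 j, j \in s & A j w].
  apply/seteqP; split => w /=.
    by move=> [j]; rewrite inE => /orP[/eqP -> ?|js Aj]; [left|right; exists j].
  by move=> [Ai|[j js Aj]]; [exists i; rewrite ?mem_head|exists j => //; rewrite inE js orbT].
rewrite measureU //.
- have -> : [set w | exists2 j, j \in s & A j w] = \bigcup_(j in [set` s]) A j.
    by apply/seteqP; split => w /= -[j js Aj]; exists j.
  by apply: fin_bigcup_measurable => // j _.
- apply/seteqP; split => w //= [Ai [j js Aj]].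
  by move: is_; rewrite (disj _ _ _ Ai Aj) js.
Qed.

(** For independent [f] and [g] the law of the pair is the product law, which
    can be computed by sections. *)
Lemma null_by_sections d d1 d2 (T : measurableType d) (T1 : measurableType d1)
    (T2 : measurableType d2) (P : probability T R) (f : {mfun T >-> T1})
    (g : {mfun T >-> T2}) (D : set (T1 * T2)) :
  (forall A B, measurable A -> measurable B ->
     P (f @^-1` A `&` g @^-1` B) = (P (f @^-1` A) * P (g @^-1` B))%E) ->
  measurable D ->
  (forall b, P (f @^-1` ysection D b) = 0%E) ->
  P [set w | D (f w, g w)] = 0%E.
Proof.
move=> ind mD secD.
have mfg : measurable_fun setT (fun w => (f w, g w)).
  by apply/measurable_fun_pairP; split.
pose fg : {mfun T >-> (T1 * T2)%type} := mfun_Sub (mem_set mfg).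
transitivity ((distribution P f \x^ distribution P g)%E D); last first.
  by rewrite /= /product_measure2; apply: integral0_eq => b _ /=; exact: secD.
apply: (measure_prod_unique (m1 := distribution P fg)) => //.
- by rewrite /= /distribution /pushforward preimage_setT probability_setT ltry.
- move=> A B mA mB; rewrite /= product_measure2E //.
  exact: ind.
Qed.

End Uniqueness.

(** * Exchangeability *)

Section MeasurableComparisons.
Context {R : realType} d (T : measurableType d).
Implicit Types f g : T -> R.

Lemma measurable_set_lt f g : measurable_fun setT f -> measurable_fun setT g ->
  measurable [set x | f x < g x].
Proof.
move=> mf mg; rewrite -[X in measurable X]setTI.
have := measurable_fun_ltr mf mg measurableT (Y := [set true]).
by rewrite preimage_true; apply.
Qed.

Lemma measurable_set_le f g : measurable_fun setT f -> measurable_fun setT g ->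
  measurable [set x | f x <= g x].
Proof.
move=> mf mg; rewrite -[X in measurable X]setTI.
have := measurable_fun_ler mf mg measurableT (Y := [set true]).
by rewrite preimage_true; apply.
Qed.

End MeasurableComparisons.

Section Exchange.
Context {R : realType} d (T : measurableType d) (P : probability T R).
Variables (h : R) (X : nat -> T -> R * R) (p : nat -> T -> nat).
Hypothesis M : nn_model P h X p.

Lemma model_law i j (B : set (R * R)) : measurable B ->
  P (X i @^-1` B) = P (X j @^-1` B).
Proof. by move=> mB; rewrite !(nn_pos_uniform M). Qed.

Definition positions n (s : {perm 'I_n}) w : n.-tuple (R * R) :=
  [tuple X (s i) w | i < n].

Lemma measurable_positions n (s : {perm 'I_n}) : measurable_fun setT (positions s).
Proof.
apply/measurable_fun_tnthP => i.
rewrite (_ : _ \o _ = X (s i)); first exact: (nn_pos_measurable M).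
by apply/funext => w /=; rewrite tnth_mktuple.
Qed.

Lemma measurable_positions_set n (s : {perm 'I_n}) (D : set (n.-tuple (R * R))) :
  measurable D -> measurable [set w | D (positions s w)].
Proof. by move=> mD; rewrite -[X in measurable X]setTI; exact: measurable_positions. Qed.

Lemma prob_positions_rect n (s : {perm 'I_n}) (B : 'I_n -> set (R * R)) :
  (forall i, measurable (B i)) ->
  P [set w | forall i, B i (tnth (positions s w) i)] = (\prod_i P (X 0%N @^-1` B i))%E.
Proof.
move=> mB.
pose C k := if insub k is Some i then B ((s^-1)%g i) else setT.
have mC k : measurable (C k) by rewrite /C; case: insub.
have -> : [set w | forall i, B i (tnth (positions s w) i)] =
    [set w | forall k, (k < n)%N -> C k (X k w)].
  apply/seteqP; split => w /= Bw.
    move=> k kn; rewrite /C insubT /=.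
    by have := Bw ((s^-1)%g (Ordinal kn)); rewrite tnth_mktuple permKV.
  move=> i; have := Bw (s i) (ltn_ord _).
  by rewrite /C valK permK tnth_mktuple.
rewrite (model_independent M) // [RHS](reindex_inj (@perm_inj _ (s^-1)%g)) /=.
by apply: eq_bigr => i _; rewrite /C valK (model_law i 0%N).
Qed.

Lemma model_exchangeable n (s t : {perm 'I_n}) (D : set (n.-tuple (R * R))) :
  measurable D -> P [set w | D (positions s w)] = P [set w | D (positions t w)].
Proof.
move=> mD.
pose f u : {mfun T >-> n.-tuple (R * R)} := mfun_Sub (mem_set (measurable_positions u)).
have E u : P [set w | D (positions u w)] = distribution P (f u) D by [].
rewrite !E; apply: measure_tuple_unique => //.
  by rewrite /= /distribution /pushforward preimage_setT probability_setT ltry.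
move=> B mB; rewrite /= /distribution /pushforward /=.
by rewrite !(prob_positions_rect _ mB).
Qed.

(** An element [s i] of [J] has as many elements of [J] below it for [k] as [i]
    has below it for the usual order, so [s i] determines [i]. *)
Lemma sorting_perm_unique n (J : {set 'I_n}) (s t : {perm 'I_n}) (k : 'I_n -> R) :
  perm_on J s -> perm_on J t ->
  (forall i j, i \in J -> j \in J -> (i < j)%N -> k (s i) < k (s j)) ->
  (forall i j, i \in J -> j \in J -> (i < j)%N -> k (t i) < k (t j)) -> s = t.
Proof.
move=> sJ tJ ks kt.
have mono (u : {perm 'I_n}) : (forall i j, i \in J -> j \in J -> (i < j)%N -> k (u i) < k (u j)) ->
    forall i j, i \in J -> j \in J -> (k (u i) < k (u j)) = (i < j)%N.
  move=> ku i j iJ jJ; have [ij|ji|ij] := ltngtP i j; first exact: ku.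
    by apply/negbTE; rewrite -leNgt ltW // ku.
  by rewrite (val_inj ij) ltxx.
have rank (u : {perm 'I_n}) : perm_on J u -> (forall i j, i \in J -> j \in J -> (i < j)%N -> k (u i) < k (u j)) ->
    forall i, i \in J -> #|[set l in J | k l < k (u i)]%SET| = #|[set j in J | (j < i)%N]%SET|.
  move=> uJ ku i iJ; symmetry; rewrite -(card_imset _ (@perm_inj _ u)); apply: eq_card => l.
  rewrite -(permKV u l) mem_imset ?inE; last exact: perm_inj.
  set j := (u^-1)%g l; rewrite (perm_closed j uJ).
  by case jJ : (j \in J) => //=; rewrite (mono u ku) //.
apply/permP => i; case iJ : (i \in J); last first.
  by rewrite !(out_perm _ (negbT iJ)).
pose j := (t^-1)%g (s i); have ti : t j = s i by rewrite permKV.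
have jJ : j \in J by rewrite -(perm_closed _ tJ) ti perm_closed.
have := rank _ sJ ks _ iJ; rewrite -ti (rank _ tJ kt _ jJ) => E.
(* [i] and [j] have the same rank in [J], that of [s i] for [k]. *)
have [ij|ji|/val_inj -> //] := ltngtP i j.
  suff : (#|[set l in J | (l < i)%N]%SET| < #|[set l in J | (l < j)%N]%SET|)%N by rewrite E ltnn.
  apply: proper_card; apply/properP; split.
    by apply/fintype.subsetP => l; rewrite !inE => /andP[->] /ltn_trans; apply.
  by exists i; rewrite !inE ?iJ ?ij ?ltnn ?andbF.
suff : (#|[set l in J | (l < j)%N]%SET| < #|[set l in J | (l < i)%N]%SET|)%N by rewrite E ltnn.
apply: proper_card; apply/properP; split.
  by apply/fintype.subsetP => l; rewrite !inE => /andP[->] /ltn_trans; apply.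
by exists j; rewrite !inE ?jJ ?ji ?ltnn ?andbF.
Qed.

(** The [#|J|!] events obtained by permuting the indices in [J] are disjoint and,
    by exchangeability, have the same probability. *)
Lemma prob_le_monotone m (K : R * R -> R * R -> R) (J : {set 'I_m}) :
  (forall n (i j : 'I_n), measurable_fun setT (fun x : n.-tuple (R * R) => K (tnth x i) (tnth x j))) ->
  (forall i, i \in J -> (0 < i)%N) ->
  prob_le P [set w | forall i j, i \in J -> j \in J -> (i < j)%N ->
     K (X 0%N w) (X i w) < K (X 0%N w) (X j w)] ((#|J|)`!%:R^-1).
Proof.
case: m J => [|m] J mK J0.
  have -> : #|J| = 0%N by apply: eq_card0 => -[].
  by rewrite fact0 invr1; apply: prob_leS (prob_leI _ _ : prob_le P setT 1); rewrite ?probability_setT.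
pose D := [set x : m.+1.-tuple (R * R) | forall i j, i \in J -> j \in J -> (i < j)%N ->
     K (tnth x ord0) (tnth x i) < K (tnth x ord0) (tnth x j)].
have mD : measurable D.
  have -> : D = \bigcap_(i in [set i | i \in J]) \bigcap_(j in [set j : 'I_m.+1 | (j \in J) && (i < j)%N])
      [set x | K (tnth x ord0) (tnth x i) < K (tnth x ord0) (tnth x j)].
    apply/seteqP; split => x /= H i.
      by move=> iJ j /= /andP[jJ ij]; exact: H.
    by move=> j iJ jJ ij; apply: H => //=; rewrite jJ.
  apply: fin_bigcap_measurable => // i _; apply: fin_bigcap_measurable => // j _.
  by apply: measurable_set_lt; exact: mK.
pose A s := [set w | D (positions s w)].
have mA s : measurable (A s) by exact: measurable_positions_set.
have A1 : [set w | forall i j, i \in J -> j \in J -> (i < j)%N ->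
     K (X 0%N w) (X i w) < K (X 0%N w) (X j w)] = A 1%g.
  by apply/seteqP; split => w H i j iJ jJ ij; have := H i j iJ jJ ij;
    rewrite !tnth_mktuple !perm1.
rewrite A1; apply: prob_leI => //.
have disj s t w : A s w /\ perm_on J s -> A t w /\ perm_on J t -> s = t.
  move=> [As sJ] [At tJ].
  have fix0 u : perm_on J u -> u ord0 = ord0.
    by move=> uJ; rewrite (out_perm uJ) //; apply/negP => /J0.
  apply: (sorting_perm_unique (k := fun i => K (X 0%N w) (X i w)) sJ tJ) => i j iJ jJ ij.
    by have := As i j iJ jJ ij; rewrite !tnth_mktuple fix0.
  by have := At i j iJ jJ ij; rewrite !tnth_mktuple fix0.
pose A' s := [set w | A s w /\ perm_on J s].
have mA' s : measurable (A' s).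
  rewrite (_ : A' s = if perm_on J s then A s else set0); first by case: ifP.
  by case sJ : (perm_on J s); apply/seteqP; split => w; rewrite /A' /= sJ // => -[].
have := sum_prob_disjoint P (s := enum [set s | perm_on J s]%SET) (enum_uniq _) mA' disj.
rewrite big_enum /= (eq_bigr (fun=> P (A 1%g))); last first.
  move=> s; rewrite inE => sJ; rewrite (_ : A' s = A s).
    exact: model_exchangeable.
  by apply/seteqP; split => w //= [].
have card_J : #|[set s : {perm 'I_m.+1} | perm_on J s]%SET| = (#|J|)`!.
  by rewrite -card_perm; apply: eq_card => s; rewrite inE.
have Pfin : P (A 1%g) \is a fin_num by exact: fin_num_measure.
rewrite -(fineK Pfin) sumEFin sumr_const card_J => sumE.
have : (((fine (P (A 1%g))) *+ (#|J|)`!)%:E <= 1)%E.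
  rewrite sumE; apply: probability_le1.
  rewrite (_ : [set w | _] = \bigcup_(s in [set s | s \in enum [set s | perm_on J s]%SET]) A' s).
    exact: fin_bigcup_measurable.
  by apply/seteqP; split => w /= -[s sJ As]; exists s.
rewrite !lee_fin => H; rewrite -[leRHS]mul1r ler_pdivlMr ?ltr0n ?fact_gt0 //.
by rewrite mulr_natr.
Qed.

End Exchange.

(** * Measurability, and absence of ties *)

Section Measurability.
Context {R : realType}.

Section Generic.
Context d (T : measurableType d).
Implicit Types (f g : T -> R) (u v : T -> R * R).

Lemma measurable_circle_dist (l : R) f g : measurable_fun setT f -> measurable_fun setT g ->
  measurable_fun setT (fun x => circle_dist l (f x) (g x)).
Proof.
move=> mf mg; have mn : measurable_fun setT (fun x => `|f x - g x|).
  by apply: measurableT_comp => //; exact: measurable_funB.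
by apply: measurable_minr => //; apply: measurable_funB.
Qed.

Lemma measurable_torus_dist (h : R) u v : measurable_fun setT u -> measurable_fun setT v ->
  measurable_fun setT (fun x => torus_dist h (u x) (v x)).
Proof.
move=> mu mv.
have [mu1 mu2] := iffLR (measurable_fun_pairP _) mu.
have [mv1 mv2] := iffLR (measurable_fun_pairP _) mv.
have mS : measurable_fun setT (fun x => circle_dist 1 (u x).1 (v x).1 ^+ 2 +
    circle_dist h (u x).2 (v x).2 ^+ 2).
  by apply: measurable_funD; apply: measurable_funX; exact: measurable_circle_dist.
have msqrt : measurable_fun setT (@Num.sqrt R).
  exact: continuous_measurable_fun (@sqrt_continuous R).
exact: (measurableT_comp msqrt mS).
Qed.

Lemma measurable_angle f g : measurable_fun setT f -> measurable_fun setT g ->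
  measurable_fun setT (fun x => angle (f x) (g x)).
Proof.
move=> mf mg; apply: measurable_fun_ifT.
- exact: measurable_fun_ler.
- exact: measurable_funB.
- by apply: measurable_funD => //; exact: measurable_funB.
Qed.

Lemma measurable_set_and (b c : T -> bool) : measurable [set x | b x] ->
  measurable [set x | c x] -> measurable [set x | b x && c x].
Proof.
move=> mb mc; rewrite (_ : [set _ | _] = [set x | b x] `&` [set x | c x]).
  exact: measurableI.
by apply/seteqP; split => x /= => [/andP[]|[-> ->]].
Qed.

Lemma measurable_set_or (b c : T -> bool) : measurable [set x | b x] ->
  measurable [set x | c x] -> measurable [set x | b x || c x].
Proof.
move=> mb mc; rewrite (_ : [set _ | _] = [set x | b x] `|` [set x | c x]).
  exact: measurableU.
by apply/seteqP; split => x /= => [/orP[]|[->|->]]; rewrite ?orbT; auto.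
Qed.

Lemma measurable_cw f g : measurable_fun setT f -> measurable_fun setT g ->
  measurable [set x | cw (f x) (g x)].
Proof.
move=> mf mg; have mB : measurable_fun setT (fun x => g x - f x) by exact: measurable_funB.
by repeat (apply: measurable_set_or || apply: measurable_set_and || apply: measurable_set_lt || apply: measurable_set_le).
Qed.

Lemma measurable_spans f g k : measurable_fun setT f -> measurable_fun setT g ->
  measurable_fun setT k -> measurable [set x | spans (f x) (g x) (k x)].
Proof.
move=> mf mg mk; have mB : measurable_fun setT (fun x => g x - f x) by exact: measurable_funB.
have mB' : measurable_fun setT (fun x => f x - g x) by exact: measurable_funB.
by repeat (apply: measurable_set_or || apply: measurable_set_and || apply: measurable_set_lt || apply: measurable_set_le).
Qed.

Lemma measurable_set_eq f g : measurable_fun setT f -> measurable_fun setT g ->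
  measurable [set x | f x = g x].
Proof.
move=> mf mg; rewrite (_ : [set _ | _] = [set x | f x <= g x] `&` [set x | g x <= f x]).
  by apply: measurableI; exact: measurable_set_le.
by apply/seteqP; split => x /= => [->//|[fg gf]]; apply: le_anti; rewrite fg.
Qed.

Lemma measurable_torus (h : R) : measurable (torus h).
Proof.
have -> : torus h = `[0, 1[%classic `*` `[0, h[%classic.
  by apply/seteqP; split => -[a b] /=; rewrite !in_itv.
exact: measurableX.
Qed.

Arguments measurable_torus : clear implicits.

Lemma measurable_tie_set (h : R) u v w : measurable_fun setT u ->
  measurable_fun setT v -> measurable_fun setT w ->
  measurable [set x | [/\ torus h (v x), torus h (w x), (v x).1 != (w x).1 &
    torus h (u x) /\ torus_dist h (u x) (v x) = torus_dist h (u x) (w x)]].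
Proof.
move=> mu mv mw.
have mt (z : T -> R * R) : measurable_fun setT z -> measurable (z @^-1` torus h).
  by move=> mz; rewrite -[X in measurable X]setTI; exact: (mz measurableT _ (measurable_torus h)).
rewrite (_ : [set _ | _] = v @^-1` torus h `&` (w @^-1` torus h `&`
   (~` [set x | (v x).1 = (w x).1] `&` (u @^-1` torus h `&`
    [set x | torus_dist h (u x) (v x) = torus_dist h (u x) (w x)])))).
  apply: measurableI; first exact: mt.
  apply: measurableI; first exact: mt.
  apply: measurableI.
    by apply: measurableC; apply: measurable_set_eq;
      [exact: (measurableT_comp measurable_fst mv)|exact: (measurableT_comp measurable_fst mw)].
  apply: measurableI; first exact: mt.
  by apply: measurable_set_eq; exact: measurable_torus_dist.
apply/seteqP; split => x /=.
  by move=> [tb tc /eqP bc [ta dd]].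
by move=> [tb [tc [/eqP bc [ta dd]]]].
Qed.

End Generic.

Lemma measurable_tnth1 n (i : 'I_n) :
  measurable_fun setT (fun x : n.-tuple (R * R) => (tnth x i).1).
Proof. exact: (measurableT_comp measurable_fst (measurable_tnth i)). Qed.

(** The candidates depend on the positions through the tests [covers] and [cw]
    only. *)
Lemma candidates_measurable (eta h B : R) n (e : {set {set 'I_n}}) (i : 'I_n) :
  measurable [set x : n.-tuple (R * R) | i \in candidates eta h B x e].
Proof.
pose A := ('I_n * 'I_n * 'I_n + 'I_n * 'I_n)%type.
pose b (a : A) (x : n.-tuple (R * R)) : bool := match a with
  | inl (u, v, w) => covers eta h x u v w
  | inr (u, v) => cw (tnth x u).1 (tnth x v).1
  end.
pose ex (g : {ffun A -> bool}) v :=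
  ~~ [exists u, exists w, ([set u; w]%SET \in e) && g (inl (u, w, v))].
pose F (g : {ffun A -> bool}) : bool := ex g i &&
  ((#|[set w | [&& w != i, ex g w & g (inr (i, w))]]%SET|%:R < B) ||
   (#|[set w | [&& w != i, ex g w & g (inr (w, i))]]%SET|%:R < B)).
have -> : [set x : n.-tuple (R * R) | i \in candidates eta h B x e] =
   [set x | F [ffun a => b a x]].
  have exE x v : exposed eta h x e v = ex [ffun a => b a x] v.
    by congr (~~ _); apply: eq_existsb => u; apply: eq_existsb => w; rewrite ffunE.
  apply/seteqP; split => x /=; rewrite inE /F exE => /andP[-> /orP[] c] /=;
    apply/orP; [left|right|left|right]; apply: le_lt_trans c; rewrite ler_nat;
    apply: subset_leq_card; apply/fintype.subsetP => w; rewrite !inE !ffunE exE /=;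
    by [].
apply: (@measurable_finite_atoms _ _ A b F) => -[[[u v] w]|[u v]] /=.
  apply: measurable_set_and; last by apply: measurable_spans; exact: measurable_tnth1.
  by apply: measurable_set_le => //; apply: measurable_torus_dist; exact: measurable_tnth.
by apply: measurable_cw; exact: measurable_tnth1.
Qed.

End Measurability.

Section Ties.
Context {R : realType} d (T : measurableType d) (P : probability T R).
Variables (h : R) (X : nat -> T -> R * R) (p : nat -> T -> nat).
Hypothesis h0 : 0 < h.
Hypothesis M : nn_model P h X p.

(** A consequence of [prob_le_close] for [K] arbitrarily large. *)
Lemma prob_le_same_abscissa i j : i != j -> prob_le P [set w | (X i w).1 = (X j w).1] 0.
Proof.
move=> ij; have mE : measurable [set w | (X i w).1 = (X j w).1].
  apply: measurable_set_eq.
    exact: (measurableT_comp measurable_fst (nn_pos_measurable M i)).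
  exact: (measurableT_comp measurable_fst (nn_pos_measurable M j)).
apply: prob_leI => //; apply/lee_addgt0Pr => e e0; rewrite add0e.
(* Chosen so that the bound [3 / L] of [prob_le_close] is at most [e]. *)
pose L := (Num.truncn (3 / e)).+1.
have L0 : 0 < L%:R :> R by rewrite ltr0n.
apply: prob_leE => //.
apply: prob_leW (_ : 3 / L%:R <= e) _.
  rewrite ler_pdivrMr // mulrC -ler_pdivrMr //; exact/ltW/truncnS_gt.
apply: prob_leS (prob_le_close h0 M ij (isT : (0 < L)%N)) => w /= ->.
by rewrite /circle_dist subrr normr0 gt_min invr_gt0 L0.
Qed.

(** Up to the choice of one of three lifts, the square of the horizontal
    distance is a monic quadratic polynomial in [x]. *)
Lemma circle_dist1_sqr (x b : R) : 0 <= x < 1 -> 0 <= b < 1 ->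
  exists k : 'I_3, circle_dist 1 x b ^+ 2 = (x - b + k%:R - 1) ^+ 2.
Proof.
move=> /andP[x0 x1] /andP[b0 b1]; rewrite /circle_dist /Num.min.
case: ifPn => _; first by exists (inord 1); rewrite inordK // real_normK ?num_real //; congr (_ ^+ 2); lra.
have [xb|xb] := leP b x.
  by exists (inord 0); rewrite inordK // ger0_norm; last lra; rewrite -sqrrN; congr (_ ^+ 2); lra.
by exists (inord 2); rewrite inordK // ltr0_norm; last lra; congr (_ ^+ 2); lra.
Qed.

(** On a horizontal line, the points equidistant from [b] and [c] solve one of
    nine equations.  In each of them the squares of [x] cancel, and the
    coefficient of [x] is nonzero since [b] and [c] have distinct abscissae. *)
Lemma bisector_null (b c : R * R) : torus h b -> torus h c -> b.1 != c.1 ->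
  measurable [set a | torus h a /\ torus_dist h a b = torus_dist h a c] ->
  (lebesgue_measure \x lebesgue_measure)%E
    [set a | torus h a /\ torus_dist h a b = torus_dist h a c] = 0%E.
Proof.
move=> [b1 b2] [c1 c2] bc mS.
rewrite (@product_measure_unique _ _ _ _ _ _ _ (lebesgue_measure \x^ lebesgue_measure)%E) //; last first.
  by move=> A B mA mB; rewrite /= product_measure2E.
rewrite /= /product_measure2; apply: integral0_eq => y _ /=.
apply: countable_lebesgue_measure0.
pose D := (circle_dist h y b.2 ^+ 2 - circle_dist h y c.2 ^+ 2).
(* The root of the equation for the lifts numbered [u.1] and [u.2]. *)
pose F (u : 'I_3 * 'I_3) := ((c.1 - u.2%:R + 1) ^+ 2 - (b.1 - u.1%:R + 1) ^+ 2 - D)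
   / (2 * (c.1 - u.2%:R - b.1 + u.1%:R)).
apply: (@sub_countable _ _ _ (range F)); last first.
  by apply: finite_set_countable; exact: finite_image.
apply: subset_card_le => x; rewrite /ysection /= inE => -[[x1 x2] /= E].
have [k1 k1E] := circle_dist1_sqr x1 b1.
have [k2 k2E] := circle_dist1_sqr x1 c1.
have := congr1 (fun r : R => r ^+ 2) E; rewrite /torus_dist !sqr_sqrtr ?addr_ge0 ?sqr_ge0 //=.
rewrite k1E k2E => E2.
have bc3 : c.1 - k2%:R - b.1 + k1%:R != 0.
  apply: contra_neq bc; move: b1 c1 => /andP[b01 b11] /andP[c01 c11].
  by case: k1 k2 {k1E k2E E2} => [[|[|[|//]]] ?] [[|[|[|//]]] ?] /=; lra.
exists (k1, k2) => //; rewrite /F /=.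
apply: (@mulIf _ (2 * (c.1 - k2%:R - b.1 + k1%:R))); first by rewrite mulf_neq0.
rewrite divfK ?mulf_neq0 // /D.
apply/eqP; rewrite -subr_eq0; apply/eqP.
move/eqP: E2; rewrite -subr_eq0 => /eqP e.
by rewrite -[RHS]oppr0 -e /=; ring.
Qed.

Lemma model_triple i j k (A B C : set (R * R)) : i != j -> i != k -> j != k ->
  measurable A -> measurable B -> measurable C ->
  P [set w | [/\ A (X i w), B (X j w) & C (X k w)]] =
  (P (X i @^-1` A) * (P (X j @^-1` B) * P (X k @^-1` C)))%E.
Proof.
move=> ij ik jk mA mB mC.
pose D l := if l == i then A else if l == j then B else if l == k then C else setT.
have mD l : measurable (D l) by rewrite /D; do 3 case: ifP => // _.
pose n := (i + j + k).+1.
have [i_n j_n k_n] : [/\ (i < n)%N, (j < n)%N & (k < n)%N] by rewrite /n; split; lia.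
have -> : [set w | [/\ A (X i w), B (X j w) & C (X k w)]] =
    [set w | forall l, (l < n)%N -> D l (X l w)].
  apply/seteqP; split => w /=.
    move=> [Aw Bw Cw] l _; rewrite /D.
    by do 3 (case: eqP => [->//|_]).
  move=> Dw; split.
  - by have := Dw i i_n; rewrite /D eqxx.
  - by have := Dw j j_n; rewrite /D eqxx (eq_sym j) (negPf ij).
  - by have := Dw k k_n; rewrite /D eqxx !(eq_sym k) (negPf ik) (negPf jk).
rewrite (model_independent M) // (bigD1 (Ordinal i_n)) //= (bigD1 (Ordinal j_n)) /=; last first.
  by rewrite -val_eqE /= eq_sym.
rewrite (bigD1 (Ordinal k_n)) /=; last by rewrite -!val_eqE /= !(eq_sym k) ik jk.
rewrite big1 ?mule1 => [|l]; last first.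
  rewrite -!val_eqE /= /D => /andP[/andP[/negPf -> /negPf ->] /negPf ->].
  by rewrite preimage_setT probability_setT.
by rewrite /D !eqxx (eq_sym j) (negPf ij) !(eq_sym k) (negPf ik) (negPf jk).
Qed.

(** [X i] is independent of the pair [(X j, X k)], and for given values of the
    pair the ties form a null set by [bisector_null]. *)
Lemma no_ties i j k : i != j -> i != k -> j != k ->
  prob_le P [set w | (X j w).1 != (X k w).1 /\
    torus_dist h (X i w) (X j w) = torus_dist h (X i w) (X k w)] 0.
Proof.
move=> ij ik jk.
have mX l := nn_pos_measurable M l.
pose f : {mfun T >-> (R * R)%type} := mfun_Sub (mem_set (mX i)).
have mg : measurable_fun setT (fun w => (X j w, X k w)).
  by apply/measurable_fun_pairP; split; [exact: (mX j)|exact: (mX k)].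
pose g : {mfun T >-> ((R * R) * (R * R))%type} := mfun_Sub (mem_set mg).
pose V := (R * R)%type.
pose S (b c : V) := [set a | torus h a /\ torus_dist h a b = torus_dist h a c].
pose D := [set u : V * (V * V) | [/\ torus h u.2.1, torus h u.2.2, u.2.1.1 != u.2.2.1
   & S u.2.1 u.2.2 u.1]].
have mD : measurable D.
  apply: (@measurable_tie_set _ _ _ h (fun u : V * (V * V) => u.1) (fun u => u.2.1)
     (fun u => u.2.2)).
  - exact: measurable_fst.
  - exact: (measurableT_comp measurable_fst measurable_snd).
  - exact: (measurableT_comp measurable_snd measurable_snd).
have secD (bc : V * V) : P (f @^-1` ysection D bc) = 0%E.
  have := measurable_ysection bc mD.
  case: (pselect [/\ torus h bc.1, torus h bc.2 & bc.1.1 != bc.2.1]) => [[tb tc nbc]|nbc].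
    have -> : ysection D bc = S bc.1 bc.2.
      by apply/seteqP; split => a; rewrite /ysection /= inE ; [by case|by split].
    move=> mS; have := nn_pos_uniform M i mS.
    rewrite (_ : S bc.1 bc.2 `&` torus h = S bc.1 bc.2); last first.
      by apply/seteqP; split => a [] //= ta dd.
    by rewrite bisector_null // mule0.
  have -> : ysection D bc = set0; last by rewrite preimage_set0 measure0.
  by apply/seteqP; split => a //; rewrite /ysection /= inE => -[tb tc nbc' _]; apply: nbc.
apply: (prob_leS (B := [set w | D (f w, g w)])) => [w /= [neq tie]|].
  by split => //=; [exact: (nn_pos_torus M)|exact: (nn_pos_torus M)|split => //; exact: (nn_pos_torus M)].
apply: prob_leI.
  have mfg : measurable_fun setT (fun w => (f w, g w)).
    by apply/measurable_fun_pairP; split.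
  by rewrite -[X in measurable X]setTI; exact: mfg.
rewrite null_by_sections // => A B mA mB.
have mfA : measurable (f @^-1` A) by rewrite -[X in measurable X]setTI; exact: (mX i measurableT _ mA).
have PfA : P (f @^-1` A) \is a fin_num by exact: fin_num_measure.
have PfA0 : 0 <= fine (P (f @^-1` A)) by rewrite fine_ge0.
have trip A' (B1 B2 : set V) : measurable A' -> measurable B1 -> measurable B2 ->
   P (f @^-1` A' `&` g @^-1` (B1 `*` B2)) = (P (f @^-1` A') * (P (X j @^-1` B1) * P (X k @^-1` B2)))%E.
  move=> mA' mB1 mB2; rewrite -model_triple //.
  by congr (P _); apply/seteqP; split => w /= => [[? [? ?]]|[? ? ?]].
rewrite setIC -[in RHS](fineK PfA).
apply: (measure_prod_unique (m1 := pushforward (mrestr P mfA) g)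
  (m2 := mscale (NngNum PfA0) (pushforward P g))) => //.
  by rewrite /= /pushforward /mrestr preimage_setT setTI -ge0_fin_numE.
move=> B1 B2 mB1 mB2; rewrite /= /pushforward /mrestr /mscale /= fineK //.
have tripT := trip _ _ _ measurableT mB1 mB2.
rewrite preimage_setT setTI probability_setT mul1e in tripT.
by rewrite setIC trip //; congr (_ * _)%E; rewrite -tripT.
Qed.

End Ties.

(** * The success event *)

Section Liminf.
Context {R : realType}.
Implicit Types (u : (\bar R)^nat) (l : \bar R).

Lemma limn_einf_le u l N : (forall n, (N <= n)%N -> (u n <= l)%E) -> (limn_einf u <= l)%E.
Proof.
move=> ul; rewrite limn_einf_lim; apply: lime_le; first exact: is_cvg_einfs.
near=> n; apply: (@le_trans _ _ (u n)).
  by apply: ereal_inf_lbound; exists n => /=.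
by apply: ul; near: n; exists N.
Unshelve. all: by end_near. Qed.

Lemma limn_einf_ge u l N : (forall n, (N <= n)%N -> (l <= u n)%E) -> (l <= limn_einf u)%E.
Proof.
move=> ul; rewrite limn_einf_lim; apply: lime_ge; first exact: is_cvg_einfs.
near=> n; apply: le_ereal_inf_tmp => _ [m /= nm <-]; apply: ul.
by apply: leq_trans nm; near: n; exists N.
Unshelve. all: by end_near. Qed.

End Liminf.

Lemma imset_eqi (aT rT : finType) (f : aT -> rT) (A B : {pred aT}) :
  A =i B -> f @: A = f @: B.
Proof.
by move=> AB; apply/setP => y; apply/imsetP/imsetP => -[x xA ->]; exists x; rewrite // ?AB // -AB.
Qed.

Section Success.
Context {R : realType} d (T : measurableType d) (P : probability T R).
Variables (h : R) (X : nat -> T -> R * R) (p : nat -> T -> nat).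
Hypothesis M : nn_model P h X p.
Variable H : procedure R.
Hypothesis rH : root_procedure H.

Definition success n : set T := [set w | ord0 \in
    H [tuple X i w | i < n.+1] (tree_edges n.+1 (p^~ w))].

Lemma measurable_tree_edges n (e : {set {set 'I_n}}) :
  measurable [set w | tree_edges n (p^~ w) = e].
Proof.
pose b (u : 'I_n * 'I_n) (w : T) : bool := p u.1 w == u.2.
pose G (g : {ffun 'I_n * 'I_n -> bool}) : {set {set 'I_n}} :=
  [set [set u.1; u.2]%SET | u : 'I_n * 'I_n & (0 < u.1)%N && g u]%SET.
have -> : [set w | tree_edges n (p^~ w) = e] = [set w | G [ffun u => b u w] = e].
  have TE w : tree_edges n (p^~ w) = G [ffun u => b u w].
    by apply: imset_eqi => -[u v]; rewrite !inE /= ffunE.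
  by apply/seteqP; split => w; rewrite /= TE.
apply: (@measurable_finite_atoms _ _ _ b (fun g => G g = e)) => -[u v].
rewrite (_ : [set _ | _] = p u @^-1` [set val v]); first exact: (nn_par_measurable M).
by apply/seteqP; split => w /= /eqP.
Qed.

Lemma measurable_success n : measurable (success n).
Proof.
have -> : success n = \bigcup_(e in [set: {set {set 'I_n.+1}}])
   ([set w | tree_edges n.+1 (p^~ w) = e] `&`
    [set w | [set x : n.+1.-tuple (R * R) | ord0 \in H x e] (positions X 1%g w)]).
  have XE w : [tuple X i w | i < n.+1] = positions X 1%g w.
    by apply: eq_from_tnth => i; rewrite !tnth_mktuple perm1.
  apply/seteqP; split => w; rewrite /success /= XE.
    by move=> ?; exists (tree_edges n.+1 (p^~ w)).
  by move=> [e _ [-> ?]].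
apply: fin_bigcup_measurable => // e _; apply: measurableI.
  exact: measurable_tree_edges.
exact: (measurable_positions_set M _ (procedure_measurable rH _ _)).
Qed.

End Success.

(** * Orders of arrival that cannot be told apart *)

Section NearestEdges.
Context {R : realType}.
Variables (h : R) (n : nat).
Implicit Types (x : n.-tuple (R * R)) (s : {perm 'I_n}).

Definition nearest x (i j : 'I_n) : bool := (j < i)%N &&
  [forall k : 'I_n, (k < i)%N ==>
    (torus_dist h (tnth x i) (tnth x j) <= torus_dist h (tnth x i) (tnth x k))].

(** All edges to a nearest older vertex.  Without ties this is the tree, and it
    makes sense as a function of the positions alone. *)
Definition nearest_edges x : {set {set 'I_n}} :=
  [set [set u.1; u.2]%SET | u : 'I_n * 'I_n & nearest x u.1 u.2]%SET.

Definition untied x := forall i j k : 'I_n, i != j -> i != k -> j != k ->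
  torus_dist h (tnth x i) (tnth x j) != torus_dist h (tnth x i) (tnth x k).

Lemma nearestP x (i j : 'I_n) : reflect ((j < i)%N /\ forall k : 'I_n, (k < i)%N ->
    torus_dist h (tnth x i) (tnth x j) <= torus_dist h (tnth x i) (tnth x k))
  (nearest x i j).
Proof.
apply: (iffP andP) => -[ji H]; split => //.
  by move=> k; exact/implyP/(forallP H).
by apply/forallP => k; apply/implyP; exact: H.
Qed.

Lemma tree_edges_nearest (y : nat -> R * R) (p : nat -> nat) :
  nn_parents h n y p -> untied [tuple y i | i < n] ->
  tree_edges n p = nearest_edges [tuple y i | i < n].
Proof.
move=> ynn unt; apply/eqP; rewrite finset.eqEsubset; apply/andP; split;
  apply/fintype.subsetP => A /imsetP[[u v]]; rewrite inE /= => uv ->;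
  apply/imsetP; exists (u, v) => //; rewrite inE /=.
  move: uv => /andP[u0 /eqP puv].
  have un : (0 < u < n)%N by rewrite u0 ltn_ord.
  have [pu Hp] := ynn u un; apply/nearestP; rewrite -puv; split => // k ku.
  by rewrite !tnth_mktuple -puv; exact: Hp.
have [vu Hv] := nearestP _ _ _ uv.
have u0 : (0 < u)%N by exact: leq_ltn_trans vu.
have un : (0 < u < n)%N by rewrite u0 ltn_ord.
have [pu Hp] := ynn u un; rewrite u0 /=.
have pn : (p u < n)%N by exact: ltn_trans pu (ltn_ord u).
apply/negPn/negP => puv.
have := unt u v (Ordinal pn); rewrite -!val_eqE /= (gtn_eqF vu) (gtn_eqF pu) eq_sym puv.
move=> /(_ isT isT isT) /eqP; apply; apply: le_anti.
by rewrite Hv //= !tnth_mktuple Hp.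
Qed.

Lemma measurable_nearest_edges (e : {set {set 'I_n}}) :
  measurable [set x : n.-tuple (R * R) | nearest_edges x = e].
Proof.
pose A := ('I_n * 'I_n * 'I_n)%type.
pose b (a : A) x : bool := torus_dist h (tnth x a.1.1) (tnth x a.1.2) <=
   torus_dist h (tnth x a.1.1) (tnth x a.2).
pose G (g : {ffun A -> bool}) : {set {set 'I_n}} :=
  [set [set u.1; u.2]%SET | u : 'I_n * 'I_n &
    (u.2 < u.1)%N && [forall k : 'I_n, (k < u.1)%N ==> g (u.1, u.2, k)]]%SET.
have -> : [set x : n.-tuple (R * R) | nearest_edges x = e] =
    [set x | G [ffun a => b a x] = e].
  have GE x : nearest_edges x = G [ffun a => b a x].
    apply: imset_eqi => -[u v]; rewrite !inE /nearest /=; congr andb.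
    by apply: eq_forallb => k; rewrite ffunE.
  by apply/seteqP; split => x; rewrite /= GE.
apply: (@measurable_finite_atoms _ _ _ b (fun g => G g = e)) => -[[i j] k].
by apply: measurable_set_le; apply: measurable_torus_dist; exact: measurable_tnth.
Qed.

End NearestEdges.

Section SlotOrder.
Variable K : nat.

(** Slot of the vertex arriving at time [t] in the order [r, r+1, ..., K-1],
    [r-1, ..., 0].  Vertices arriving from time [K] on keep their index. *)
Definition slot_of (r t : nat) : nat :=
  if (K <= t)%N then t else if (t + r < K)%N then (t + r)%N else (K.-1 - t)%N.

Lemma slot_of_lt n r t : (K <= n)%N -> (t < n)%N -> (slot_of r t < n)%N.
Proof. by rewrite /slot_of => Kn tn; (repeat case: ifP => ?); lia. Qed.

Lemma slot_of_ltK r t : (t < K)%N -> (slot_of r t < K)%N.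
Proof. by rewrite /slot_of => tK; (repeat case: ifP => ?); lia. Qed.

Lemma slot_of_inj r : (r < K)%N -> injective (slot_of r).
Proof. by move=> rK t u; rewrite /slot_of; (repeat case: ifP => ?); lia. Qed.

Lemma slot_of0 r : (r < K)%N -> slot_of r 0 = r.
Proof. by rewrite /slot_of => rK; (repeat case: ifP => ?); lia. Qed.

Definition slot_perm_fun n (Kn : (K <= n)%N) r (t : 'I_n) : 'I_n :=
  Ordinal (slot_of_lt r Kn (ltn_ord t)).

Lemma slot_perm_inj n (Kn : (K <= n)%N) (r : 'I_K) : injective (slot_perm_fun Kn r).
Proof.
by move=> t u /(congr1 val) /= /(slot_of_inj (ltn_ord r)) /val_inj.
Qed.

Definition slot_perm n (Kn : (K <= n)%N) (r : 'I_K) : {perm 'I_n} := perm (@slot_perm_inj n Kn r).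

Lemma slot_permE n (Kn : (K <= n)%N) (r : 'I_K) t : slot_perm Kn r t = slot_of r t :> nat.
Proof. by rewrite permE. Qed.

End SlotOrder.

Section Slots.
Context {R : realType}.
Variables (h : R) (K : nat).
Hypothesis K0 : (0 < K)%N.

(** The slots spread over a quarter of the circle, where distances are absolute
    differences. *)
Definition slot_gap : R := (4 * K%:R)^-1.
Local Notation s := slot_gap.
Hypothesis hs : 0 < h <= s.

Definition slot (j : nat) : set (R * R) := [set z | j%:R * s <= z.1 < j%:R * s + s / 16].

Lemma slot_gap_gt0 : 0 < s.
Proof. by rewrite invr_gt0 mulr_gt0 // ltr0n. Qed.

(** A vertex in an adjacent slot is at distance at most [(1 + 1/16 + 1/2) s], and
    one in a farther slot at least [(2 - 1/16) s]. *)
Lemma slot_near (i j l : nat) (a b c : R * R) : (i < K)%N -> (j < K)%N -> (l < K)%N ->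
  torus h a -> torus h b -> torus h c -> slot i a -> slot j b -> slot l c ->
  (j == i.+1) || (i == j.+1) -> (l.+1 < i)%N || (i.+1 < l)%N ->
  torus_dist h a b < torus_dist h a c.
Proof.
move=> iK jK lK ta tb tc /andP[a1 a2] /andP[b1 b2] /andP[c1 c2] ij il.
have s0 := slot_gap_gt0; move/andP: hs => [h0 hs'].
apply: le_lt_trans (torus_dist_le_circle ta tb) _.
apply: lt_le_trans (circle_dist_le_torus ta tc).
have Ks : K%:R * s = 1 / 4 by rewrite /slot_gap; field; rewrite pnatr_eq0 -lt0n.
have ub m : (m < K)%N -> 0 <= m%:R * s /\ m%:R * s + s <= 1 / 4.
  move=> mK; split; first by rewrite mulr_ge0 ?ler0n // ltW.
  by rewrite -Ks -[in X in _ + X](mul1r s) -mulrDl ler_pM2r // natr1 ler_nat.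
have [i1 i2] := ub _ iK; have [l1 l2] := ub _ lK.
have dab : circle_dist 1 a.1 b.1 <= s + s / 16.
  rewrite /circle_dist ge_min ler_norml; apply/orP; left.
  case/orP: ij => /eqP E.
    have Ej : j%:R * s = i%:R * s + s by rewrite E -[i.+1%:R]natr1 mulrDl mul1r.
    by rewrite Ej in b1 b2; apply/andP; split; lra.
  have Ei : i%:R * s = j%:R * s + s by rewrite E -[j.+1%:R]natr1 mulrDl mul1r.
  by rewrite Ei in a1 a2; apply/andP; split; lra.
have dac : 2 * s - s / 16 <= circle_dist 1 a.1 c.1.
  have dn : `|a.1 - c.1| <= 1 / 4 by rewrite ler_norml; apply/andP; split; lra.
  rewrite /circle_dist le_min; apply/andP; split.
    rewrite ler_normr; apply/orP.
    case/orP: il => il; [left|right].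
      have : (l%:R + 2) * s <= i%:R * s by rewrite ler_pM2r // -natrD ler_nat addn2.
      by rewrite mulrDl; lra.
    have : (i%:R + 2) * s <= l%:R * s by rewrite ler_pM2r // -natrD ler_nat addn2.
    by rewrite mulrDl; lra.
  have : s <= 1 / 4 by lra.
  by lra.
lra.
Qed.

Definition in_slots n (x : n.-tuple (R * R)) : Prop :=
  forall j : 'I_n, (j < K)%N -> slot j (tnth x j).

Lemma slot_nearest n (x : n.-tuple (R * R)) (f : 'I_n -> nat) (u v : 'I_n) :
  (forall i, torus h (tnth x i)) ->
  (forall i : 'I_n, (i <= u)%N -> (f i < K)%N /\ slot (f i) (tnth x i)) ->
  (forall i : 'I_n, (i < u)%N -> f i = f v \/ ((f i).+1 < f u)%N \/ ((f u).+1 < f i)%N) ->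
  (forall i : 'I_n, (i < u)%N -> f i = f v -> i = v) ->
  (v < u)%N -> (f u == (f v).+1) || (f v == (f u).+1) ->
  forall w, nearest h x u w <-> w = v.
Proof.
move=> tx fs fv fvinj vu adj.
have [fuK su] := fs u (leqnn u); have [fvK sv] := fs v (ltnW vu).
have far (k : 'I_n) : (k < u)%N -> k != v ->
    torus_dist h (tnth x u) (tnth x v) < torus_dist h (tnth x u) (tnth x k).
  move=> ku kv; have [fkK sk] := fs k (ltnW ku).
  apply: (slot_near fuK fvK fkK) => //; first by rewrite orbC.
  by case: (fv k ku) => [/(fvinj _ ku) E|[->|->]]; rewrite ?orbT //; rewrite E eqxx in kv.
move=> w; split => [/nearestP[wu Hw]|->].
  apply/eqP/negPn/negP => wv.
  by have := far w wu wv; rewrite ltNge Hw.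
apply/nearestP; split => // k ku; have [->//|kv] := eqVneq k v.
exact: ltW (far _ _ _).
Qed.

(** Renaming the vertices by their slots turns the tree built in the order
    [slot_of K r] into the one built by the same points in the order of the
    slots.  In both, each of the first [K] vertices but the oldest is joined to
    its only older neighbour in slot order, which gives the path through the
    slots.  Later vertices see the same set of older points in both orders. *)
Lemma relabel_nearest_edges n (Kn : (K <= n)%N) (r : 'I_K) (x : n.-tuple (R * R)) :
  (forall i, torus h (tnth x i)) ->
  in_slots (relabel_pos (slot_perm Kn r) x) ->
  relabel_edges (slot_perm Kn r) (nearest_edges h x) =
  nearest_edges h (relabel_pos (slot_perm Kn r) x).
Proof.
set sg := slot_perm Kn r; set y := relabel_pos sg x => tx sy.
have ty i : torus h (tnth y i) by rewrite tnth_mktuple.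
have yx i : tnth y (sg i) = tnth x i by exact: tnth_relabel.
have rK := ltn_ord r.
have early (u v : 'I_n) : (v < u)%N -> (u < K)%N ->
    (sg u == (sg v).+1 :> nat) || (sg v == (sg u).+1 :> nat) ->
    forall w, nearest h x u w <-> w = v.
  move=> vu uK adj; apply: (slot_nearest (f := fun i => sg i)) => //.
  - move=> i iu; have iK : (i < K)%N by exact: leq_ltn_trans iu uK.
    have siK : (sg i < K)%N by rewrite slot_permE slot_of_ltK.
    by split => //; rewrite -yx; exact: sy.
  - move=> i iu; move: adj; rewrite !slot_permE /slot_of.
    have iK : (i < K)%N by exact: ltn_trans iu uK.
    have vK : (v < K)%N by exact: ltn_trans vu uK.
    by do ![case: ifP => ?]; lia.
  - by move=> i _ /val_inj /perm_inj.
have earlyY (u v : 'I_n) : (u < K)%N -> u = v.+1 :> nat ->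
    forall w, nearest h y u w <-> w = v.
  move=> uK uv; apply: (slot_nearest (f := fun i => i)) => //.
  - move=> i iu; have iK : (i < K)%N by exact: leq_ltn_trans iu uK.
    by split => //; exact: sy.
  - by move=> i iu; move: iu; rewrite uv; clear; lia.
  - by move=> i _ /val_inj.
  - by rewrite uv.
  - by rewrite uv eqxx.
have late (u : 'I_n) : (K <= u)%N -> sg u = u /\ forall t : 'I_n, (sg t < u)%N = (t < u)%N.
  move=> Ku; split; first by apply: val_inj; rewrite /= slot_permE /slot_of Ku.
  by move=> t; rewrite slot_permE /slot_of; (repeat case: ifP => ?); lia.
have lateE (u v : 'I_n) : (K <= u)%N -> nearest h x u v = nearest h y u (sg v).
  move=> Ku; have [su st] := late u Ku.
  have yu : tnth y u = tnth x u by rewrite -yx su.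
  rewrite /nearest st; congr andb; apply/forallP/forallP => H k.
    rewrite -(permKV sg k) st yu !yx; exact: H.
  by have := H (sg k); rewrite st yu !yx.
have pair (a b c e : 'I_n) : a = c -> b = e -> [set a; b]%SET = [set c; e]%SET by move=> -> ->.
apply/eqP; rewrite finset.eqEsubset; apply/andP; split; apply/fintype.subsetP => A.
  case/imsetP => A0 /imsetP[[u v]]; rewrite inE /= => uv -> ->.
  rewrite imsetU !imset_set1.
  have [Ku|uK] := leqP K u.
    apply/imsetP; exists (sg u, sg v) => //; rewrite inE /=.
    by have [-> _] := late u Ku; rewrite -lateE.
  have vu : (v < u)%N by case/nearestP: uv.
  have [t [tu tadj]] : exists t : 'I_n, (t < u)%N /\
      ((sg u == (sg t).+1 :> nat) || (sg t == (sg u).+1 :> nat)).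
    have pn : (u.-1 < n)%N by apply: leq_ltn_trans (ltn_ord u); exact: leq_pred.
    have zn : (0 < n)%N by exact: (leq_trans K0 (Kn)).
    have [ur|ur] := eqVneq (u : nat) (K - r)%N.
      exists (Ordinal zn); rewrite !slot_permE /slot_of /=; split; first lia.
      by do ![case: ifP => ?]; lia.
    exists (Ordinal pn); rewrite !slot_permE /slot_of /=; split; first lia.
    by do ![case: ifP => ?]; lia.
  have vt := iffLR (early u t tu uK tadj v) uv; subst v.
  have su : (sg u < K)%N by rewrite slot_permE slot_of_ltK.
  have st : (sg t < K)%N by rewrite slot_permE slot_of_ltK // (ltn_trans tu).
  case/orP: tadj => /eqP adj.
    apply/imsetP; exists (sg u, sg t) => //; rewrite inE /=.
    by apply/(earlyY (sg u) (sg t)).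
  rewrite finset.setUC; apply/imsetP; exists (sg t, sg u) => //; rewrite inE /=.
  by apply/(earlyY (sg t) (sg u)).
case/imsetP => -[u v]; rewrite inE /= => uv ->.
have rel (a b : 'I_n) : nearest h x a b -> [set sg a; sg b]%SET \in relabel_edges sg (nearest_edges h x).
  move=> ab; rewrite mem_relabel_edges; apply/imsetP; exists (a, b) => //.
  by rewrite inE.
have [Ku|uK] := leqP K u.
  have [su _] := late u Ku.
  rewrite -su -(permKV sg v); apply: rel.
  by rewrite lateE // permKV.
have vu : (v < u)%N by case/nearestP: uv.
have pn : (u.-1 < n)%N by apply: leq_ltn_trans (ltn_ord u); exact: leq_pred.
have vE : v = u.-1 :> nat.
  have uE : u = (Ordinal pn).+1 :> nat by rewrite /= prednK // (leq_ltn_trans _ vu).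
  by have /(iffLR (earlyY u (Ordinal pn) uK uE v)) -> := uv.
have vK : (v < K)%N by exact: ltn_trans vu uK.
pose a := (sg^-1)%g u; pose b := (sg^-1)%g v.
have sa : sg a = u by rewrite permKV.
have sb : sg b = v by rewrite permKV.
have adj : (sg a == (sg b).+1 :> nat) || (sg b == (sg a).+1 :> nat).
  by rewrite sa sb vE prednK ?eqxx // (leq_ltn_trans _ vu).
have aK : (a < K)%N.
  by rewrite ltnNge; apply/negP => Ka; have [E _] := late a Ka; move: uK; rewrite -sa E; lia.
have bK : (b < K)%N.
  by rewrite ltnNge; apply/negP => Kb; have [E _] := late b Kb; move: vK; rewrite -sb E; lia.
have [ba|ab|ab] := ltngtP b a.
- by rewrite -sa -sb; apply: rel; apply/(early a b).
- rewrite -sa -sb finset.setUC; apply: rel; apply/(early b a) => //.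
  by rewrite orbC.
- by move: vu; rewrite -sa -sb (val_inj ab) ltnn.
Qed.

End Slots.

Section LowerBound.
Context {R : realType} d (T : measurableType d) (P : probability T R).
Variables (h : R) (X : nat -> T -> R * R) (p : nat -> T -> nat).
Hypothesis M : nn_model P h X p.
Variables (H : procedure R) (b : R) (K : nat).
Hypothesis rH : root_procedure H.
Hypothesis sizeH : size_at_most h H b.
Hypothesis K0 : (0 < K)%N.
Hypothesis bK : b < K%:R.
Hypothesis hs : 0 < h <= slot_gap (R := R) K.
Local Notation s := (slot_gap (R := R) K).
Local Notation slot := (slot (R := R) K).

(** A tie requires equal abscissae or the situation of [no_ties]. *)
Lemma prob_le_untied n : prob_le P [set w | ~ untied h (positions X (1%g : {perm 'I_n}) w)] 0.
Proof.
have h0 : 0 < h by case/andP: hs.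
have := @prob_le_exists_cst _ _ _ P ('I_n * 'I_n * 'I_n)%type
   (fun u => [&& u.1.1 != u.1.2, u.1.1 != u.2 & u.1.2 != u.2])
   (fun u => [set w | (X u.1.2 w).1 = (X u.2 w).1] `|`
     [set w | (X u.1.2 w).1 != (X u.2 w).1 /\
      torus_dist h (X u.1.1 w) (X u.1.2 w) = torus_dist h (X u.1.1 w) (X u.2 w)]) 0.
rewrite mulr0 => bound.
apply: prob_leS (bound _) => [w /= nu|[[i j] k] /= /and3P[ij ik jk]]; last first.
  by rewrite -[0](addr0 0); apply: prob_leU; [exact: (prob_le_same_abscissa h0 M)|exact: (no_ties h0 M)].
apply: contra_notP nu => nE i j k ij ik jk; rewrite !tnth_mktuple !perm1.
apply/eqP => E; apply: nE; exists (i, j, k) => /=; first by rewrite ij ik jk.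
by have [e|e] := eqVneq (X j w).1 (X k w).1; [left|right].
Qed.

Lemma prob_slots : P [set w | forall j, (j < K)%N -> slot j (X j w)] = ((s / 16) ^+ K)%:E.
Proof.
have h0 : 0 < h by case/andP: hs.
have s0 := slot_gap_gt0 (R := R) K0.
have Ks : K%:R * s = 1 / 4 by rewrite /slot_gap; field; rewrite pnatr_eq0 -lt0n.
have mS j : measurable (slot j) by exact: measurable_strip.
rewrite (model_independent M) //.
under eq_bigr => j _.
  rewrite (model_uniform_strip h0 M).
  - over.
  - by rewrite mulr_ge0 ?ler0n // ltW.
  - by rewrite lerDl divr_ge0 // ltW.
  - have : j.+1%:R * s <= K%:R * s by rewrite ler_pM2r // ler_nat.
    by rewrite -[j.+1%:R]natr1 mulrDl mul1r; lra.
rewrite prodEFin; under eq_bigr do rewrite addrAC subrr add0r.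
by rewrite prodr_const card_ord.
Qed.

Section FixedSize.
Variable n : nat.
Hypothesis Kn : (K <= n.+1)%N.
Local Notation pos := (positions X (1%g : {perm 'I_n.+1})).
Local Notation sg := (slot_perm Kn).

Let posE w : [tuple X i w | i < n.+1] = pos w.
Proof. by apply: eq_from_tnth => i; rewrite !tnth_mktuple perm1. Qed.

Let relabelE (r : 'I_K) w : relabel_pos (sg r) (pos w) = positions X ((sg r)^-1)%g w.
Proof. by apply: eq_from_tnth => i; rewrite !tnth_mktuple perm1. Qed.

Let torus_pos w i : torus h (tnth (pos w) i).
Proof. by rewrite tnth_mktuple; exact: (nn_pos_torus M). Qed.

Let edgesE w : untied h (pos w) -> tree_edges n.+1 (p^~ w) = nearest_edges h (pos w).
Proof.
move=> unt; rewrite -posE; apply: (@tree_edges_nearest _ _ _ (X^~ w)); last by rewrite posE.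
exact: (@nn_par_nearest _ _ _ _ _ _ _ M n.+1 w).
Qed.

(** Tuples listed in the order of the slots, from which the procedure does not
    return the vertex of slot [r]. *)
Definition misses (r : 'I_K) : set (n.+1.-tuple (R * R)) :=
  [set x | in_slots K x /\ widen_ord Kn r \notin H x (nearest_edges h x)].

Lemma measurable_misses r : measurable (misses r).
Proof.
have -> : misses r = (\bigcap_(j in [set j : 'I_n.+1 | (j < K)%N]) (@tnth _ _ ^~ j) @^-1` slot j) `&`
   \bigcup_(e in [set: {set {set 'I_n.+1}}]) ([set x | nearest_edges h x = e] `&`
     ~` [set x | widen_ord Kn r \in H x e]).
  apply/seteqP; split => x /=.
    move=> [sx nH]; split => //; exists (nearest_edges h x) => //; split => //.
    exact/negP.
  by move=> [sx [e _ [<- /negP]]].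
apply: measurableI.
  apply: fin_bigcap_measurable => // j _; rewrite -[X in measurable X]setTI.
  by apply: measurable_tnth => //; exact: measurable_strip.
apply: fin_bigcup_measurable => // e _; apply: measurableI.
  exact: measurable_nearest_edges.
by apply: measurableC; exact: (procedure_measurable rH).
Qed.

(** When the arrivals follow the order [slot_of K r], the root is in slot [r];
    by equivariance the procedure fails when it misses this slot. *)
Lemma misses_order (r : 'I_K) w : untied h (pos w) ->
  misses r (positions X ((sg r)^-1)%g w) ->
  (forall t, (t < K)%N -> slot (slot_of K r t) (X t w)) /\ ~ success X p H n w.
Proof.
move=> unt [sx nH]; split.
  move=> t tK; have tn : (t < n.+1)%N by exact: leq_trans tK Kn.
  have := sx (sg r (Ordinal tn)); rewrite slot_permE /= tnth_mktuple permK /=.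
  by apply; exact: slot_of_ltK.
rewrite /success /= posE edgesE // => H0.
rewrite -relabelE in sx nH.
move: nH; rewrite -(relabel_nearest_edges K0 hs (Kn := Kn) (torus_pos w) sx).
rewrite (procedure_equivariant rH).
have -> : widen_ord Kn r = sg r ord0.
  by apply: val_inj; rewrite /= slot_permE slot_of0.
by rewrite mem_imset ?H0 //; exact: perm_inj.
Qed.

(** For each [r], exchangeability equates the probability of [misses r] at the
    points in order of arrival with the one in the order [slot_of K r], where
    the root is missed.  The events [misses r] cover the event that the points
    arrive in the order of the slots, since fewer than [K] vertices are
    returned, and the failures for distinct [r] are disjoint. *)
Lemma prob_success_le : (P (success X p H n) <= (1 - (s / 16) ^+ K)%:E)%E.
Proof.
have mS := measurable_success M rH n.
pose A (r : 'I_K) := [set w | forall t, (t < K)%N -> slot (slot_of K r t) (X t w)].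
have mA r : measurable (A r).
  by apply: (@model_forall _ _ _ _ _ _ _ M K (fun t => slot (slot_of K r t))) => t; exact: measurable_strip.
pose F r := A r `&` ~` success X p H n.
have mF r : measurable (F r) by apply: measurableI => //; exact: measurableC.
have s0 := slot_gap_gt0 (R := R) K0.
have disjF r r' w : F r w -> F r' w -> r = r'.
  move=> [/(_ 0%N K0) + _] [/(_ 0%N K0) + _]; rewrite !slot_of0 // /slot /=.
  move=> /andP[r1 r2] /andP[r'1 r'2]; apply/val_inj/eqP.
  have lt_le (i j : nat) : i%:R * s < j%:R * s + s -> (i <= j)%N.
    by rewrite -[in X in _ + X](mul1r s) -mulrDl ltr_pM2r // natr1 ltr_nat ltnS.
  by rewrite eqn_leq !lt_le //; lra.
have Pmiss r : prob_le P [set w | misses r (pos w)] (fine (P (F r))).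
  apply: prob_leI.
    exact: (measurable_positions_set M _ (measurable_misses r)).
  rewrite (model_exchangeable M _ ((sg r)^-1)%g (measurable_misses r)).
  apply: prob_leE; first exact: (measurable_positions_set M _ (measurable_misses r)).
  rewrite -[fine _]addr0; apply: prob_leS (prob_leU (prob_leI (mF r) _) (prob_le_untied n.+1)).
    move=> w mw /=; have [unt|nunt] := pselect (untied h (pos w)); last by right.
    by left; have [] := misses_order unt mw.
  by rewrite fineK // fin_num_measure.
have Pslots : prob_le P [set w | forall j, (j < K)%N -> slot j (X j w)] (\sum_r fine (P (F r))).
  rewrite -[\sum_r _]addr0.
  apply: prob_leS (prob_leU (prob_le_exists (Q := xpredT) (fun r _ => Pmiss r)) (prob_le_untied n.+1)).
  move=> w sw; have [unt|nunt] := pselect (untied h (pos w)); last by right.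
  left => /=; have inS : in_slots K (pos w) by move=> j jK; rewrite tnth_mktuple perm1; exact: sw.
  have size_w : #|H (pos w) (nearest_edges h (pos w))|%:R <= b.
    apply: sizeH; exists (X^~ w), (p^~ w), 1%g; split.
    - by move=> i _; exact: (nn_pos_torus M).
    - exact: (@nn_par_nearest _ _ _ _ _ _ _ M n.+1 w).
    - by apply: eq_from_tnth => i; rewrite !tnth_mktuple invg1 !perm1.
    - rewrite -edgesE //; apply/setP => B; apply/idP/imsetP => [Be|[B' B'e ->]].
        by exists B => //; rewrite (eq_imset _ (@perm1 _)) imset_id.
      by rewrite (eq_imset _ (@perm1 _)) imset_id.
  suff [r nr] : exists r : 'I_K, widen_ord Kn r \notin H (pos w) (nearest_edges h (pos w)).
    by exists r.
  apply/existsP; rewrite -negb_forall; apply/negP => /forallP all.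
  have : (K <= #|H (pos w) (nearest_edges h (pos w))|)%N.
    have widen_inj : injective (widen_ord Kn) by move=> i j /(congr1 val) /= /val_inj.
    rewrite -[K]card_ord -(card_imset _ widen_inj).
    by apply/subset_leq_card/fintype.subsetP => _ /imsetP[r _ ->]; exact: all.
  by rewrite -(ler_nat R) leNgt (le_lt_trans size_w bK).
have q_le : (s / 16) ^+ K <= \sum_r fine (P (F r)).
  rewrite -lee_fin -prob_slots; apply: prob_leE Pslots.
  by apply: (model_forall M) => t; exact: measurable_strip.
have sum_le : \sum_r fine (P (F r)) <= fine (P (~` success X p H n)).
  have Pf : P (~` success X p H n) \is a fin_num by rewrite fin_num_measure //; exact: measurableC.
  rewrite -lee_fin fineK // -sumEFin.
  under eq_bigr do rewrite fineK ?fin_num_measure //.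
  rewrite -big_enum /= (sum_prob_disjoint _ (enum_uniq _) mF disjF).
  apply: le_measure; rewrite ?inE.
  - rewrite (_ : [set w | _] = \bigcup_(r in [set: 'I_K]) F r).
      exact: fin_bigcup_measurable.
    by apply/seteqP; split => w /= [r _ Fr]; exists r => //; rewrite mem_enum.
  - exact: measurableC.
  - by move=> w [r _ []].
have fS : P (success X p H n) \is a fin_num by exact: fin_num_measure.
rewrite -(fineK fS) lee_fin.
have : fine (P (~` success X p H n)) = 1 - fine (P (success X p H n)).
  by rewrite probability_setC // fineB.
lra.
Qed.

End FixedSize.

Lemma liminf_success_le : (liminf_success P X p H <= (1 - (s / 16) ^+ K)%:E)%E.
Proof. by apply: (@limn_einf_le _ _ _ K) => n Kn; apply: prob_success_le; exact: ltnW. Qed.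

End LowerBound.

(** * The finder as a program *)

Section Runs.
Context {R : realType}.
Implicit Types (st : state R) (c : cmd) (Q : state R -> Prop).

(** Total correctness with a time bound. *)
Definition runs c st (t : nat) Q : Prop :=
  exists t' st', [/\ exec c st t' st', (t' <= t)%N & Q st'].

Lemma runs_le c st t t' Q : (t <= t')%N -> runs c st t Q -> runs c st t' Q.
Proof. by move=> tt [u [st' [e ut q]]]; exists u, st'; split => //; exact: leq_trans tt. Qed.

Lemma runs_seq c1 c2 st t1 t2 Q :
  runs c1 st t1 (fun st' => runs c2 st' t2 Q) -> runs (Seq c1 c2) st (t1 + t2) Q.
Proof.
move=> [u1 [st1 [e1 ut1 [u2 [st2 [e2 ut2 q]]]]]]; exists (u1 + u2)%N, st2; split => //.
  exact: ExecSeq e1 e2.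
exact: leq_add.
Qed.

Lemma runs_if b c1 c2 st t Q :
  runs (if beval st b then c1 else c2) st t Q -> runs (If b c1 c2) st (bcost b + t) Q.
Proof.
move=> [u [st' [e ut q]]]; exists (bcost b + u)%N, st'; split => //.
  exact: ExecIf.
by rewrite leq_add2l.
Qed.

Lemma runs_skip st Q : Q st -> runs Skip st 1 Q.
Proof. by move=> q; exists 1%N, st; split => //; exact: ExecSkip. Qed.

Lemma runs_iset a i e st Q : Q (set_int st a (ieval st i) (ieval st e)) ->
  runs (ISet a i e) st (icost i + icost e).+1 Q.
Proof.
by move=> q; exists (icost i + icost e).+1, (set_int st a (ieval st i) (ieval st e)); split => //; exact: ExecISet.
Qed.

Lemma runs_rset a i e st Q : Q (set_real st a (ieval st i) (reval st e)) ->
  runs (RSet a i e) st (icost i + rcost e).+1 Q.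
Proof.
by move=> q; exists (icost i + rcost e).+1, (set_real st a (ieval st i) (reval st e)); split => //; exact: ExecRSet.
Qed.

Definition counter k : iexpr := IGet 4 (ILit k).

Definition incr k : cmd := ISet 4 (ILit k) (IAdd (counter k) (ILit 1)).

(** The loop counter is cell [k] of integer array 4. *)
Definition For k (bound : iexpr) (body : cmd) : cmd :=
  Seq (ISet 4 (ILit k) (ILit 0))
      (While (BILt (counter k) bound) (Seq body (incr k))).

Lemma runs_for_aux k bound body N t (Inv : nat -> state R -> Prop) st :
  Inv 0%N (set_int st 4 k 0) ->
  (forall i st', Inv i st' -> ieval st' bound = N) ->
  (forall i st', (i < N)%N -> Inv i st' -> ints st' 4 k = i ->
     runs body st' t (fun st'' => ints st'' 4 k = i /\ Inv i.+1 (set_int st'' 4 k i.+1))) ->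
  runs (For k bound body) st (N * (t + icost bound + 9) + icost bound + 6) (Inv N).
Proof.
move=> inv0 boundE step.
apply: (@runs_le _ _ (3 + (N * (t + icost bound + 9) + icost bound + 3))); first lia.
rewrite /For; apply: (runs_seq (t1 := 3)); apply: runs_iset => /=.
suff loop : forall i st', (i <= N)%N -> Inv i st' -> ints st' 4 k = i ->
    runs (While (BILt (counter k) bound) (Seq body (incr k))) st'
      ((N - i) * (t + icost bound + 9) + icost bound + 3) (Inv N).
  by have := loop 0%N _ (leq0n N) inv0; rewrite subn0; apply; rewrite /= eqxx.
move=> i; move eqd : (N - i)%N => dd; elim: dd i eqd => [|dd IH] i Ni st' iN inv ik.
  have {iN Ni}iN : i = N by lia.
  exists (bcost (BILt (counter k) bound)), st'; split; last by rewrite -iN.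
    by apply: ExecWhileFalse; rewrite /= ik (boundE _ _ inv) iN ltnn.
  by rewrite /= mul0n; lia.
have iltN : (i < N)%N by lia.
have [u [st1 [e1 ut [ik1 inv1]]]] := step i st' iltN inv ik.
have [||||u2 [st2 [e2 ut2 q]]] := IH i.+1 _ (set_int st1 4 k i.+1); try by [|lia].
  by rewrite /= eqxx.
exists (bcost (BILt (counter k) bound) + (u + (1 + (2 + 1).+1).+1) + u2)%N, st2; split => //.
  apply: ExecWhileTrue e2; first by rewrite /= ik (boundE _ _ inv).
  apply: ExecSeq e1 _.
  have -> : set_int st1 4 k i.+1 =
     set_int st1 4 (ieval st1 (ILit k)) (ieval st1 (IAdd (counter k) (ILit 1))).
    by rewrite /= ik1 addn1.
  exact: ExecISet.
by rewrite /= mulSn; lia.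
Qed.

(** The invariant [Inv i] describes the state in which the counter has just been
    set to [i]. *)
Lemma runs_for k bound body N t (Inv : nat -> state R -> Prop) st t' Q :
  (N * (t + icost bound + 9) + icost bound + 6 <= t')%N ->
  Inv 0%N (set_int st 4 k 0) ->
  (forall i st', Inv i st' -> ieval st' bound = N) ->
  (forall i st', (i < N)%N -> Inv i st' -> ints st' 4 k = i ->
     runs body st' t (fun st'' => ints st'' 4 k = i /\ Inv i.+1 (set_int st'' 4 k i.+1))) ->
  (forall st', Inv N st' -> Q st') ->
  runs (For k bound body) st t' Q.
Proof.
move=> tt inv0 boundE step QN; apply: runs_le tt _.
have [u [st' [e ut q]]] := runs_for_aux inv0 boundE step.
by exists u, st'; split => //; exact: QN.
Qed.

End Runs.

Section Program.

Definition por b c : bexpr := BNot (BAnd (BNot b) (BNot c)).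
Definition ple u v : bexpr := BNot (BRLt v u).
Definition pfrac a b : rexpr := RDiv (RNat (ILit a)) (RNat (ILit b)).
Definition pneg u : rexpr := RSub (RNat (ILit 0)) u.

Definition p_short_arc a b c : bexpr :=
  por (BAnd (ple (RSub b a) (pfrac 1 2)) (BAnd (BRLt a c) (BRLt c b)))
      (BAnd (BRLt (RSub b a) (pneg (pfrac 1 2))) (por (BRLt a c) (BRLt c b))).

Definition p_spans a b c : bexpr := por (p_short_arc a b c) (p_short_arc b a c).

Definition p_cw a b : bexpr :=
  por (BAnd (ple (RNat (ILit 0)) (RSub b a)) (BRLt (RSub b a) (pfrac 1 4)))
      (BRLt (RSub b a) (pneg (pfrac 3 4))).

Definition p_logs : rexpr :=
  let l := RFun Ln (RDiv (RNat (ILit 1)) (RGet 0 (ILit 0))) in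
  RMul (RNat (ILit 8)) (RDiv l (RFun Ln l)).

Definition p_covers u v w : bexpr :=
  BAnd (ple (RGet 3 (ILit 1))
            (RDist (RGet 0 (ILit 1)) (RGet 1 u) (RGet 2 u) (RGet 1 v) (RGet 2 v)))
       (p_spans (RGet 1 u) (RGet 1 v) (RGet 1 w)).

Definition p_covered (w : iexpr) : bexpr := BILt (ILit 0) (IGet 5 w).

Definition p_count k b : cmd := If b (incr k) Skip.

Definition vertex := counter 0.
Definition other := counter 1.
Definition n_vertices : iexpr := IGet 0 (ILit 0).

Definition mark_covered : cmd :=
  For 0 n_vertices (For 1 (ISub n_vertices (ILit 1))
    (If (p_covers (IGet 1 other) (IGet 2 other) vertex) (ISet 5 vertex (ILit 1)) Skip)).

Definition p_other : bexpr :=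
  BAnd (por (BILt other vertex) (BILt vertex other)) (BNot (p_covered other)).

Definition count_run : cmd :=
  Seq (p_count 2 (BAnd p_other (p_cw (RGet 1 vertex) (RGet 1 other))))
      (p_count 3 (BAnd p_other (p_cw (RGet 1 other) (RGet 1 vertex)))).

Definition select_vertex : cmd :=
  Seq (Seq (ISet 4 (ILit 2) (ILit 0)) (ISet 4 (ILit 3) (ILit 0)))
  (Seq (For 1 n_vertices count_run)
    (If (BAnd (BNot (p_covered vertex))
              (por (BRLt (RNat (counter 2)) (RGet 3 (ILit 0)))
                   (BRLt (RNat (counter 3)) (RGet 3 (ILit 0)))))
        (ISet 3 vertex (ILit 1)) Skip)).

(** Integer array 5 holds the flags of the covered vertices, and cells 2 and 3 of
    array 4 the sizes of the two runs.  Real array 3 holds the bound on the runs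
    and the threshold on edge lengths. *)
Definition root_finder : cmd :=
  Seq (Seq (RSet 3 (ILit 0) p_logs)
           (RSet 3 (ILit 1) (RMul (RGet 0 (ILit 0)) (RGet 0 (ILit 0)))))
  (Seq mark_covered (For 0 n_vertices select_vertex)).

End Program.

Section ProgramTests.
Context {R : realType}.
Implicit Types st : state R.

Lemma beval_por st b c : beval st (por b c) = beval st b || beval st c.
Proof. by rewrite /= negb_and !negbK. Qed.

Lemma beval_and st b c : beval st (BAnd b c) = beval st b && beval st c.
Proof. by []. Qed.

Lemma beval_ple st u v : beval st (ple u v) = (reval st u <= reval st v).
Proof. by rewrite /= -leNgt. Qed.

Lemma beval_spans st a b c : beval st (p_spans a b c) =
  spans (reval st a) (reval st b) (reval st c).
Proof. by rewrite /p_spans /p_short_arc !beval_por /= -!leNgt  ?sub0r !negb_and -!ltNge. Qed.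

Lemma beval_cw st a b : beval st (p_cw a b) = cw (reval st a) (reval st b).
Proof. by rewrite /p_cw beval_por /= -!leNgt ?sub0r. Qed.

End ProgramTests.

Definition run_bound {R : realType} (eps : R) : R := 8 * (ln eps^-1 / ln (ln eps^-1)).

Section ProgramCorrect.
Context {R : realType}.
Variables (eps h : R) (n : nat) (x : n.-tuple (R * R)) (es : seq ('I_n * 'I_n)).
Implicit Types st : state R.
Let B := run_bound eps.
Let eta := eps * eps.
Hypothesis size_es : size es = (n - 1)%N.
Hypothesis n0 : (0 < n)%N.

Let X1 (i : nat) := nth 0 [seq z.1 | z <- x] i.
Let X2 (i : nat) := nth 0 [seq z.2 | z <- x] i.
Let E1 (j : nat) := nth 0%N [seq val u.1 | u <- es] j.
Let E2 (j : nat) := nth 0%N [seq val u.2 | u <- es] j.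

Definition ready st : Prop :=
  [/\ ints st 0 0 = n, forall j, ints st 1 j = E1 j & forall j, ints st 2 j = E2 j] /\
  [/\ reals st 0 1 = h, forall i, reals st 1 i = X1 i, forall i, reals st 2 i = X2 i,
      reals st 3 0 = B & reals st 3 1 = eta].

(** Edge number [j] covers vertex [v], read from the input arrays. *)
Definition coversN (j v : nat) : bool :=
  (eta <= torus_dist h (X1 (E1 j), X2 (E1 j)) (X1 (E2 j), X2 (E2 j)))
  && spans (X1 (E1 j)) (X1 (E2 j)) (X1 v).

Definition coveredN (m v : nat) : bool := has (coversN^~ v) (iota 0 m).

Lemma coveredNS m v : coveredN m.+1 v = coveredN m v || coversN m v.
Proof. by rewrite /coveredN -addn1 iotaD has_cat /= orbF. Qed.

Lemma runs_mark_covered st : ready st -> (forall i, ints st 5 i = 0%N) ->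
    (forall i, ints st 3 i = 0%N) ->
  runs mark_covered st (n * ((n - 1) * 210 + 40) + 20)
    (fun st' => [/\ ready st', forall i, (i < n)%N -> ints st' 5 i = coveredN (n - 1) i &
                   forall i, ints st' 3 i = 0%N]).
Proof.
move=> rdy z5 z3.
pose flags v m st' := forall i, ints st' 5 i =
  (if (i < v)%N then coveredN (n - 1) i else if i == v then coveredN m i else false) :> nat.
pose Inv v st' := [/\ ready st', flags v 0%N st' & forall i, ints st' 3 i = 0%N].
apply: (runs_for (N := n) (t := (n - 1) * 210 + 15) (Inv := Inv)).
- by rewrite /=; lia.
- by split => //= i; rewrite /= z5; case: eqP.
- by move=> i st' [[[]]].
- move=> v st' vn [rdy' fl z3'] kv.
  pose Inv2 m st'' := [/\ ready st'', flags v m st'', ints st'' 4 0 = v & forall i, ints st'' 3 i = 0%N].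
  apply: (runs_for (N := (n - 1)%N) (t := 190) (Inv := Inv2)).
  + by rewrite /=; lia.
  + by split.
  + by move=> i st'' [[[/= -> _ _] _] _ _ _].
  + move=> m st'' mn [rdy'' fl'' kv'' z3''] km.
    (* The test costs 182 units. *)
    apply: (@runs_le _ _ _ (bcost (p_covers (IGet 1 other) (IGet 2 other) vertex) + 5)) => //.
    apply: runs_if.
    have -> : beval st'' (p_covers (IGet 1 other) (IGet 2 other) vertex) = coversN m v.
      move: rdy'' => [[nE e1 e2] [hE x1 x2 BE etaE]].
      rewrite /p_covers beval_and beval_ple beval_spans /=.
      by rewrite hE etaE km kv'' !e1 !e2 !x1 !x2.
    case: ifP => cov; last first.
      apply: (@runs_le _ _ _ 1) => //; apply: runs_skip; split => //; split => //= i.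
      rewrite /= fl''; case: ifP => // _; case: eqP => // ->.
      by rewrite coveredNS cov orbF.
    apply: (@runs_le _ _ _ 4) => //; apply: runs_iset; split => //; split => //= i.
    rewrite /= kv'' fl''; case: (eqVneq i v) => [->|//].
    by rewrite ltnn coveredNS cov orbT.
  + move=> st'' [rdy'' fl'' kv'' z3'']; split => //; split => //= i.
    rewrite /= fl'' [(i < v.+1)%N]ltnS; case: (ltngtP i v) => //= iv.
    by case: eqP.
- by move=> st' [rdy' fl z3']; split => // i iv; rewrite fl iv.
Qed.

Definition cw_count v m := count (fun w => [&& w != v, ~~ coveredN (n - 1) w & cw (X1 v) (X1 w)]) (iota 0 m).
Definition ccw_count v m := count (fun w => [&& w != v, ~~ coveredN (n - 1) w & cw (X1 w) (X1 v)]) (iota 0 m).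

Definition selected v := ~~ coveredN (n - 1) v && (((cw_count v n)%:R < B) || ((ccw_count v n)%:R < B)).

Lemma runs_select_vertices st : ready st ->
    (forall i, (i < n)%N -> ints st 5 i = coveredN (n - 1) i) ->
    (forall i, ints st 3 i = 0%N) ->
  runs (For 0 n_vertices select_vertex) st (n * (n * 170 + 100) + 20)
    (fun st' => forall i, (i < n)%N -> (ints st' 3 i != 0%N) = selected i).
Proof.
move=> rdy cov z3.
pose Inv v st' := [/\ ready st', forall i, (i < n)%N -> ints st' 5 i = coveredN (n - 1) i &
   forall i, ints st' 3 i = ((i < v)%N && selected i)].
apply: (runs_for (N := n) (t := n * 170 + 80) (Inv := Inv)).
- by rewrite /=; lia.
- by split => // i; rewrite /= z3.
- by move=> i st' [[[]]].
- move=> v st' vn [rdy' cov' sel'] kv; rewrite /select_vertex.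
  apply: (@runs_le _ _ _ ((3 + 3) + ((n * 170 + 20) + 50))); first lia.
  apply: runs_seq; apply: runs_seq; apply: runs_iset; apply: runs_iset.
  apply: runs_seq.
  pose Inv2 m st'' := [/\ ready st'', ints st'' 4 0 = v,
     forall i, (i < n)%N -> ints st'' 5 i = coveredN (n - 1) i,
     forall i, ints st'' 3 i = ((i < v)%N && selected i) &
     ints st'' 4 2 = cw_count v m /\ ints st'' 4 3 = ccw_count v m].
  apply: (runs_for (N := n) (t := 150) (Inv := Inv2)).
  + by rewrite /=; lia.
  + by split.
  + by move=> i st'' [[[]]].
  + move=> m st'' mn [rdy'' kv'' cov'' sel'' [c2 c3]] km.
    have otherE s' : ready s' -> ints s' 4 0 = v -> ints s' 4 1 = m -> ints s' 5 m = coveredN (n - 1) m ->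
        beval s' p_other = (m != v) && ~~ coveredN (n - 1) m.
      move=> _ k0 k1 k5; rewrite /p_other beval_and beval_por /= k0 k1 k5.
      by rewrite -neq_ltn lt0b.
    rewrite /count_run.
    apply: (@runs_le _ _ _ ((bcost (BAnd p_other (p_cw (RGet 1 vertex) (RGet 1 other))) + 6) +
        (bcost (BAnd p_other (p_cw (RGet 1 other) (RGet 1 vertex))) + 6))) => //.
    apply: runs_seq; apply: runs_if.
    have -> : beval st'' (BAnd p_other (p_cw (RGet 1 vertex) (RGet 1 other))) =
        [&& m != v, ~~ coveredN (n - 1) m & cw (X1 v) (X1 m)].
      rewrite beval_and otherE ?cov'' // beval_cw /= kv'' km.
      by move: rdy'' => [_ [_ x1 _ _ _]]; rewrite !x1 andbA.
    set b2 := [&& m != v, ~~ coveredN (n - 1) m & cw (X1 v) (X1 m)].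
    have c2S : cw_count v m.+1 = (cw_count v m + b2)%N.
      by rewrite /cw_count -[m.+1]addn1 iotaD count_cat /= addn0.
    pose st1 := if b2 then set_int st'' 4 2 (cw_count v m + 1) else st''.
    have run1 Q : Q st1 -> runs (if b2 then incr 2 else Skip) st'' 6 Q.
      rewrite /st1; case: b2 {c2S st1} => q; last by apply: (@runs_le _ _ _ 1) => //; exact: runs_skip.
      by apply: runs_iset; rewrite /= c2.
    have [rdy1 k01 k11] : [/\ ready st1, ints st1 4 0 = v & ints st1 4 1 = m].
      by rewrite /st1; case: b2 {c2S st1 run1}; split.
    have [cov1 sel1] : (forall i, (i < n)%N -> ints st1 5 i = coveredN (n - 1) i) /\
        (forall i, ints st1 3 i = ((i < v)%N && selected i)).
      by rewrite /st1; case: b2 {c2S st1 run1 rdy1 k01 k11}; split.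
    have [d2 d3] : ints st1 4 2 = cw_count v m.+1 /\ ints st1 4 3 = ccw_count v m.
      by rewrite c2S /st1; case: b2 {c2S st1 run1 rdy1 k01 k11 cov1 sel1}; rewrite /= ?addn0.
    apply: run1; apply: runs_if.
    have -> : beval st1 (BAnd p_other (p_cw (RGet 1 other) (RGet 1 vertex))) =
        [&& m != v, ~~ coveredN (n - 1) m & cw (X1 m) (X1 v)].
      rewrite beval_and otherE ?cov1 // beval_cw /= k01 k11.
      by move: rdy1 => [_ [_ x1 _ _ _]]; rewrite !x1 andbA.
    set b3 := [&& m != v, ~~ coveredN (n - 1) m & cw (X1 m) (X1 v)].
    have c3S : ccw_count v m.+1 = (ccw_count v m + b3)%N.
      by rewrite /ccw_count -[m.+1]addn1 iotaD count_cat /= addn0.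
    case: b3 c3S => c3S.
      by apply: runs_iset; split=> [|]; [|split => //=; rewrite d3 c3S].
    apply: (@runs_le _ _ _ 1) => //; apply: runs_skip; rewrite addn0 in c3S.
    by split => //; split => //=; rewrite c3S.
  + move=> st'' [rdy'' kv'' cov'' sel'' [c2 c3]].
    apply: (@runs_le _ _ _ (23 + 4)) => //; apply: (runs_if (t := 4)).
    have -> : beval st'' (BAnd (BNot (p_covered vertex))
              (por (BRLt (RNat (counter 2)) (RGet 3 (ILit 0)))
                   (BRLt (RNat (counter 3)) (RGet 3 (ILit 0))))) = selected v.
      move: rdy'' => [_ [_ _ _ BE _]].
      by rewrite beval_and beval_por /= kv'' cov'' // c2 c3 BE lt0b.
    case selv : (selected v).
      apply: runs_iset; split; first by [].
      split => //= i; rewrite /= kv'' sel'' ltnS.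
      by case: (ltngtP i v) => //= iv; rewrite iv selv.
    apply: (@runs_le _ _ _ 1) => //; apply: runs_skip; split; first by [].
    split => //= i; rewrite /= sel'' ltnS.
    by case: (ltngtP i v) => //= iv; rewrite iv selv.
- by move=> st' [_ _ sel'] i iv; rewrite sel' iv /= eqb0 negbK.
Qed.

Lemma runs_root_finder : runs root_finder (input eps h x es) (n ^ 2 * 1000)
   (fun st => forall i, (i < n)%N -> (ints st 3 i != 0%N) = selected i).
Proof.
apply: (@runs_le _ _ _ ((20 + 10) + ((n * ((n - 1) * 210 + 40) + 20) + (n * (n * 170 + 100) + 20)))).
  by rewrite -mulnn; nia.
rewrite /root_finder; apply: runs_seq; apply: runs_seq.
apply: (@runs_le _ _ _ 19) => //; apply: runs_rset.
apply: (@runs_le _ _ _ 7) => //; apply: runs_rset.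
apply: runs_seq; set st0 := set_real _ _ _ _.
have rdy0 : ready st0.
  split; split => //=; try by case.
  by rewrite /B /run_bound /= div1r.
have [u [st1 [e1 ut [rdy1 cov1 z31]]]] := runs_mark_covered rdy0 (fun _ => erefl) (fun _ => erefl).
by exists u, st1; split => //; exact: runs_select_vertices.
Qed.

End ProgramCorrect.

Definition finder {R : realType} (h : R -> R) (eps : R) : procedure R :=
  fun n => candidates (eps * eps) (h eps) (run_bound eps) (n := n).

Section FinderComputes.
Context {R : realType}.

Lemma nn_tree_size (h : R) n (x : n.-tuple (R * R)) e :
  nn_tree h x e -> #|e| = (n - 1)%N.
Proof.
move=> [y [p [s [_ ynn _ ->]]]].
rewrite /relabel_edges card_imset; last exact: imset_inj perm_inj.
by rewrite card_tree_edges ?subn1 // => i /ynn[].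
Qed.

Lemma finder_computes (h : R -> R) (eps : R) :
  computes_within root_finder eps (h eps) (finder h eps)
    (fun n => 1000%:R * (n%:R ^+ 2 + ln eps^-1 ^+ 2)).
Proof.
move=> n x e es n0 tree listes.
have size_es : size es = (n - 1)%N.
  by rewrite -(nn_tree_size tree) cardE -(perm_size listes) size_map.
have [t [st [run tn sel]]] :=
   runs_root_finder eps (h eps) x size_es n0.
exists t, st; split => //; last first.
  move: tn {sel run}; move: 1000%N => k tn.
  apply: (@le_trans _ _ (n ^ 2 * k)%:R); first by rewrite ler_nat.
  by rewrite natrM natrX mulrC ler_wpM2l ?ler0n // lerDl sqr_ge0.
apply/setP => v; rewrite inE sel //.
have xE (i : 'I_n) : nth 0 [seq z.1 | z <- x] i = (tnth x i).1.
  by rewrite (nth_map (tnth x i)) ?size_tuple // -tnth_nth.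
have yE (i : 'I_n) : nth 0 [seq z.2 | z <- x] i = (tnth x i).2.
  by rewrite (nth_map (tnth x i)) ?size_tuple // -tnth_nth.
have coversE (u : 'I_n * 'I_n) (w : 'I_n) j : (j < size es)%N -> nth u es j = u ->
    coversN eps (h eps) x es j w = covers (eps * eps) (h eps) x u.1 u.2 w.
  move=> js ju; rewrite /coversN !(nth_map u) // ju !xE !yE /covers.
  by rewrite -!surjective_pairing.
have exposedE w : exposed (eps * eps) (h eps) x e w = ~~ coveredN eps (h eps) x es (n - 1) w.
  congr (~~ _); apply/existsP/hasP.
    move=> [a /existsP[b /andP[ab cov]]].
    have : [set a; b]%SET \in [seq [set u.1; u.2]%SET | u <- es].
      by rewrite (perm_mem listes) mem_enum.
    case/mapP => u ues abu; exists (index u es).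
      by rewrite mem_iota add0n -size_es index_mem.
    rewrite (coversE u) ?index_mem ?nth_index //.
    case: (set2_eq abu) => -[ua ub]; first by rewrite -ua -ub.
    by move: cov; rewrite /covers -ua -ub torus_distC spansC.
  move=> [j]; rewrite mem_iota add0n -size_es => /andP[_ js] cov.
  case: es listes size_es js cov sel coversE {run} => // u0 es' listes size_es js cov sel coversE.
  pose u := nth u0 (u0 :: es') j.
  exists u.1; apply/existsP; exists u.2; apply/andP; split.
    rewrite -mem_enum -(perm_mem listes); apply/mapP; exists u => //.
    exact: mem_nth.
  by rewrite -(coversE u _ j) // (set_nth_default u0).
have countE (Q : pred nat) : count Q (iota 0 n) = #|[set w : 'I_n | Q w]%SET|.
  rewrite -sum1_count -sum1_card -[X in iota 0 X]subn0 -/(index_iota 0 n) big_mkord.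
  by apply: eq_bigl => w; rewrite inE.
rewrite /finder inE /selected exposedE -/(run_bound eps) /cw_count /ccw_count !countE.
have runE : cw_run (eps * eps) (h eps) x e v = [set w : 'I_n | [&& w != v :> nat,
    ~~ coveredN eps (h eps) x es (n - 1) w & cw (nth 0 [seq z.1 | z <- x] v) (nth 0 [seq z.1 | z <- x] w)]]%SET.
  by apply/setP => w; rewrite !inE exposedE !xE.
have ccwE : ccw_run (eps * eps) (h eps) x e v = [set w : 'I_n | [&& w != v :> nat,
    ~~ coveredN eps (h eps) x es (n - 1) w & cw (nth 0 [seq z.1 | z <- x] w) (nth 0 [seq z.1 | z <- x] v)]]%SET.
  by apply/setP => w; rewrite !inE exposedE !xE.
by rewrite runE ccwE.
Qed.

End FinderComputes.

(** * Probability of missing the root *)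

Section RootFound.
Context {R : realType} d (T : measurableType d) (P : probability T R).
Variables (h : R) (X : nat -> T -> R * R) (p : nat -> T -> nat).
Hypothesis h0 : 0 < h.
Hypothesis M : nn_model P h X p.

Lemma prob_le_many_monotone m N (K : R * R -> R * R -> R) :
  (forall n (i j : 'I_n), measurable_fun setT (fun x : n.-tuple (R * R) => K (tnth x i) (tnth x j))) ->
  prob_le P [set w | exists2 J : {set 'I_m}, #|J| == N &
     (forall i, i \in J -> (0 < i)%N) /\ forall i j, i \in J -> j \in J -> (i < j)%N ->
        K (X 0%N w) (X i w) < K (X 0%N w) (X j w)]
   ('C(m, N)%:R * N`!%:R^-1).
Proof.
move=> mK.
have cardQ : #|[pred J : {set 'I_m} | #|J| == N]| = 'C(m, N).
  by rewrite -[X in 'C(X, _)]card_ord -card_draws; apply: eq_card => J; rewrite !inE.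
rewrite -cardQ; apply: (@prob_le_exists_cst _ _ _ _ _ [pred J : {set 'I_m} | #|J| == N]) => J /= /eqP JN.
have [J0|J0] := pselect (forall i, i \in J -> (0 < i)%N); last first.
  apply: prob_leW (prob_leS _ (prob_le0 P)); first by rewrite invr_ge0 ler0n.
  by move=> w [].
rewrite -JN; apply: prob_leS (prob_le_monotone M mK J0) => w [_]; exact.
Qed.

Variables (eta B : R) (m N L1 L2 M0 K : nat).
Hypothesis NB : N%:R <= B.
Hypothesis L10 : (0 < L1)%N.
Hypothesis L20 : (0 < L2)%N.
Hypothesis K0 : (0 < K)%N.
Hypothesis eta_L1 : eta <= L1%:R^-1.
Hypothesis h_L2 : h < L2%:R^-1.
Hypothesis eta_K : K%:R^-1 + h / 2 < eta.

Let H : procedure R := fun n => candidates eta h B (n := n).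

Lemma candidates_procedure : root_procedure H.
Proof.
split; first by move=> n s x e; exact: candidates_equivariant.
by move=> n e i; exact: candidates_measurable.
Qed.

(** In this order: all the first [m + 1] vertices are near the root; two of them
    are at distance less than [1/L1]; [N] of them have monotone angles in one of
    two directions; one of the first [M0] is within [1/L2] of the root; these do
    not meet every arc of length [1/K]. *)
Definition failure_bound : R :=
  4 * (3 / 4) ^+ m + (m.+1 * m.+1)%:R * (3 / L1%:R) + 2 * ('C(m.+1, N)%:R * N`!%:R^-1)
  + M0%:R * (3 / L2%:R) + K%:R * (1 - K%:R^-1) ^+ M0.

(** Outside the six bad events and the null event that two abscissae coincide,
    [root_is_candidate] and [root_edges_short] apply. *)
Lemma prob_le_failure n : (m <= n)%N -> (M0 <= n.+1)%N ->
  prob_le P (~` success X p H n) failure_bound.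
Proof.
move=> mn Mn.
pose near0 := [set w | forall i, (i < m.+1)%N -> circle_dist 1 (X 0%N w).1 (X i w).1 < 1 / 4].
pose close := [set w | exists2 u : 'I_m.+1 * 'I_m.+1, val u.1 != val u.2 &
   circle_dist 1 (X u.1 w).1 (X u.2 w).1 < L1%:R^-1].
pose same := [set w | exists2 u : 'I_n.+1 * 'I_n.+1, val u.1 != val u.2 & (X u.1 w).1 = (X u.2 w).1].
pose mono (F : R * R -> R * R -> R) := [set w | exists2 J : {set 'I_m.+1}, #|J| == N &
     (forall i, i \in J -> (0 < i)%N) /\ forall i j, i \in J -> j \in J -> (i < j)%N ->
        F (X 0%N w) (X i w) < F (X 0%N w) (X j w)].
pose cwF (z z' : R * R) := angle z.1 z'.1; pose ccwF (z z' : R * R) := angle z'.1 z.1.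
pose crowd := [set w | exists2 i : 'I_M0, val i != 0%N & circle_dist 1 (X 0%N w).1 (X i w).1 < L2%:R^-1].
pose sparse := [set w | ~ forall a, 0 <= a < 1 ->
      exists2 i, (i < M0)%N & circle_dist 1 a (X i w).1 <= K%:R^-1].
have inv_ge0 (L : nat) : 0 <= 3 / L%:R :> R by rewrite divr_ge0 ?ler0n.
have Pclose : prob_le P close ((m.+1 * m.+1)%:R * (3 / L1%:R)).
  apply: prob_leW (@prob_le_exists_cst _ _ _ P ('I_m.+1 * 'I_m.+1)%type (fun u => val u.1 != val u.2) _ _
    (fun u hu => prob_le_close h0 M hu L10)).
  rewrite ler_wpM2r // ler_nat; apply: leq_trans (max_card _) _.
  by rewrite card_prod !card_ord.
have Psame : prob_le P same 0.
  have := @prob_le_exists_cst _ _ _ P ('I_n.+1 * 'I_n.+1)%type (fun u => val u.1 != val u.2) _ _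
    (fun u hu => prob_le_same_abscissa h0 M hu).
  by rewrite mulr0.
have Pcrowd : prob_le P crowd (M0%:R * (3 / L2%:R)).
  have ne (i : 'I_M0) : val i != 0%N -> 0%N != val i by rewrite eq_sym.
  apply: prob_leW (@prob_le_exists_cst _ _ _ P 'I_M0 (fun i => val i != 0%N) _ _
    (fun i hi => prob_le_close h0 M (ne i hi) L20)).
  by rewrite ler_wpM2r // ler_nat; apply: leq_trans (max_card _) _; rewrite card_ord.
have Pcw : prob_le P (mono cwF) ('C(m.+1, N)%:R * N`!%:R^-1).
  by apply: prob_le_many_monotone => k i j; apply: measurable_angle; exact: measurable_tnth1.
have Pccw : prob_le P (mono ccwF) ('C(m.+1, N)%:R * N`!%:R^-1).
  by apply: prob_le_many_monotone => k i j; apply: measurable_angle; exact: measurable_tnth1.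
have Psparse := prob_le_not_dense h0 M M0 K0.
have Pnear := prob_le_all_near h0 M m.
have := prob_leU (prob_leU (prob_leU (prob_leU Pnear Pclose) (prob_leU Pcw Pccw)) Pcrowd)
   (prob_leU Psparse Psame).
rewrite addr0 -mulr2n -[_ *+ 2]mulr_natl => bound.
apply: prob_leS bound => w; apply: contra_notP => good.
have nsparse : ~ sparse w by move=> ?; apply: good; right; left.
have nsame : ~ same w by move=> ?; apply: good; right; right.
have ncrowd : ~ crowd w by move=> ?; apply: good; left; right.
have nccw : ~ mono ccwF w by move=> ?; apply: good; left; left; right; right.
have ncw : ~ mono cwF w by move=> ?; apply: good; left; left; right; left.
have nclose : ~ close w by move=> ?; apply: good; left; left; left; right.
have nnear : ~ near0 w by move=> ?; apply: good; left; left; left; left.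
rewrite /success /=.
apply: (@root_is_candidate _ eta h B n m.+1 N (X^~ w) (p^~ w)) => //.
- by move=> i _; exact: (nn_pos_torus M).
- exact: (@nn_par_nearest _ _ _ _ _ _ _ M n.+1 w).
- move=> i j /andP[ij jn]; apply/eqP => E; apply: nsame.
  exists (Ordinal (ltn_trans ij jn), Ordinal jn) => //=.
  by rewrite ltn_eqF.
- move=> i j /andP[ij jm]; apply: le_trans eta_L1 _; rewrite leNgt; apply/negP => E; apply: nclose.
  exists (Ordinal (ltn_trans ij jm), Ordinal jm) => //=.
  by rewrite ltn_eqF.
- apply: contrapT => nfar; apply: nnear => i im; rewrite ltNge; apply/negP => fari; apply: nfar.
  by exists i.
- by move=> J JN J0 mo; apply: ncw; exists J; [exact/eqP|split].
- by move=> J JN J0 mo; apply: nccw; exists J; [exact/eqP|split].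
apply: (@root_edges_short _ eta h K%:R^-1 n.+1 M0) => //.
- by move=> i _; exact: (nn_pos_torus M).
- exact: (@nn_par_nearest _ _ _ _ _ _ _ M n.+1 w).
- move=> i /andP[i0 iM]; rewrite ltNge; apply/negP => E; apply: ncrowd.
  exists (Ordinal iM) => /=; first by rewrite -lt0n.
  exact: le_lt_trans E h_L2.
- exact: contrapT nsparse.
Qed.

Lemma liminf_success_ge : ((1 - failure_bound)%:E <= liminf_success P X p H)%E.
Proof.
apply: (@limn_einf_ge _ _ _ (maxn m M0)) => n; rewrite geq_max => /andP[mn Mn].
have mS := measurable_success M candidates_procedure n.
have := prob_leE (measurableC mS) (prob_le_failure mn (leqW Mn)).
have fS : P (success X p H n) \is a fin_num by exact: fin_num_measure.
move=> bound; apply: (@le_trans _ _ (P (success X p H n))); last by [].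
move: bound.
by rewrite probability_setC // -(fineK fS) -EFinB !lee_fin; lra.
Qed.

End RootFound.

(** * Asymptotic estimates *)

Section Estimates.
Context {R : realType}.
Implicit Types (x y eps : R).

Lemma expR_ge_monomial n y : 0 <= y -> y ^+ n / n`!%:R <= expR y.
Proof.
case: n => [|n] y0; first by rewrite expr0 fact0 divr1 -expR0 ler_expR.
by apply: le_trans (expR_ge1Dxn n y0); rewrite lerDr ler01.
Qed.

Lemma exp_one_minus x (k : nat) : x <= 1 -> (1 - x) ^+ k <= expR (- (x * k%:R)).
Proof.
move=> x1; apply: (@le_trans _ _ (expR (- x) ^+ k)).
  by apply: lerXn2r; rewrite ?nnegrE ?expR_ge0 ?subr_ge0 // expR_ge1Dx.
by rewrite -expRM_natr mulNr.
Qed.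

Lemma expR1_le4 : expR 1 <= 4 :> R.
Proof.
have := expR_ge1Dx (- (1 / 2) : R); rewrite expRN => H.
have e0 := expR_gt0 (1 / 2 : R).
have e2 : expR (1 / 2) <= 2 :> R.
  have := ler_wpM2r (ltW e0) H; rewrite mulVf ?gt_eqF //; lra.
have -> : expR 1 = expR (1 / 2) * expR (1 / 2) :> R by rewrite -expRD; congr expR; lra.
have -> : 4 = 2 * 2 :> R by lra.
by apply: ler_pM => //; exact: ltW.
Qed.

(** A crude Stirling bound, from [n^n / n! <= exp n]. *)
Lemma fact_ge (n : nat) : n%:R ^+ n <= 4 ^+ n * n`!%:R :> R.
Proof.
rewrite -ler_pdivrMr ?ltr0n ?fact_gt0 //.
apply: le_trans (expR_ge_monomial n (ler0n _ n)) _.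
rewrite -[X in expR X]mul1r expRM_natr; apply: lerXn2r; rewrite ?nnegrE ?expR_ge0 //.
exact: expR1_le4.
Qed.

Lemma binomial_over_fact (m n : nat) : (0 < n)%N ->
  'C(m, n)%:R * n`!%:R^-1 <= (16 * m%:R / n%:R ^+ 2) ^+ n :> R.
Proof.
move=> n0; have f0 : 0 < n`!%:R :> R by rewrite ltr0n fact_gt0.
have nn0 : 0 < n%:R ^+ n :> R by rewrite exprn_gt0 // ltr0n.
have C_le : 'C(m, n)%:R * n`!%:R <= m%:R ^+ n :> R.
  rewrite -natrM -natrX ler_nat bin_ffact /falling_factorial.
  have ff k : (m ^_ k <= m ^ k)%N.
    by elim: k => // k IH; rewrite ffactnSr expnSr leq_mul // leq_subr.
  exact: ff.
have inv_le : n`!%:R^-1 <= 4 ^+ n / n%:R ^+ n :> R.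
  by rewrite ler_pdivlMr // mulrC ler_pdivrMr // fact_ge.
apply: (@le_trans _ _ (m%:R ^+ n * (n`!%:R^-1 * n`!%:R^-1))).
  rewrite mulrA ler_wpM2r ?invr_ge0 ?ler0n //.
  by rewrite ler_pdivlMr.
rewrite (_ : (_ / _) ^+ n = m%:R ^+ n * ((4 ^+ n / n%:R ^+ n) * (4 ^+ n / n%:R ^+ n))).
  rewrite ler_wpM2l ?exprn_ge0 ?ler0n //.
  by apply: ler_pM; rewrite ?invr_ge0 ?ler0n.
rewrite !exprMn exprVn -exprM mulnC exprM -expr2 exprMn !expr2 invfM.
rewrite (_ : 16 = 4 * 4 :> R); last by lra.
by rewrite exprMn; ring.
Qed.

Lemma truncn_bounds y : 1 <= y ->
  [/\ y / 2 <= (Num.truncn y)%:R, (Num.truncn y)%:R <= y, y < (Num.truncn y).+1%:R & (0 < Num.truncn y)%N].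
Proof.
move=> y1; have y0 : 0 <= y by lra.
have /andP[t1 t2] := truncn_itv y0.
have t0 : (0 < Num.truncn y)%N by rewrite truncn_gt0.
have : 1 <= (Num.truncn y)%:R :> R by rewrite ler1n.
by move: t2; rewrite -natr1 => *; split => //; lra.
Qed.

Lemma truncn_inv y : 0 < y -> y <= 1 -> let L := Num.truncn y^-1 in
  [/\ (0 < L)%N, y <= L%:R^-1 & L%:R^-1 <= 2 * y].
Proof.
move=> y0 y1 L; have iy : 1 <= y^-1 by rewrite invf_ge1.
have [L2 L1 _ L0] := truncn_bounds iy; have L0' : 0 < L%:R :> R by rewrite ltr0n.
split => //.
  by rewrite -[leLHS]invrK lef_pV2 ?posrE ?invr_gt0.
rewrite -[leRHS]invrK lef_pV2 ?posrE ?invr_gt0 ?mulr_gt0 //.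
by rewrite invfM mulrC.
Qed.

Lemma near_small (A : R) : \forall eps \near 0^'+, 0 < eps /\ A <= ln eps^-1.
Proof.
near=> eps; have e0 : 0 < eps by near: eps; exact: nbhs_right_gt.
split => //; rewrite lnV ?posrE // lerNr -ler_expR lnK ?posrE //.
by near: eps; apply: nbhs_right_le; exact: expR_gt0.
Unshelve. all: by end_near. Qed.

Lemma eps_ln_small (a : R) : 0 <= a -> exists A, forall eps,
  0 < eps -> A <= ln eps^-1 -> eps * (a * (1 + ln eps^-1 ^+ 2)) <= 1.
Proof.
move=> a0; exists (12 * a + 1) => eps e0; set l := ln _ => Al.
have l1 : 1 <= l by lra.
have e_cube : eps * l ^+ 3 <= 6.
  have := expR_ge_monomial 3 (le_trans ler01 l1).
  rewrite ler_pdivrMr ?ltr0n ?fact_gt0 // /l lnK ?posrE ?invr_gt0 // mulrC.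
  by rewrite ler_pdivlMr // mulrC (_ : 3`! = 6)%N.
have l2 : 1 <= l ^+ 2 by exact: exprn_ege1.
apply: (@le_trans _ _ (eps * (2 * (a * l ^+ 2)))).
  rewrite ler_wpM2l ?(ltW e0) //; have := ler_wpM2l a0 l2; lra.
have : eps * (12 * (a * l ^+ 2)) <= eps * l ^+ 3.
  rewrite ler_wpM2l ?(ltW e0) // [l ^+ 3]exprS mulrA ler_wpM2r ?sqr_ge0 //; lra.
lra.
Qed.

Lemma sqr_le_expR : exists2 L : R, 1 <= L & forall y, L <= y -> 9 * y ^+ 2 <= expR (y / 2).
Proof.
exists (9 * (8 * 6)) => [|y yL]; first by lra.
have y0 : 0 <= y by lra.
have := expR_ge_monomial 3 (_ : 0 <= y / 2); rewrite (_ : 3`! = 6)%N // => /(_ ltac:(lra)).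
apply: le_trans; rewrite expr_div_n (_ : 2 ^+ 3 = 8 :> R); last by ring.
have : 9 * (8 * 6) * y ^+ 2 <= y ^+ 3 by rewrite [y ^+ 3]exprS ler_wpM2r ?sqr_ge0.
lra.
Qed.

Lemma near_term (l eps : R) (m : nat) : eps = expR (- l) -> 8 * l < m.+1%:R ->
  4 * (3 / 4) ^+ m <= 16 * (eps * eps).
Proof.
move=> epsE; rewrite -[m.+1%:R]natr1 => mlt.
have -> : 3 / 4 = 1 - 1 / 4 :> R by lra.
have H : (1 - 1 / 4) ^+ m <= expR (- (1 / 4 * m%:R)) :> R by apply: (@exp_one_minus (1 / 4)); lra.
have : expR (- (1 / 4 * m%:R)) <= expR (1 + (- l + - l)) by rewrite ler_expR; lra.
rewrite 2!expRD -epsE => H2.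
have : expR 1 * (eps * eps) <= 4 * (eps * eps).
  by rewrite ler_wpM2r ?expR1_le4 // epsE mulr_ge0 ?expR_ge0.
lra.
Qed.

Lemma close_term (l r : R) (m L : nat) : m.+1%:R <= 9 * l -> L%:R^-1 <= 2 * r ->
  (m.+1 * m.+1)%:R * (3 / L%:R) <= 6 * (9 * 9) * (l ^+ 2 * r).
Proof.
move=> m9 L3; have mm : m.+1%:R * m.+1%:R <= (9 * l) * (9 * l) by apply: ler_pM; rewrite ?ler0n.
have -> : 6 * (9 * 9) * (l ^+ 2 * r) = (9 * l) * (9 * l) * (3 * (2 * r)) by ring.
rewrite natrM; apply: ler_pM; rewrite ?mulr_ge0 ?ler0n ?invr_ge0 //.
by rewrite ler_pM2l.
Qed.

(** Once [9 (ln l)^2 <= l^(1/2)], the base of the bound of [binomial_over_fact] is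
    at most [l^(-1/2)], and [l^(-N/2)] is at most [exp (- 4 l + ln l / 2)]. *)
Lemma monotone_term (l : R) (m N : nat) : 0 < l ->
  9 * ln l ^+ 2 <= expR (ln l / 2) -> 1 <= ln l ->
  m%:R <= 9 * l -> 4 * (l / ln l) <= N%:R -> 8 * (l / ln l) - 1 <= N%:R ->
  'C(m, N)%:R * N`!%:R^-1 <= expR (- l) * expR (- l).
Proof.
move=> l0; have lamE : expR (ln l) = l by rewrite lnK.
set lam := ln l in lamE * => big lam1 m9 N4 NB.
have lam0 : 0 < lam by lra.
have lam_le : lam <= l by have := expR_ge1Dx lam; rewrite lamE; lra.
have ll0 : 0 < l / lam by rewrite divr_gt0.
have N0' : 0 < N%:R :> R by lra.
have N0 : (0 < N)%N by rewrite -(ltr0n R).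
apply: le_trans (binomial_over_fact _ N0) _.
have base : 16 * m%:R / N%:R ^+ 2 <= expR (- (lam / 2)).
  rewrite ler_pdivrMr ?exprn_gt0 //.
  have N2 : (4 * (l / lam)) ^+ 2 <= N%:R ^+ 2.
    by apply: lerXn2r; rewrite ?nnegrE ?ler0n //; lra.
  apply: (@le_trans _ _ (expR (- (lam / 2)) * (4 * (l / lam)) ^+ 2)); last first.
    by rewrite ler_wpM2l ?expR_ge0.
  apply: (@le_trans _ _ (16 * (9 * l))); first lra.
  have lsq : l = expR (lam / 2) * expR (lam / 2) by rewrite -expRD -lamE; congr expR; lra.
  have e2 : expR (- (lam / 2)) * l = expR (lam / 2).
    by rewrite [X in _ * X]lsq mulrA -expRD addNr expR0 mul1r.
  have -> : expR (- (lam / 2)) * (4 * (l / lam)) ^+ 2 =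
     (expR (- (lam / 2)) * l) * (16 * l) / lam ^+ 2.
    by field; rewrite gt_eqF.
  rewrite e2 ler_pdivlMr ?exprn_gt0 //.
  have -> : 16 * (9 * l) * lam ^+ 2 = (9 * lam ^+ 2) * (16 * l) by ring.
  by rewrite ler_wpM2r // mulr_ge0 // ltW.
apply: (@le_trans _ _ (expR (- (lam / 2)) ^+ N)).
  by apply: lerXn2r; rewrite ?nnegrE ?expR_ge0 ?divr_ge0 ?mulr_ge0 ?ler0n ?sqr_ge0.
rewrite -expRM_natr -expRD ler_expR.
have : lam * (8 * (l / lam) - 1) <= lam * N%:R by rewrite ler_wpM2l // ltW.
have -> : lam * (8 * (l / lam) - 1) = 8 * l - lam by field; rewrite gt_eqF.
lra.
Qed.

Lemma crowd_term (C0 eps : R) (M L : nat) : 0 < eps -> M%:R <= 2 * (eps^-1) ^+ 3 ->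
  L%:R^-1 <= 2 * (2 * C0 * eps ^+ 5) -> M%:R * (3 / L%:R) <= 24 * C0 * (eps * eps).
Proof.
move=> e0 M2 L3.
have -> : 24 * C0 * (eps * eps) = 2 * (eps^-1) ^+ 3 * (3 * (2 * (2 * C0 * eps ^+ 5))).
  by field; rewrite gt_eqF.
by apply: ler_pM; rewrite ?divr_ge0 ?ler0n // ler_pM2l.
Qed.

Lemma sparse_term (eps : R) (k M : nat) : 0 < eps -> (0 < k)%N ->
  k%:R <= 3 * (eps^-1) ^+ 2 -> (eps^-1) ^+ 3 <= M%:R ->
  k%:R * (1 - k%:R^-1) ^+ M <= 3 * (24 * (9 * 9)) * (eps * eps).
Proof.
move=> e0 k0 k3 M3; have k0' : 0 < k%:R :> R by rewrite ltr0n.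
have en : eps != 0 by rewrite gt_eqF.
pose q := eps^-1; have q0 : 0 < q by rewrite invr_gt0.
have H : (1 - k%:R^-1) ^+ M <= expR (- (k%:R^-1 * M%:R)) :> R.
  by apply: exp_one_minus; rewrite invf_le1 ?ler1n.
have q3 : q / 3 <= k%:R^-1 * M%:R.
  rewrite [k%:R^-1 * _]mulrC ler_pdivlMr //; apply: le_trans M3.
  apply: (@le_trans _ _ (q / 3 * (3 * q ^+ 2))); first by rewrite ler_wpM2l // divr_ge0 // ltW.
  by rewrite (_ : q / 3 * _ = q ^+ 3) //; field.
have E4 : expR (- (q / 3)) <= 24 * (9 * 9) * eps ^+ 4.
  have q30 : 0 <= q / 3 by rewrite divr_ge0 // ltW.
  have := expR_ge_monomial 4 q30; rewrite (_ : 4`! = 24)%N // => H4.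
  rewrite expRN -[leRHS]invrK lef_pV2 ?posrE ?invr_gt0 ?expR_gt0 ?mulr_gt0 ?exprn_gt0 //.
  apply: le_trans H4; rewrite (_ : (_ / _) ^+ 4 / _ = (24 * (9 * 9) * eps ^+ 4)^-1) //.
  by rewrite /q; field.
have -> : 3 * (24 * (9 * 9)) * (eps * eps) = 3 * q ^+ 2 * (24 * (9 * 9) * eps ^+ 4).
  by rewrite /q; field.
apply: ler_pM => //.
  by rewrite exprn_ge0 // subr_ge0 invf_le1 // ler1n.
by apply: le_trans H _; apply: le_trans E4; rewrite ler_expR; lra.
Qed.

Lemma run_boundE eps : run_bound eps = 8 * (ln eps^-1 / ln (ln eps^-1)).
Proof. by []. Qed.

Lemma add_terms (t1 t2 t3 t4 t5 b1 b2 c u v : R) :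
  0 <= b1 -> 0 <= b2 -> 0 <= c -> 0 <= u -> 0 <= v ->
  t1 <= 16 * u -> t2 <= b1 * v -> t3 <= u -> t4 <= c * u -> t5 <= b2 * u ->
  t1 + t2 + 2 * t3 + t4 + t5 <= (16 + b1 + 2 + c + b2) * (u + v).
Proof.
move=> b10 b20 c0 u0 v0 T1 T2 T3 T4 T5.
have := mulr_ge0 b10 u0; have := mulr_ge0 b20 v0; have := mulr_ge0 c0 v0.
lra.
Qed.

(** All five terms are [O(eps^2 (1 + ln(1/eps)^2))] for [m] near [8 ln(1/eps)],
    [L1] near [eps^-2], [L2] near [eps^-5 / (2 C0)], [M0] near [eps^-3] and [K]
    near [2 eps^-2]. *)
Lemma failure_bound_small (C0 : R) : 1 <= C0 -> exists A, forall eps h,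
  0 < eps -> A <= ln eps^-1 -> 0 < h <= C0 * eps ^+ 5 ->
  exists m N L1 L2 M0 K : nat,
    [/\ N%:R <= run_bound eps, (0 < L1)%N, (0 < L2)%N & (0 < K)%N] /\
    [/\ eps * eps <= L1%:R^-1, h < L2%:R^-1, K%:R^-1 + h / 2 < eps * eps &
        failure_bound m N L1 L2 M0 K <= eps].
Proof.
move=> C1.
pose b1 : R := 6 * (9 * 9); pose b2 : R := 3 * (24 * (9 * 9)).
pose a := 16 + b1 + 2 + 24 * C0 + b2.
have b10 : 0 <= b1 by rewrite /b1; lra.
have b20 : 0 <= b2 by rewrite /b2; lra.
have a0 : 0 <= a by rewrite /a; lra.
have [A1 HA1] := eps_ln_small a0; have [Lam Lam1 HLam] := sqr_le_expR.
pose B0 := Num.max A1 (Num.max (expR Lam) 1).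
exists B0 => eps h e0; set l := ln eps^-1 => Al /andP[h0 hC].
have [Al1 [Al2 l1]] : A1 <= l /\ (expR Lam <= l /\ 1 <= l).
  by move: Al; rewrite /B0 !ge_max => /and3P[].
have small := HA1 eps e0 Al1; rewrite -/l in small.
have l0 : 0 < l by lra.
have epsE : eps = expR (- l) by rewrite expRN /l lnK ?posrE ?invr_gt0 // invrK.
have lam_big : Lam <= ln l by rewrite -ler_expR lnK.
have lam1 : 1 <= ln l by lra.
have lam_le : ln l <= l by have := expR_ge1Dx (ln l); rewrite lnK //; lra.
have l_lam : 1 <= l / ln l by rewrite ler_pdivlMr ?mul1r //; lra.
have el2 : 0 <= eps * l ^+ 2 by rewrite mulr_ge0 ?sqr_ge0 ?ltW.
have ea : eps * a <= 1.
  by apply: le_trans small; rewrite ler_wpM2l ?(ltW e0) // ler_peMr // lerDl sqr_ge0.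
have eC : 24 * (eps * C0) <= 1.
  by apply: le_trans ea; rewrite [24 * _]mulrCA ler_wpM2l ?(ltW e0) // /a; lra.
have e1 : eps < 1.
  have : eps * 16 <= eps * a by rewrite ler_wpM2l ?(ltW e0) // /a; lra.
  lra.
have ee0 : 0 < eps ^+ 2 by rewrite exprn_gt0.
have ee1 : eps ^+ 2 <= 1 by rewrite exprn_ile1 ?ltW.
have e3_0 : 0 < eps ^+ 3 by rewrite exprn_gt0.
have e3_e : eps ^+ 3 <= eps by rewrite ler_iXnr // ltW.
pose y5 := 2 * C0 * eps ^+ 5.
have y5_0 : 0 < y5 by rewrite /y5 mulr_gt0 ?exprn_gt0 //; lra.
have y5_ee : y5 <= eps ^+ 2.
  have -> : y5 = eps ^+ 2 * (2 * C0 * eps ^+ 3) by rewrite /y5; ring.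
  rewrite ler_piMr ?ltW //.
  have : C0 * eps ^+ 3 <= C0 * eps by rewrite ler_wpM2l //; lra.
  lra.
have h_y5 : 2 * h <= y5 by rewrite /y5; lra.
have [L10 eeL1 L1le] := truncn_inv ee0 ee1.
have [L20 yL2 L2le] := truncn_inv y5_0 (le_trans y5_ee ee1).
set L1 := Num.truncn (eps ^+ 2)^-1 in L10 eeL1 L1le.
set L2 := Num.truncn y5^-1 in L20 yL2 L2le.
pose q := eps^-1.
have q0 : 0 < q by rewrite invr_gt0.
have q1 : 1 <= q by rewrite invf_ge1 // ltW.
have q2 : 1 <= q ^+ 2 by rewrite exprn_ege1.
have q3 : 1 <= q ^+ 3 by rewrite exprn_ege1.
have [_ kle klt _] := @truncn_bounds (2 * q ^+ 2) ltac:(lra).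
set k := Num.truncn (2 * q ^+ 2) in kle klt.
have [_ M0le M0lt _] := @truncn_bounds (q ^+ 3) ltac:(lra).
set M' := Num.truncn (q ^+ 3) in M0le M0lt.
have [_ mle mlt _] := @truncn_bounds (8 * l) ltac:(lra).
set m := Num.truncn (8 * l) in mle mlt.
have [Nge Nle Nlt N0] := @truncn_bounds (8 * (l / ln l)) ltac:(lra).
set N := Num.truncn _ in Nge Nle Nlt N0.
exists m, N, L1, L2, M'.+1, k.+1; split; first by split.
have k0 : 0 < k.+1%:R :> R by rewrite ltr0n.
have kinv : k.+1%:R^-1 < eps ^+ 2 / 2.
  rewrite -[ltRHS]invrK ltf_pV2 ?posrE ?invr_gt0 ?divr_gt0 //.
  by rewrite invf_div -exprVn.
have kle3 : k.+1%:R <= 3 * q ^+ 2 by rewrite -[k.+1%:R]natr1; lra.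
have M2 : M'.+1%:R <= 2 * q ^+ 3 by rewrite -[M'.+1%:R]natr1; lra.
have m9 : m.+1%:R <= 9 * l by rewrite -[m.+1%:R]natr1; lra.
have NB : 8 * (l / ln l) - 1 <= N%:R by move: Nlt; rewrite -[N.+1%:R]natr1; lra.
have kh : k.+1%:R^-1 + h / 2 < eps ^+ 2.
  have h4 : h / 2 <= eps ^+ 2 / 2 by lra.
  have -> : eps ^+ 2 = eps ^+ 2 / 2 + eps ^+ 2 / 2 by lra.
  exact: ltr_leD.
rewrite -expr2; split=> //; first by lra.
have T1 := near_term epsE mlt.
have T2 := close_term m9 L1le.
have T3 : 'C(m.+1, N)%:R * N`!%:R^-1 <= eps ^+ 2.
  by rewrite expr2 epsE; apply: monotone_term => //; [exact: HLam|clear -Nge; lra].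
have T4 := crowd_term e0 M2 L2le.
have T5 := sparse_term e0 (ltn0Sn k) kle3 (ltW M0lt).
rewrite -expr2 in T1 T4 T5; rewrite -/b1 in T2; rewrite -/b2 in T5.
rewrite /failure_bound.
have fin : eps ^+ 2 * (a * (1 + l ^+ 2)) <= eps.
  by rewrite expr2 -mulrA ler_piMr // ltW.
apply: le_trans fin.
have -> : eps ^+ 2 * (a * (1 + l ^+ 2)) = a * (eps ^+ 2 + l ^+ 2 * eps ^+ 2) by ring.
apply: add_terms => //; rewrite ?(ltW ee0) //; first by rewrite mulr_ge0 // (le_trans ler01 C1).
by rewrite mulr_ge0 ?sqr_ge0 // ltW.
Qed.

Lemma size_bound_small : exists A, forall eps, A <= ln eps^-1 ->
  0 <= run_bound eps /\
  8 * (run_bound eps + 1) <= 1000%:R * (ln eps^-1 / ln (ln eps^-1)).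
Proof.
exists (expR 1) => eps; rewrite run_boundE; set l := ln eps^-1 => l1.
have l0 : 0 < l by apply: lt_le_trans l1; exact: expR_gt0.
have lam1 : 1 <= ln l by rewrite -ler_expR lnK.
have lam_le : ln l <= l by have := expR_ge1Dx (ln l); rewrite lnK //; lra.
have l_lam : 1 <= l / ln l by rewrite ler_pdivlMr ?mul1r //; lra.
set y := l / ln l in l_lam *; split; first lra.
apply: (@le_trans _ _ (128%:R * y)).
  lra.
by rewrite ler_wpM2r ?ler_nat //; lra.
Qed.

(** For [K] near [l / (4 ln l)], where [l = ln(1/eps)], the probability of a
    prescribed slot order is [(64 K)^-K >= l^-K >= exp (- l / 2)]. *)
Lemma lower_arith (C0 : R) : 0 < C0 -> exists A, forall eps h,
  0 < eps -> A <= ln eps^-1 -> 0 < h <= C0 * (ln eps^-1)^-1 ->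
  exists K : nat, [/\ (0 < K)%N, 1 / 4 * (ln eps^-1 / ln (ln eps^-1)) < K%:R,
    h <= slot_gap K & eps < (slot_gap K / 16) ^+ K].
Proof.
move=> C1; pose Lam := 2 * C0 + 32.
exists (expR Lam + 8 * C0) => eps h e0; set l := ln eps^-1 => Al /andP[h0 hC].
have El := expR_gt0 Lam.
have l0 : 0 < l by lra.
have lam_big : Lam <= ln l by rewrite -ler_expR lnK // ; lra.
have lam0 : 0 < ln l by rewrite /Lam in lam_big; lra.
have lam_sq : ln l ^+ 2 / 2 <= l.
  have := expR_ge_monomial 2 (ltW lam0); rewrite lnK //.
have lam4 : 4 * ln l <= l.
  apply: le_trans lam_sq; rewrite /Lam in lam_big.
  have : ln l * 4 <= ln l * (ln l / 2) by rewrite ler_wpM2l ?(ltW lam0) //; lra.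
  by rewrite expr2; clear; lra.
have l_lam : 4 <= l / ln l by rewrite ler_pdivlMr.
set y := l / ln l in l_lam *.
have lyE : y * ln l = l by rewrite /y divfK // gt_eqF.
pose K := (Num.truncn (1 / 4 * y)).+1.
have [_ tle tlt _] := @truncn_bounds (1 / 4 * y) ltac:(lra).
have K0 : 0 < K%:R :> R by rewrite ltr0n.
have Kle : K%:R <= y / 2 by rewrite /K -[_.+1%:R]natr1; lra.
have Cy : 2 * C0 * y <= l.
  rewrite -lyE mulrC ler_wpM2l //; first lra.
  by rewrite /Lam in lam_big; lra.
exists K; split => //.
  apply: le_trans hC _; rewrite /slot_gap ler_pdivrMr // [_^-1 * l]mulrC.
  rewrite ler_pdivlMr ?mulr_gt0 //.
  have : C0 * K%:R <= C0 * (y / 2) by rewrite ler_wpM2l // ltW.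
  lra.
have y32 : 32 * y <= l by rewrite -lyE mulrC ler_wpM2l //; [lra|rewrite /Lam in lam_big; lra].
have -> : slot_gap K / 16 = (64 * K%:R)^-1 :> R.
  by rewrite /slot_gap; field; rewrite gt_eqF.
rewrite exprVn -[ltLHS]invrK ltf_pV2 ?posrE ?invr_gt0 ?exprn_gt0 ?mulr_gt0 //.
have -> : eps^-1 = expR l by rewrite /l lnK ?posrE ?invr_gt0.
apply: (@le_lt_trans _ _ (l ^+ K)).
  by apply: lerXn2r; rewrite ?nnegrE ?mulr_ge0 ?ler0n //; lra.
rewrite -{1}(@lnK _ l) // -expRM_natr ltr_expR.
have : ln l * K%:R <= ln l * (y / 2) by rewrite ler_wpM2l // ltW.
have -> : ln l * (y / 2) = l / 2 by rewrite -[in RHS]lyE; ring.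
lra.
Qed.

End Estimates.

(** * The two bounds *)

Theorem mainTheorem3 (R : realType) :
  (* upper bound *)
  (forall h : R -> R,
    (forall eps : R, 0 < eps < 1 -> 0 < h eps) ->
    (h : R -> R^o) =O_ (0^'+) (fun eps : R => eps ^+ 5 : R^o) ->
    exists (alg : cmd) (H : R -> procedure R) (C : R),
      [/\ forall eps : R, 0 < eps < 1 -> root_procedure (H eps),
          forall eps : R, 0 < eps < 1 ->
            computes_within alg eps (h eps) (H eps)
              (fun n => C * (n%:R ^+ 2 + ln eps^-1 ^+ 2)) &
          \forall eps \near 0^'+,
            size_at_most (h eps) (H eps) (C * (ln eps^-1 / ln (ln eps^-1))) /\
            forall d (T : measurableType d) (P : probability T R) X p,
              nn_model P (h eps) X p ->
              ((1 - eps)%:E <= liminf_success P X p (H eps))%E]) /\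
  (* lower bound *)
  (forall h : R -> R,
    (forall eps : R, 0 < eps < 1 -> 0 < h eps) ->
    (h : R -> R^o) =O_ (0^'+) (fun eps : R => (ln eps^-1)^-1 : R^o) ->
    exists2 c : R, 0 < c &
      \forall eps \near 0^'+,
        forall d (T : measurableType d) (P : probability T R) X p,
          nn_model P (h eps) X p ->
          ~ exists H : procedure R,
            [/\ root_procedure H,
                size_at_most (h eps) H (c * (ln eps^-1 / ln (ln eps^-1))) &
                ((1 - eps)%:E <= liminf_success P X p H)%E]).
Proof.
split=> h h0 hO.
  have [C0 C00 hC] : exists2 C0 : R, 0 < C0 & \forall eps \near 0^'+, `|h eps| <= C0 * `|eps ^+ 5|.
    by move/eqO_exP: hO.
  have C1 : 1 <= C0 + 1 by rewrite lerDr ltW.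
  have [A1 HA1] := failure_bound_small C1.
  have [A2 HA2] := @size_bound_small R.
  exists root_finder, (finder h), 1000%:R; split.
  - by move=> eps _; exact: candidates_procedure.
  - by move=> eps _; exact: finder_computes.
  near=> eps.
  have [e0 Al1] : 0 < eps /\ A1 <= ln eps^-1 by near: eps; exact: near_small.
  have [_ Al2] : 0 < eps /\ A2 <= ln eps^-1 by near: eps; exact: near_small.
  have e1 : eps < 1 by near: eps; exact: nbhs_right_lt.
  have he0 : 0 < h eps by apply: h0; rewrite e0.
  have he : `|h eps| <= C0 * `|eps ^+ 5| by near: eps.
  have [B0 size8] := HA2 eps Al2.
  split.
    move=> n x e [y [p [s [yt _ -> _]]]]; apply: le_trans size8.
    apply: card_candidates => // v; rewrite !tnth_mktuple.
    by have [] := yt _ (ltn_ord (s^-1 v)%g).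
  move=> d T P X p M.
  have he5 : 0 < h eps <= (C0 + 1) * eps ^+ 5.
    have e50 : 0 <= eps ^+ 5 by rewrite exprn_ge0 // ltW.
    rewrite he0 /=; move: he; rewrite (gtr0_norm he0) ger0_norm // => he.
    by apply: le_trans he _; rewrite ler_wpM2r // lerDl.
  have [m [N [L1 [L2 [M0 [K [[NB L10 L20 K0] [eL hL eK fb]]]]]]]] := HA1 eps (h eps) e0 Al1 he5.
  apply: le_trans (liminf_success_ge he0 M m M0 NB L10 L20 K0 eL hL eK).
  by rewrite lee_fin lerD2l lerN2.
have [C0 C00 hC] : exists2 C0 : R, 0 < C0 & \forall eps \near 0^'+, `|h eps| <= C0 * `|(ln eps^-1)^-1|.
  by move/eqO_exP: hO.
have [A HA] := lower_arith C00.
exists (1 / 4); first by lra.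
near=> eps => d T P X p M [H [rH sizeH succ]].
have [e0 Al] : 0 < eps /\ A <= ln eps^-1 by near: eps; exact: near_small.
have [_ l1] : 0 < eps /\ 1 <= ln eps^-1 by near: eps; exact: near_small.
have e1 : eps < 1 by near: eps; exact: nbhs_right_lt.
have he0 : 0 < h eps by apply: h0; rewrite e0.
have he : `|h eps| <= C0 * `|(ln eps^-1)^-1| by near: eps.
have hl : 0 < h eps <= C0 * (ln eps^-1)^-1.
  rewrite he0 /=; move: he; rewrite (gtr0_norm he0) gtr0_norm // invr_gt0; lra.
have [K [K0 bK hK qK]] := HA eps (h eps) e0 Al hl.
have hs : 0 < h eps <= slot_gap K by rewrite he0.
have := le_trans succ (liminf_success_le M rH sizeH K0 bK hs).
by rewrite lee_fin; lra.
Unshelve. all: by end_near.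
Qed.
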